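(* 1. There is exactly one function $w_{\mathfrak{so}}:\bigsqcup_{m\ge 0}S(m)\to\mathbb{C}[C_0,C_2,C_4,\dots]$ on the set of permutations of any finite number of elements, with values in the ring of polynomials in the independent variables $C_0,C_2,C_4,\dots$ indexed by even nonnegative integers, that satisfies the $\mathfrak{so}$-relations (A1)–(A4) listed in the context. That is, the $\mathfrak{so}$-relations determine the invariant $w_{\mathfrak{so}}$ uniquely. 2. Restricted to chord diagrams (that is, to involutions without fixed points), $w_{\mathfrak{so}}$ is a weight system: the value of $w_{\mathfrak{so}}$ on the involution of a chord diagram gives a well-defined function on chord diagrams (independent of the cut point), and this function satisfies the $4$-term relations.
   Context: **Permutations.** $S(m)$ is the symmetric group on $\{1,\dots,m\}$ ($S(0)$ has one element, the empty permutation). A permutation of a finite totally ordered set $X$ is identified with an element of $S(|X|)$ via the order-preserving bijection $X\to\{1,\dots,|X|\}$. A cycle $(x_1\,x_2\dots x_\ell)$ means $x_1\mapsto x_2\mapsto\dots\mapsto x_\ell\mapsto x_1$. The concatenation of $s\in S(m)$ and $t\in S(n)$ is the permutation in $S(m+n)$ acting as $s$ on $\{1,\dots,m\}$ and as $t$ (shifted by $m$) on $\{m+1,\dots,m+n\}$. For a finite word $Q$ in distinct letters, $|Q|$ is its length and $\overline{Q}$ is the reversed word; juxtaposition of words is concatenation; words may be empty. **The $\mathfrak{so}$-relations.** A function $w$ on all permutations with values in a commutative ring with given elements $C_0,C_2,C_4,\dots$ satisfies the $\mathfrak{so}$-relations if: (A1) $w$ is multiplicative with respect to concatenation, and $w=1$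 on the empty permutation. (A2) If $s'$ is obtained from $s$ by inverting one of its cycles, of length $\ell$, then $w(s')=(-1)^{\ell}w(s)$. (A3) For even $m\ge2$, the value of $w$ on the standard cycle $1\mapsto2\mapsto\dots\mapsto m\mapsto1$ is $C_m$. (A4) (Recurrence Rule) Let $s\in S(m)$ and $1\le r<m$. Let $s'$ be the conjugate of $s$ by the transposition $(r\ r{+}1)$. Let $V$ be a new letter, and order $(\{1,\dots,m\}\setminus\{r,r+1\})\cup\{V\}$ so that $V$ occupies the place of $r,r+1$. For a collection $c$ of cycles in the letters of the cycles of $s$ through $r$ and $r+1$, with $r,r+1$ deleted and $V$ added, let $w[c]$ be the value of $w$ on the permutation of this ordered set whose cycles are those in $c$ together with all cycles of $s$ containing neither $r$ nor $r+1$. (a) If $r$ and $r+1$ lie in different cycles $(r\,P)$ and $(r{+}1\;Q)$ of $s$, with $P,Q$ possibly empty words and $a=|Q|$, then $$w(s)=w(s')+w[(V\,Q\,P)]-w[(V\,P\,Q)]+(-1)^{a}\bigl(w[(V\,P\,\overline{Q})]-w[(V\,\overline{Q}\,P)]\bigr).$$ (b) If $r$ and $r+1$ lie in the same cycle $(r\,P\;r{+}1\;Q)$ with $Q$ nonempty (i.e. $s(r+1)\ne r$) and $a=|Q|$, then $$w(s)=w(s')+w[(P)(V\,Q)]-w[(V\,P)(Q)]+(-1)^{a}\bigl(w[(V\,P\,\overline{Q})]+w[(V\,\overline{Q}\,P)]\bigr),$$ where, if $P$ is empty, the empty cycle $(P)$ is interpreted as a factor $C_0$, i.e. $w[(P)(V\,Q)]=C_0\,w[(V\,Q)]$.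 (c) If $s(r+1)=r$, i.e. the cycle is $(r\,P\;r{+}1)$, then $$w(s)=w(s')+(2-C_0)\,w[(V\,P)].$$ **Chord diagrams.** A chord diagram of order $n$ is an oriented circle with $2n$ pairwise distinct points split into $n$ disjoint pairs (chords), up to orientation-preserving diffeomorphisms of the circle. Cutting the circle at a point which is not a chord end, and numbering the chord ends $1,\dots,2n$ along the orientation, one associates to it the fixed-point-free involution in $S(2n)$ swapping the two ends of each chord. **$4$-term relations.** Let $D$ be a chord diagram, $x,y$ the two ends of one of its chords, and $z$ a point of the circle which is not a chord end. For $p\in\{x,y\}$ let $D_p^{+}$ (resp. $D_p^{-}$) be obtained from $D$ by adding a chord joining $z$ with a point immediately after (resp. before) $p$ in the sense of the orientation. A function $w$ on chord diagrams satisfies the $4$-term relations if, for all such data, $$w(D_y^{+})-w(D_y^{-})=w(D_x^{-})-w(D_x^{+}).$$ A weight system is a function on chord diagrams satisfying the $4$-term relations. *)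

(* Defs.v *)
From HB Require Import structures.
From mathcomp Require Import all_boot all_order all_fingroup all_algebra.
From mathcomp Require Import finmap complex monalg.
From mathcomp Require Import boolp classical_sets reals topology normedtype derive.

Set Implicit Arguments.
Unset Strict Implicit.
Unset Printing Implicit Defensive.

Import Order.TTheory GRing.Theory Num.Theory.
Import numFieldNormedType.Exports.

Local Open Scope ring_scope.

Notation coef_ring R := {malg R[i][{cmonom nat}]}.

(* The variable indexed by k is C_{2k}, so that a value c : nat -> A stands
   for the family C_0, C_2, C_4, ..., with C_m = c m./2 for even m. *)
Definition Cvar (R : realType) (k : nat) : coef_ring R := << ucm k >>.

Lemma concat_fun_inj m n (s : 'S_m) (t : 'S_n) :
  injective (fun i : 'I_(m + n) => match split i with
                                   | inl j => lshift n (s j)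
                                   | inr j => rshift m (t j)
                                   end).
Proof.
move=> i j; rewrite -{2}(splitK i) -{2}(splitK j).
case: (split i) => k; case: (split j) => l /= /eqP.
- by rewrite eq_lshift => /eqP /perm_inj ->.
- by rewrite eq_lrshift.
- by rewrite eq_rlshift.
- by rewrite eq_rshift => /eqP /perm_inj ->.
Qed.

Definition concat_perm m n (s : 'S_m) (t : 'S_n) : 'S_(m + n) :=
  perm (concat_fun_inj (s := s) (t := t)).

Definition std_cycle m : 'S_m := perm (@ordS_inj m).

Lemma invert_fun_inj m (s : 'S_m) (x : 'I_m) :
  injective (fun y => if y \in porbit s x then (s^-1)%g y else s y).
Proof.
have sE y : (s y \in porbit s x) = (y \in porbit s x).
  by rewrite -!eq_porbit_mem -[in RHS](porbit_perm s 1 y) expg1.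
have sV y : ((s^-1)%g y \in porbit s x) = (y \in porbit s x).
  by rewrite -[in RHS](permKV s y) sE.
move=> y z; case: ifP => yx; case: ifP => zx.
- exact: perm_inj.
- by move=> e; rewrite -sV e sE zx in yx.
- by move=> e; rewrite -sV -e sE yx in zx.
- exact: perm_inj.
Qed.

Definition invert_cycle m (s : 'S_m) (x : 'I_m) : 'S_m :=
  perm (invert_fun_inj (s := s) (x := x)).

(* The permutation with underlying function f; the fallback to the identity
   for non-injective f is never used on the functions below. *)
Definition insub_perm (T : finType) (f : T -> T) : {perm T} :=
  insubd (1%g : {perm T}) ([ffun x => f x] : {ffun T -> T}).

Section Recurrence.
Variables (A : comNzRingType) (c : nat -> A) (w : forall m, 'S_m -> A).
Variables (n : nat) (s : 'S_n.+2) (r : 'I_n.+1).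

(* The neighbouring letters r and r+1 among the n+2 letters 0, ..., n+1. *)
Definition letr : 'I_n.+2 := widen_ord (leqnSn _) r.
Definition letr1 : 'I_n.+2 := lift ord0 r.

(* The ordered set of letters other than r, r+1, with V added at their place,
   is identified with 'I_n.+1, where V is r.  The map [collapse] sends a
   letter to its new number (and r, r+1 to V); [expand] is its inverse away
   from r, r+1, V. *)
Definition letV : 'I_n.+1 := r.
Definition collapse (x : 'I_n.+2) : 'I_n.+1 := odflt letV (unlift letr1 x).
Definition expand (x : 'I_n.+1) : 'I_n.+2 := lift letr1 x.

(* The permutation with the cycles in cs, and s elsewhere. *)
Definition subst_perm (cs : seq (seq 'I_n.+1)) : 'S_n.+1 :=
  insub_perm
    (foldr (fun (p : seq 'I_n.+1) f x => if x \in p then next p x else f x)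
              (fun x => collapse (s (expand x))) cs).

(* The value w[cs], each empty cycle contributing a factor C_0. *)
Definition bracket (cs : seq (seq 'I_n.+1)) : A :=
  c 0%N ^+ count (@nilp _) cs * w (subst_perm cs).

Definition conj_adj : 'S_n.+2 := (s ^ tperm letr letr1)%g.

(* The word p is a cycle of s iff [ufcycle s p], i.e., p has distinct letters
   and s maps each letter of p to the cyclically next one. *)
Definition recurrence_rule : Prop :=
  [/\ forall P Q : seq 'I_n.+2,
        letr \notin porbit s letr1 ->
        ufcycle s (letr :: P) -> ufcycle s (letr1 :: Q) ->
        let P' := map collapse P in let Q' := map collapse Q in
        w s = w conj_adj
              + bracket [:: letV :: Q' ++ P'] - bracket [:: letV :: P' ++ Q']
              + (-1) ^+ size Q * (bracket [:: letV :: P' ++ rev Q']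
                                  - bracket [:: letV :: rev Q' ++ P']),
      forall P Q : seq 'I_n.+2,
        Q != [::] ->
        ufcycle s (letr :: P ++ letr1 :: Q) ->
        let P' := map collapse P in let Q' := map collapse Q in
        w s = w conj_adj
              + bracket [:: P'; letV :: Q'] - bracket [:: letV :: P'; Q']
              + (-1) ^+ size Q * (bracket [:: letV :: P' ++ rev Q']
                                  + bracket [:: letV :: rev Q' ++ P'])
    & forall P : seq 'I_n.+2,
        ufcycle s (letr :: P ++ [:: letr1]) ->
        w s = w conj_adj + (2 - c 0%N) * bracket [:: letV :: map collapse P]].

End Recurrence.

Record so_relations (A : comNzRingType) (c : nat -> A)
    (w : forall m, 'S_m -> A) : Prop := SoRelations {
  so_empty : w 0 1%g = 1;
  so_concat : forall m n (s : 'S_m) (t : 'S_n),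
    w (m + n)%N (concat_perm s t) = w m s * w n t;
  so_invert : forall m (s : 'S_m) (x : 'I_m),
    w m (invert_cycle s x) = (-1) ^+ #|porbit s x| * w m s;
  so_std : forall m, (2 <= m)%N -> ~~ odd m -> w m (std_cycle m) = c m./2;
  so_recurrence : forall n (s : 'S_n.+2) (r : 'I_n.+1),
    recurrence_rule c w s r
}.

Section Circle.
Variable R : realType.

(* The circle R/Z, a point being given by its representative in [0, 1), with
   the orientation of increasing reals. *)
Definition circle := {x : R | 0 <= x < 1}.

(* The length, in [0, 1), of the arc going from x to y along the orientation. *)
Definition arc_len (x y : circle) : R :=
  if val x <= val y then val y - val x else val y - val x + 1.

Definition smooth (F : R -> R) : Prop :=
  forall k x, derivable (derive1n k F : R -> R) x 1.

(* Orientation-preserving diffeomorphisms of R/Z: the maps induced by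
   increasing diffeomorphisms F of R commuting with the translation by 1. *)
Definition circle_diffeo (h : circle -> circle) : Prop :=
  exists F G : R -> R,
    [/\ smooth F /\ smooth G, cancel F G /\ cancel G F,
        {homo F : x y / x < y}, forall x, F (x + 1) = F x + 1
      & forall x : circle, exists k : int, F (val x) = val (h x) + k%:~R].

Definition is_chord_set (D : {fset {fset circle}}) : bool :=
  [forall a : D, #|` fsval a| == 2%N] &&
  [forall a : D, forall b : D,
     (a != b) ==> [disjoint fsval a & fsval b]%fset].

(* A representative of a chord diagram: the set of its chords, each of which
   is the set of its two ends.  Diagrams are taken up to [same_diagram]. *)
Definition chord_diagram := {D : {fset {fset circle}} | is_chord_set D}.

Implicit Types D : chord_diagram.

Definition nchords D : nat := #|` val D|.

Definition ends D : {fset circle} := (\bigcup_(a <- val D) a)%fset.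

Definition same_diagram D D' : Prop :=
  exists2 h, circle_diffeo h
    & val D' = [fset [fset h x | x in (a : {fset circle})] | a in val D]%fset.

(* The ends in the order in which they are met along the orientation,
   starting from the cut point p. *)
Definition ends_from D (p : circle) : seq circle :=
  sort (fun x y => arc_len p x <= arc_len p y) (ends D).

Definition cut_perm D (p : circle) : 'S_((nchords D).*2) :=
  let e (i : 'I_((nchords D).*2)) := nth p (ends_from D p) i in
  insub_perm (fun i => odflt i [pick j | [fset e i; e j]%fset \in val D]).

(* q lies immediately after (resp. before) the end x, with no end of D and no
   marked point z in between. *)
Definition just_after D (z x q : circle) : Prop :=
  0 < arc_len x q /\
  forall y, y \in (z |` ends D)%fset -> y != x -> arc_len x q < arc_len x y.
Definition just_before D (z x q : circle) : Prop :=
  0 < arc_len q x /\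
  forall y, y \in (z |` ends D)%fset -> y != x -> arc_len q x < arc_len y x.

Definition add_chord D (z q : circle) D' : Prop :=
  val D' = ([fset z; q] |` val D)%fset.

Definition four_term (A : zmodType) (f : chord_diagram -> A) : Prop :=
  forall D (x y z : circle),
    [fset x; y]%fset \in val D -> z \notin ends D ->
  forall (xp xm yp ym : circle) (Dxp Dxm Dyp Dym : chord_diagram),
    just_after D z x xp -> add_chord D z xp Dxp ->
    just_before D z x xm -> add_chord D z xm Dxm ->
    just_after D z y yp -> add_chord D z yp Dyp ->
    just_before D z y ym -> add_chord D z ym Dym ->
  f Dyp - f Dym = f Dxm - f Dxp.

(* A function on chord diagrams, i.e., on classes of [same_diagram], that
   satisfies the 4-term relations. *)
Definition weight_system (A : zmodType) (f : chord_diagram -> A) : Prop :=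
  (forall D D', same_diagram D D' -> f D = f D') /\ four_term f.

End Circle.

(* Main.v *)
(* Uniqueness: modulo values at permutations of fewer letters the recurrence
   rule makes w conjugation invariant, so by multiplicativity only standard
   cycles matter; an odd cycle is conjugate to its inverse, whence 2 w of it is
   determined by values at fewer letters.

   Existence: if F_ij are the generators of so(N), i.e. F_ij = - F_(bar j)(bar i),
   then w(s) = sum_i prod_a F_(i_a, i_(s a)) satisfies the so-relations with
   C_0 = N and C_m the m-th Casimir element, and acts by a scalar on every
   highest weight vector; these are realised by monomials in a fermionic Fock
   space.  The recurrence reduces w(s) to a polynomial in the C_m; it does not
   depend on the reduction, since polynomials are separated by the eigenvalues:
   the leading term of C_2k at the weight lambda is 2 sum_i lambda_i ^ (2k), and
   such power sums together with N satisfy no polynomial relation.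

   Chord diagrams: exchanging neighbouring ends of two different chords changes
   w by 4 times its value at a permutation in which the two chords are replaced
   by a 3-cycle.  When the cut point moves past an end of a chord, these
   contributions cancel in pairs, and in the 4-term relation both sides equal
   the same contribution. *)
From HB Require Import structures.
Require Import Defs.
From mathcomp Require Import all_boot all_order all_fingroup all_algebra.
From mathcomp Require Import finmap complex monalg reals.
From mathcomp Require Import boolp zify ring lra.

Set Implicit Arguments.
Unset Strict Implicit.
Unset Printing Implicit Defensive.

Import Order.TTheory GRing.Theory Num.Theory.
Local Open Scope ring_scope.

(** One lemma, [reduction], carries every reduction: a subgroup B of values, closed under halving,
    compatible with concatenation and containing the even standard cycles, contains all values as
    soon as adjacent conjugation changes them by elements of B modulo smaller permutations. It is
    used with three choices of B: pairs of equal values (uniqueness), multiples of the highest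
    weight vector (so that neither centrality of [op F s] nor irreducibility has to be discussed),
    and functions of the weight that come from a polynomial (existence). Since these values are
    pairs, vectors and functions, the rule is restated for an abelian group with an operator in the
    role of C_0.

    In the model the factors do not commute: the order of the letters is the order of the factors,
    and the recurrence is the commutator of two neighbouring factors. Its plain terms give the
    brackets without reversal, its mirror terms those with a reversed word.

    C_0 needs no separate argument in the separation step: with N = 2M its value 2M is the power sum
    of exponent 0. *)

Lemma perm_eq_swap_ind (T : eqType) (Q : seq T -> Prop) :
  (forall e1 x y e2, Q (e1 ++ x :: y :: e2) -> Q (e1 ++ y :: x :: e2)) ->
  forall e e', perm_eq e e' -> Q e -> Q e'.
Proof.
(* The prefix [p] holds the letters already in place: the first letter of [e] is put in front of the
   remaining letters of [e'] and then swapped rightwards to its position in [e']. *)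
move=> swapQ e e' ee'; rewrite -[e]cat0s -[e']cat0s; move: [::] => p.
elim: e p e' ee' => [|x e IHe] p e' ee'.
  by move: ee'; rewrite perm_sym => /perm_nilP ->.
have xe' : x \in e' by rewrite -(perm_mem ee') mem_head.
rewrite -cat_rcons => /IHe; case/splitPr: xe' ee' => e1 e2 ee' /(_ (e1 ++ e2)).
have -> : perm_eq e (e1 ++ e2).
  by rewrite -(perm_cons x) (perm_trans ee') // -[x :: e2]cat1s perm_catCA.
move/(_ isT); clear - swapQ; elim: e1 p => [|y e1 IH] p; rewrite cat_rcons // => /swapQ Qp.
by rewrite /= -(cat_rcons y p); apply: IH; rewrite !cat_rcons.
Qed.

(** * Permutations as words and uniqueness *)

Section Words.
Variables (T : eqType) (x0 : T).
Implicit Types (e : seq T) (f : T -> T).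

(* Permutations are handled as words of labelled letters, so that moving or
   deleting a letter does not renumber the others. *)
Definition rep m (s : 'S_m) e f :=
  size e = m /\ forall i : 'I_m, nth x0 e (s i) = f (nth x0 e i).

(** In a word without repetition positions and letters determine each other. The sizes are tied to
    the word by equations, so no cast between symmetric groups appears. *)
Lemma rep_eq (G : Type) (w : forall m, 'S_m -> G) e f f' m (s : 'S_m)
    m' (s' : 'S_m') :
  uniq e -> {in e, f =1 f'} -> rep s e f -> rep s' e f' -> w m s = w m' s'.
Proof.
move=> ue ff' [em sP] [em' s'P]; subst m; subst m'.
congr (w _ _); apply/permP => i; apply: val_inj; apply/eqP.
by rewrite -(nth_uniq x0 _ _ ue) ?ltn_ord // sP s'P ff' // mem_nth.
Qed.

Lemma nth_swap e1 x y e2 n (r : 'I_n.+1) (i : 'I_n.+2) : r = size e1 :> nat ->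
  nth x0 (e1 ++ y :: x :: e2) i
  = nth x0 (e1 ++ x :: y :: e2) (tperm (letr r) (letr1 r) i).
Proof.
move=> re1; case: tpermP => [->|->|ir ir1].
- by rewrite !nth_cat /= /bump /= add1n re1 ltnn subnn ifN ?subSnn // -leqNgt.
- by rewrite !nth_cat /= /bump /= add1n re1 ltnn subnn ifN ?subSnn // -leqNgt.
- rewrite !nth_cat; case: ltnP => // le1i.
  case E: (i - size e1)%N => [|[|k]] //.
    by case: ir; apply: val_inj; rewrite /= re1 -(subnK le1i) E.
  by case: ir1; apply: val_inj; rewrite /= re1 -(subnK le1i) E.
Qed.

(** In terms of labelled letters, an adjacent conjugation leaves [f] alone and only exchanges two
    neighbours of the word. *)
Lemma rep_swap e1 x y e2 f n (s : 'S_n.+2) (r : 'I_n.+1) :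
  r = size e1 :> nat -> rep s (e1 ++ x :: y :: e2) f ->
  rep (conj_adj s r) (e1 ++ y :: x :: e2) f.
Proof.
move=> re1 [es sP]; split=> [|i]; first by rewrite -es !size_cat.
rewrite !(@nth_swap _ x y _ _ r) // /conj_adj /conjg !permM tpermV tpermK sP.
by [].
Qed.

End Words.

Lemma conj_adj_conj n (Q : 'S_n.+2 -> Prop) :
  (forall s r, Q s -> Q (conj_adj s r)) -> forall s g, Q s -> Q (s ^ g)%g.
Proof.
move=> adjQ s g Qs.
(* [s] read off the sorted arrangement is [s] itself, and read off the arrangement by [g^-1] it is
   the conjugate by [g]; swaps connect the two arrangements. *)
pose QQ e := forall t, rep ord0 t e s -> Q t.
have ue : uniq (map (g^-1)%g (enum 'I_n.+2)).
  by rewrite map_inj_uniq ?enum_uniq //; apply: perm_inj.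
have nthe (i : 'I_n.+2) : nth ord0 (map (g^-1)%g (enum 'I_n.+2)) i = (g^-1)%g i.
  by rewrite (nth_map ord0) ?size_enum_ord // nth_ord_enum.
suff: QQ (map (g^-1)%g (enum 'I_n.+2)).
  apply; split=> [|i]; first by rewrite size_map size_enum_ord.
  by rewrite !nthe /conjg !permM permK.
apply: (@perm_eq_swap_ind _ QQ _ (enum 'I_n.+2)).
- move=> e1 x y e2 Qe t te.
  have re1 : (size e1 < n.+1)%N.
    have [+ _] := te; rewrite size_cat /= !addnS => /eq_add_S/eq_add_S en.
    by rewrite ltnS (leq_trans (leq_addr _ _) (eq_leq en)).
  have /Qe := rep_swap (r := Ordinal re1) erefl te.
  move/(adjQ _ (Ordinal re1)); rewrite /conj_adj -conjgM -{2}tpermV mulgV.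
  by rewrite conjg1.
- apply: uniq_perm => //; first exact: enum_uniq.
  move=> x; rewrite mem_enum inE; apply/esym/mapP; exists (g x) => //.
    by rewrite mem_enum.
  by rewrite permK.
- move=> t [_ tP]; suff -> : t = s by [].
  by apply/permP => i; have := tP i; rewrite !nth_ord_enum.
Qed.

Lemma split_concat a b (t : 'S_(a + b)) :
  (forall i : 'I_a, (t (lshift b i) < a)%N) ->
  exists t1 t2, t = concat_perm t1 t2.
Proof.
move=> tl.
have inj1 : injective (fun i => Ordinal (tl i)).
  move=> i j [] e; apply: (@lshift_inj a b); apply: (@perm_inj _ t).
  exact: val_inj.
pose t1 := perm inj1.
have t1E i : t (lshift b i) = lshift b (t1 i).
  by apply: val_inj; rewrite permE.
have tr (j : 'I_b) : (t (rshift a j) - a < b)%N.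
  case: (splitP (t (rshift a j))) => [i ti|k ->]; last by rewrite addKn.
  have /perm_inj/eqP : t (rshift a j) = t (lshift b ((t1^-1)%g i)).
    by apply: val_inj; rewrite t1E permKV.
  by rewrite eq_rlshift.
have trE (j : 'I_b) : t (rshift a j) = rshift a (Ordinal (tr j)).
  apply: val_inj => /=; rewrite subnKC //.
  case: (splitP (t (rshift a j))) => [i ti|k ->]; last by rewrite leq_addr.
  have /perm_inj/eqP : t (rshift a j) = t (lshift b ((t1^-1)%g i)).
    by apply: val_inj; rewrite t1E permKV.
  by rewrite eq_rlshift.
have inj2 : injective (fun j => Ordinal (tr j)).
  move=> i j e; apply: (@rshift_inj a b); apply: (@perm_inj _ t).
  by rewrite !trE e.
exists t1, (perm inj2); apply/permP => i; rewrite permE.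
case: (splitP i) => j ij.
  by rewrite (_ : i = lshift b j) ?t1E //; apply: val_inj.
by rewrite (_ : i = rshift a j) ?trE ?permE //; apply: val_inj.
Qed.

Lemma conj_std_or_concat n (s : 'S_n.+1) : exists g,
  (s ^ g)%g = std_cycle n.+1 \/
  exists a b (e : (a + b = n.+1)%N) t1 t2,
    [/\ (a < n.+1)%N, (b < n.+1)%N
      & (s ^ g)%g = cast_perm e (@concat_perm a b t1 t2)].
Proof.
set x : 'I_n.+1 := ord0; set l := #|porbit s x|.
set tr := traject s x l.
(* The cycle of the letter 0 in its own order, then the other letters. Conjugating by the position
   in [e] makes this cycle standard on the first [l] letters, so that the rest splits off as a
   block. *)
set e := tr ++ [seq y <- enum 'I_n.+1 | y \notin tr].
have ue : uniq e.
  rewrite cat_uniq uniq_traject_porbit filter_uniq ?enum_uniq // andbT.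
  by apply/hasPn => y; rewrite mem_filter => /andP[].
have mem_e y : y \in e.
  by rewrite mem_cat mem_filter mem_enum andbT orbN.
have se : size e = n.+1.
  by rewrite (@perm_size _ _ (enum 'I_n.+1)) ?size_enum_ord //;
    apply: uniq_perm => // [|y]; rewrite ?enum_uniq // mem_e mem_enum.
have ginj : injective (fun i : 'I_n.+1 => nth x e i).
  by move=> i j /eqP; rewrite nth_uniq ?se // => /eqP /val_inj.
pose g := ((perm ginj)^-1)%g.
have l_gt0 : (0 < l)%N by apply/card_gt0P; exists x; apply: porbit_id.
have l_le : (l <= n.+1)%N by rewrite -se size_cat size_traject leq_addr.
have gE i : (g^-1)%g i = nth x e i by rewrite /g invgK permE.
have sgE (i : 'I_n.+1) : (i < l)%N ->
    (s ^ g)%g i = (if i.+1 == l then 0 else i.+1)%N :> nat.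
  move=> il; suff : nth x e ((s ^ g)%g i)
      = nth x e (if i.+1 == l then 0 else i.+1)%N.
    move/eqP; rewrite nth_uniq ?se //; first by move/eqP.
    by case: ifP => // /negbT; rewrite neq_ltn [(l < _)%N]ltnNge il orbF => /leq_trans; apply.
  have -> : nth x e ((s ^ g)%g i) = s (nth x e i).
    by rewrite -!gE /conjg !permM permK.
  have nthl j : (j < l)%N -> nth x e j = iter j s x.
    by move=> jl; rewrite nth_cat size_traject jl nth_traject.
  rewrite nthl // -iterS; case: ifP => [/eqP ->|/negbT il1].
    by rewrite nthl // iter_porbit.
  by rewrite nthl // ltn_neqAle il1.
exists g; move: (s ^ g)%g sgE => sg sgE; have [le|lne] := eqVneq l n.+1.
  left; apply/permP => i; apply: val_inj; rewrite /= sgE ?le // permE /=.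
  rewrite eqSS; case: eqVneq => [->|ni]; first by rewrite modnn.
  by rewrite modn_small // ltnS ltn_neqAle ni -ltnS ltn_ord.
have ln : (l < n.+1)%N by rewrite ltn_neqAle lne.
have e1 : (l + (n.+1 - l) = n.+1)%N by rewrite subnKC.
right; exists l, (n.+1 - l)%N, e1.
have [|t1 [t2 t12]] := @split_concat _ _ (cast_perm (esym e1) sg).
  move=> i; rewrite cast_permE /= esymK sgE //=.
  by case: ifP => // /negbT il; rewrite ltn_neqAle il ltn_ord.
exists t1, t2; split=> //; first by rewrite ltn_subrL l_gt0.
by rewrite -t12 cast_permKV.
Qed.

(** Induction on the number of letters. The step for standard cycles has all smaller permutations at
    its disposal, which odd cycles need; the step for conjugation has those with one letter fewer,
    where the brackets of the recurrence live. *)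
Lemma perm_induction (P : forall m, 'S_m -> Prop) :
  P 0 1%g ->
  (forall m n (s : 'S_m) (t : 'S_n), P m s -> P n t -> P _ (concat_perm s t)) ->
  (forall m, (forall k (t : 'S_k), (k < m)%N -> P k t) -> (0 < m)%N ->
     P m (std_cycle m)) ->
  (forall n (s : 'S_n.+2) r, (forall t : 'S_n.+1, P _ t) ->
     P _ s -> P _ (conj_adj s r)) ->
  forall m (s : 'S_m), P m s.
Proof.
move=> P0 Pconcat Pstd Pconj m s; have [n] := ubnP m; elim: n m s => // n IHn m s.
rewrite ltnS => mn; have {}IHn k (t : 'S_k) : (k < m)%N -> P k t.
  by move=> km; apply/IHn/(leq_trans km).
case: m s mn IHn => [|m] s mn IHn; first by rewrite (permS0 s).
have {}Pconj (t g : 'S_m.+1) : P _ t -> P _ (t ^ g)%g.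
  case: m => [|m] in t g s mn IHn *; first by rewrite [(t ^ g)%g]permS1 [t]permS1.
  apply: conj_adj_conj => {}t r; apply: Pconj => t'; exact: IHn.
have [g sg] := conj_std_or_concat s.
rewrite -[s](conjgK g); apply: Pconj; case: sg => [->|]; first exact: Pstd.
move=> [a [b [e [t1 [t2 [am bm ->]]]]]]; 
have Pcast k l (kl : k = l) (t : 'S_k) : P k t -> P l (cast_perm kl t).
  by case: l / kl; rewrite cast_perm_id.
by apply/Pcast/Pconcat; apply: IHn.
Qed.

Lemma std_cycle_porbit m (x y : 'I_m) : y \in porbit (std_cycle m) x.
Proof.
case: m x y => [[]//|m] x y.
suff all0 z : z \in porbit (std_cycle m.+1) ord0.
  by have := all0 x; rewrite -eq_porbit_mem => /eqP ->.
case: z => z zm; elim: z zm => [|z IHz] zm.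
  by rewrite (_ : Ordinal zm = ord0) ?porbit_id //; apply: val_inj.
have := IHz (ltnW zm); rewrite -!eq_porbit_mem => /eqP <-.
rewrite -(porbit_perm _ 1 (Ordinal (ltnW zm))) expg1; apply/eqP.
by congr porbit; apply: val_inj; rewrite permE /= modn_small.
Qed.

Lemma std_cycle_rev m : exists g, (std_cycle m ^ g = (std_cycle m)^-1)%g.
Proof.
exists (perm (@rev_ord_inj m)); apply/permP => i; apply: (@perm_inj _ (std_cycle m)).
rewrite permKV -(rev_ordK i); move: (rev_ord i) => {i} j.
rewrite -(permE (@rev_ord_inj m)) permJ; apply: val_inj; rewrite !permE /=.
case: j => i im /=; have [im1|ni] := eqVneq i.+1 m; last first.
  have im1 : (i.+1 < m)%N by rewrite ltn_neqAle ni.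
  by rewrite (modn_small im1) subnSK // modn_small // ltn_subrL (leq_trans _ im).
by rewrite im1 modnn; case: m im1 im => // m [->] _; rewrite subSS subn0 subnn modnn.
Qed.

Lemma invert_std_cycle m (x : 'I_m) :
  invert_cycle (std_cycle m) x = ((std_cycle m)^-1)%g.
Proof. by apply/permP => y; rewrite permE std_cycle_porbit. Qed.

Lemma card_porbit_std_cycle m (x : 'I_m) : #|porbit (std_cycle m) x| = m.
Proof.
by rewrite -[RHS]card_ord; apply: eq_card => y; rewrite std_cycle_porbit.
Qed.

Section Reduction.
Variables (G : zmodType) (w : forall m, 'S_m -> G) (B : G -> Prop).
Arguments w {m} _.
Hypothesis BB : forall x y, B x -> B y -> B (x - y).
Hypothesis Bhalf : forall x, B (x + x) -> B x.
Hypothesis B_empty : B (@w 0 1%g).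
Hypothesis B_concat : forall m n (s : 'S_m) (t : 'S_n),
  B (w s) -> B (w t) -> B (w (concat_perm s t)).
Hypothesis B_std : forall m, (2 <= m)%N -> ~~ odd m -> B (w (std_cycle m)).
Hypothesis w_invert : forall m (s : 'S_m) x,
  w (invert_cycle s x) = if odd #|porbit s x| then - w s else w s.
Hypothesis B_step : forall n (s : 'S_n.+2) r,
  (forall t : 'S_n.+1, B (w t)) -> B (w s - w (conj_adj s r)).

(** Even standard cycles lie in B by assumption; an odd one is conjugate to its inverse, which has
    the opposite value, so its double lies in B. *)
Lemma reduction m (s : 'S_m) : B (w s).
Proof.
have B0 : B 0 by rewrite -(subrr (@w 0 1%g)); apply: BB.
have BN x : B x -> B (- x) by rewrite -[- x]sub0r; apply: BB.
apply: (perm_induction (P := fun m s => B (@w m s))) => {m s} //.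
- move=> m IHm m_gt0; have [om|em] := boolP (odd m); last first.
    by case: m em m_gt0 {IHm} => [|[|m]] // em _; apply: B_std.
  have conjB (t g : 'S_m) : B (w t - w (t ^ g)%g).
    case: m g IHm t {om m_gt0} => [|[|m]] g IHm t.
    - by rewrite [(t ^ g)%g]permS0 [t]permS0 subrr.
    - by rewrite [(t ^ g)%g]permS1 [t]permS1 subrr.
    - apply: (@conj_adj_conj _ (fun t' => B (w t - w t'))); last by rewrite subrr.
      move=> t' r Bt'; rewrite -(subrK (w t') (w t)) -addrA -[X in _ + X]opprK.
      by apply/BB/BN/B_step => // t''; apply: IHm.
  have x : 'I_m by exists 0%N.
  have [g sg] := std_cycle_rev m.
  (* Conjugating by the reversal [g] inverts the cycle; as its length is odd, the difference in
     [conjB] is the double of its value. *)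
  apply: Bhalf; have := conjB (std_cycle m) g.
  by rewrite sg -(invert_std_cycle x) w_invert card_porbit_std_cycle om opprK.
- by move=> n s r IH Bs; rewrite -[w _](subKr (w s)); apply/BB/B_step.
Qed.

End Reduction.

Lemma path_sub_in (T : eqType) (e e' : rel T) x p :
  (forall a b, a \in x :: p -> b \in p -> e a b -> e' a b) ->
  path e x p -> path e' x p.
Proof.
elim: p x => //= y p IHp x ee' /andP[exy py]; rewrite ee' ?mem_head //=.
by apply: IHp py => a b ap bp; apply: ee'; rewrite inE ?ap ?bp orbT.
Qed.

Lemma fcycle_mem (T : finType) (s : {perm T}) p a :
  fcycle s p -> (s a \in p) = (a \in p).
Proof.
move=> cp; apply/idP/idP => [sap|]; last exact: mem_fcycle.
have := prev_cycle cp sap => /eqP /perm_inj <-.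
by rewrite mem_prev.
Qed.

Lemma fcycle_rcons (T : finType) (s : {perm T}) x p :
  fcycle s (x :: p) = fpath s x p && (s (last x p) == x).
Proof. by rewrite /= rcons_path. Qed.

Lemma porbit_word (T : finType) (s : {perm T}) x : exists p,
  [/\ ufcycle s (x :: p), porbit s x =i x :: p & #|porbit s x| = (size p).+1].
Proof.
have := uniq_traject_porbit s x; have := iter_porbit s x.
have := porbit_traject s x.
case E: #|porbit s x| => [|k] op it ut.
  by move/eqP: E; rewrite (negPf (card_porbit_neq0 _ _)).
exists (traject s (s x) k); split=> //; last by rewrite size_traject.
apply/andP; split=> //=; rewrite -[X in rcons _ X]it iterSr -trajectSr.
exact: fpath_traject.
Qed.

(** The cases (a), (b), (c) of the recurrence rule are exhaustive. *)
Lemma adj_words n (s : 'S_n.+2) (r : 'I_n.+1) :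
  [\/ exists P Q, [/\ letr r \notin porbit s (letr1 r),
        ufcycle s (letr r :: P) & ufcycle s (letr1 r :: Q)],
      exists P Q, Q != [::] /\ ufcycle s (letr r :: P ++ letr1 r :: Q)
    | exists P, ufcycle s (letr r :: P ++ [:: letr1 r])].
Proof.
have [P [cP oP _]] := porbit_word s (letr r).
have [Q [cQ oQ _]] := porbit_word s (letr1 r).
have [|rr1] := boolP (letr1 r \in letr r :: P); last first.
  by constructor 1; exists P, Q; rewrite porbit_sym oP.
rewrite inE; case: eqP => [/(congr1 val)/= /eqP|_ /= /splitPr r1P].
  by rewrite /bump /= add1n; lia.
case: r1P cP => P1 [|q P2] cP; first by constructor 3; exists P1.
by constructor 2; exists P1, (q :: P2).
Qed.

Lemma insub_permE (T : finType) (f : T -> T) : injective f -> insub_perm f =1 f.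
Proof.
move=> finj x; rewrite /insub_perm -pvalE insubdK ?ffunE //.
by apply/injectiveP => y z; rewrite !ffunE => /finj.
Qed.

Lemma eq_insub_perm (T : finType) (f g : T -> T) :
  f =1 g -> insub_perm f = insub_perm g.
Proof.
by move=> fg; rewrite /insub_perm; congr insubd; apply/ffunP => x; rewrite !ffunE.
Qed.

(** * Merging two neighbouring letters *)

Section Delete.
Variables (n : nat) (r : 'I_n.+1).
Local Notation V := (letV r).
Local Notation lr := (letr r).
Local Notation lr1 := (letr1 r).
Local Notation col := (collapse r).

Lemma letr_neq : lr != lr1.
Proof. by rewrite -val_eqE /= /bump /= add1n; lia. Qed.

Lemma expandV : lift lr1 V = lr.
Proof. by apply: val_inj; rewrite /= /bump /= /bump /= add1n ltnn. Qed.

Lemma collapse_letr1 : col lr1 = V.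
Proof. by rewrite /collapse unlift_none. Qed.

Lemma expandK b : col (lift lr1 b) = b.
Proof. by rewrite /collapse liftK. Qed.

Lemma collapse_letr : col lr = V.
Proof. by rewrite -expandV expandK. Qed.

Lemma collapseK a : a != lr1 -> lift lr1 (col a) = a.
Proof.
by rewrite eq_sym => /unlift_some[b ab ub]; rewrite /collapse ub.
Qed.

(** Making room at r or at r+1 differs only in which of the two neighbours V becomes, hence by their
    transposition. *)
Lemma lift_letr b : lift lr b = tperm lr lr1 (lift lr1 b).
Proof.
have [->|bV] := eqVneq b V.
  by rewrite expandV tpermL; apply: val_inj; rewrite /= /bump leqnn.
rewrite tpermD.
- apply: val_inj; rewrite /= /bump /= /bump /= !add1n.
  have : (b : nat) != r by [].
  by case: ltngtP.
- by apply: contra bV => /eqP e; rewrite -[b]expandK -e collapse_letr.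
- by rewrite neq_lift.
Qed.

Definition adjacent_pair (x y : 'I_n.+2) :=
  (x, y) = (lr, lr1) \/ (x, y) = (lr1, lr).

Section Pair.
Variables x y : 'I_n.+2.
Hypothesis xy : adjacent_pair x y.

Lemma pair_neq : x != y.
Proof.
by case: xy => -[-> ->]; rewrite ?[lr1 == _]eq_sym letr_neq.
Qed.

Lemma collapse_x : col x = V.
Proof. by case: xy => -[-> _]; rewrite (collapse_letr, collapse_letr1). Qed.

Lemma collapse_y : col y = V.
Proof. by case: xy => -[_ ->]; rewrite (collapse_letr, collapse_letr1). Qed.

Lemma liftV : lift x V = y.
Proof. by case: xy => -[-> ->]; rewrite ?lift_letr expandV ?tpermL. Qed.

Lemma lift_expand b : b != V -> lift x b = expand r b.
Proof.
move=> bV; case: xy => -[-> _] //; rewrite lift_letr tpermD //.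
  by apply: contra bV => /eqP e; rewrite -[b]expandK -e collapse_letr.
by rewrite neq_lift.
Qed.

Lemma collapse_lift b : col (lift x b) = b.
Proof.
have [->|bV] := eqVneq b V; first by rewrite liftV collapse_y.
by rewrite lift_expand // expandK.
Qed.

Lemma lift_collapse a : a != x -> lift x (col a) = a.
Proof.
rewrite eq_sym => /unlift_some[b ab _]; by rewrite ab collapse_lift.
Qed.

Variable s : 'S_n.+2.

(* The brackets of the recurrence rule without reversed words are values at
   such permutations, for (x, y) = (r, r+1) and (x, y) = (r+1, r). *)
Definition skip (b : 'I_n.+1) : 'I_n.+1 :=
  let u := (tperm x y * s)%g in
  let a := lift x b in col (if u a == x then u x else u a).

Lemma lift_skip b : let u := (tperm x y * s)%g in let a := lift x b in
  lift x (skip b) = if u a == x then u x else u a.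
Proof.
rewrite /= lift_collapse //; case: ifP => [/eqP e|/negbT //].
apply/eqP => e'; have /eqP := perm_inj (etrans e (esym e')).
by rewrite eq_sym (negPf (neq_lift _ _)).
Qed.

(** [skip] is, up to relabelling, the first return map of the permutation [tperm x y * s] to the
    letters other than [x]. *)
Lemma skip_inj : injective skip.
Proof.
move=> b c /(congr1 (lift x)); rewrite !lift_skip /=.
case: eqP => [bx|bx]; case: eqP => [cx|cx].
- by move=> _; apply/(@lift_inj _ x)/(@perm_inj _ (tperm x y * s)%g); rewrite bx.
- by move/perm_inj/eqP; rewrite (negPf (neq_lift _ _)).
- by move/perm_inj/eqP; rewrite eq_sym (negPf (neq_lift _ _)).
- by move/perm_inj/lift_inj.
Qed.

(** In terms of the arrows of [s]: an arrow into [x] continues to [s y], an arrow into [y] ends at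
    V, and V continues to [s x]. *)
Lemma skip_collapse a : a != y -> skip (col a) = col (if s a == x then s y else s a).
Proof.
move=> ay; rewrite /skip; have [->|ax] := eqVneq a x.
  rewrite collapse_x liftV !permM tpermL tpermR.
  by case: ifP => // /eqP ->; rewrite collapse_x.
rewrite lift_collapse // !permM tpermL tpermD // eq_sym //.
Qed.
End Pair.
End Delete.

Section SkipWords.
Variables (n : nat) (r : 'I_n.+1) (x y : 'I_n.+2).
Hypothesis xy : adjacent_pair r x y.
Variable s : 'S_n.+2.
Local Notation V := (letV r).
Local Notation col := (collapse r).
Local Notation D := (skip r x y s).

Lemma subst_perm_skip (s' : 'S_n.+2) cs :
  (forall p, p \in cs -> fcycle D p) ->
  (forall b, (forall p, p \in cs -> b \notin p) -> D b = col (s' (expand r b))) ->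
  subst_perm s' r cs = insub_perm D.
Proof.
move=> csD offD; apply: eq_insub_perm => b.
have : (forall p, p \in cs -> b \notin p) \/ True by right.
have : forall c, (forall p, p \in cs -> c \notin p) -> c = b -> D b = col (s' (expand r b)).
  by move=> c + cb; rewrite cb; apply: offD.
elim: cs csD {offD} => [|p cs IHcs] csD off _ /=.
  by rewrite -(off b).
case: ifP => [bp|bp].
  by rewrite -(eqP (next_cycle (csD p (mem_head _ _)) bp)).
apply: IHcs; last by right.
  by move=> q qcs; apply: csD; rewrite inE qcs orbT.
move=> c cq cb; apply: (off b) => // q; rewrite inE => /predU1P[->|/cq].
  by rewrite bp.
by rewrite cb.
Qed.

Lemma skip_fpath z p : fpath s z p -> x \notin p -> y \notin z :: p ->
  fpath D (col z) (map col p).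
Proof.
move=> sp xp yp; rewrite path_map; apply: path_sub_in sp => a b ap bp /=.
move=> /eqP sab; rewrite skip_collapse //; last by apply: contraNneq yp => <-.
by rewrite sab; case: (b =P x) => [bx|//]; rewrite -bx bp in xp.
Qed.

Lemma skip_off p q b : fcycle s p -> fcycle s q -> x \in p ++ q -> y \in p ++ q ->
  b \notin map col (p ++ q) -> D b = col (s (expand r b)).
Proof.
move=> cp cq xpq ypq bpq.
have bV : b != V by apply: contraNneq bpq => ->; rewrite -(collapse_y xy) map_f.
have epq : expand r b \notin p ++ q.
  by apply: contra bpq => /(map_f col); rewrite expandK.
have ey : expand r b != y by apply: contraNneq epq => ->.
rewrite -{1}[b](expandK r) skip_collapse //; case: eqP => // sx; move: epq xpq.
by rewrite -sx !mem_cat !fcycle_mem // => /negPf ->.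
Qed.

Lemma skip_fcycle z p t : fpath s z p -> s (last z p) = t ->
  x \notin p -> y \notin z :: p -> t != x -> fpath D (col z) (map col (rcons p t)).
Proof.
move=> sp lp xp yp tx; rewrite map_rcons rcons_path skip_fpath //= last_map.
rewrite skip_collapse //; last by apply: contraNneq yp => <-; rewrite mem_last.
by rewrite lp (negPf tx).
Qed.

(** From V the cycle follows P; the arrow that would return to [x] is redirected to the start of Q,
    and the end of Q enters [y], that is V. *)
Lemma skip_join P Q : fcycle s (x :: P) -> fcycle s (y :: Q) ->
  uniq ((x :: P) ++ y :: Q) -> fcycle D (V :: map col P ++ map col Q).
Proof.
move=> cP cQ uPQ; have sxP a : (s a \in x :: P) = (a \in x :: P).
  exact: fcycle_mem.
move: cP cQ uPQ; rewrite !fcycle_rcons => /andP[pP /eqP lP] /andP[pQ /eqP lQ].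
rewrite cat_uniq /= => /and4P[/andP[xP uP] /norP[yP /hasPn PQ] yQ uQ].
have xQ : x \notin Q by apply: contraL (mem_head x P) => /PQ.
have yx : y != x by rewrite eq_sym (pair_neq xy).
have DlP : D (last V (map col P)) = col (s y).
  rewrite -(collapse_x xy) last_map skip_collapse ?lP ?eqxx //.
  by apply: contraNneq yP => <-; rewrite mem_last.
rewrite /= rcons_cat cat_path -{1}(collapse_x xy) skip_fpath //=.
case: Q => [|q Q] in pQ lQ PQ yQ uQ xQ *; first by rewrite /= DlP lQ (collapse_y xy) /= eqxx.
move: pQ => /= /andP[/eqP sy pQ]; rewrite DlP sy eqxx /= -(collapse_y xy) -map_rcons.
by apply: skip_fcycle => //; move: xQ; rewrite inE => /norP[].
Qed.

(** The end of P enters [y], that is V, and closes the first cycle; the end of Q would enter [x] and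
    is redirected to [s y], the start of Q. *)
Lemma skip_split P Q : fcycle s (x :: P ++ y :: Q) -> uniq (x :: P ++ y :: Q) ->
  fcycle D (V :: map col P) /\ fcycle D (map col Q).
Proof.
rewrite fcycle_rcons cat_path last_cat /= => /andP[/and3P[pP /eqP lP pQ] /eqP lQ].
rewrite mem_cat cat_uniq inE /= => /andP[/norP[xP /norP[xy_ xQ]]].
move=> /and4P[uP /norP[yP PQ] yQ uQ].
have yx : y != x by rewrite eq_sym.
split.
  rewrite -{1}(collapse_x xy) -[V](collapse_y xy) /= -map_rcons.
  by apply: skip_fcycle => //; rewrite inE negb_or yx.
case: Q => [//|q Q] in pQ lQ PQ yQ uQ xQ *.
move: pQ => /= /andP[/eqP sy pQ]; rewrite rcons_path skip_fpath //=; last first.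
  by move: xQ; rewrite inE => /norP[].
rewrite last_map skip_collapse //; first by rewrite lQ eqxx sy.
by apply: contraNneq yQ => <-; rewrite mem_last.
Qed.

End SkipWords.

Lemma fcycle_porbit (T : finType) (s : {perm T}) z p :
  fcycle s (z :: p) -> z :: p =i porbit s z.
Proof.
move=> cp a; apply/idP/porbitP => [|[k ->]].
  move: cp; rewrite fcycle_rcons => /andP[/fpathP[k ->] _].
  by rewrite -[z :: _]/(traject s z k.+1) => /trajectP[i _ ->]; exists i; rewrite permX.
elim: k => [|k IHk]; first by rewrite perm1 mem_head.
by rewrite expgSr permM fcycle_mem.
Qed.

(** [s'] may differ from [s] on the two cycles, which the substitution overwrites. This serves the
    brackets with a reversed word, where the contraction is taken in a modification of the given
    permutation. *)
Lemma subst_perm_join n (r : 'I_n.+1) x y (s s' : 'S_n.+2) P Q :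
  adjacent_pair r x y -> fcycle s (x :: P) -> fcycle s (y :: Q) ->
  uniq ((x :: P) ++ y :: Q) ->
  (forall a, a \notin (x :: P) ++ y :: Q -> s' a = s a) ->
  subst_perm s' r [:: letV r :: map (collapse r) P ++ map (collapse r) Q]
  = insub_perm (skip r x y s).
Proof.
move=> xy cP cQ uPQ ss'; apply: subst_perm_skip => [p|b].
  by rewrite inE => /eqP ->; apply: skip_join.
move=> /(_ _ (mem_head _ _)) bPQ.
have bPQ' : b \notin map (collapse r) ((x :: P) ++ y :: Q).
  move: bPQ; rewrite map_cat /= (collapse_x xy) (collapse_y xy) !(inE, mem_cat).
  by case: (b == _); case: (b \in _).
rewrite (skip_off xy cP cQ) //; first by rewrite ss' //; apply: contra bPQ' => /(map_f (collapse r)); rewrite expandK.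
  by rewrite mem_head.
by rewrite mem_cat mem_head orbT.
Qed.

(** The two cycles are disjoint, so their order in the list is immaterial; the brackets of case (b)
    list them in either order. *)
Lemma subst_perm_split n (r : 'I_n.+1) x y (s : 'S_n.+2) P Q cs :
  adjacent_pair r x y -> ufcycle s (x :: P ++ y :: Q) ->
  cs =i [:: letV r :: map (collapse r) P; map (collapse r) Q] \/
  Q = [::] /\ cs = [:: letV r :: map (collapse r) P] ->
  subst_perm s r cs = insub_perm (skip r x y s).
Proof.
move=> xy /andP[cPQ uPQ] csE; have [cP cQ] := skip_split xy cPQ uPQ.
have csE' : (forall p, p \in cs -> p = letV r :: map (collapse r) P
  \/ p = map (collapse r) Q) /\ forall b, (forall p, p \in cs -> b \notin p) ->
  b \notin letV r :: map (collapse r) P ++ map (collapse r) Q.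
  case: csE => [csE|[-> ->]]; split=> [p|b].
  - by rewrite csE !inE => /orP[]/eqP; [left|right].
  - move=> bcs; rewrite -cat_cons mem_cat negb_or !bcs // csE !inE eqxx ?orbT //.
  - by rewrite inE => /eqP; left.
  - by rewrite cats0 => -> //; apply: mem_head.
case: csE' => cs1 cs2; apply: subst_perm_skip => [p /cs1[]->//|b /cs2 bPQ].
rewrite (skip_off xy cPQ (q := [::])) ?cats0 //.
- by rewrite mem_head.
- by rewrite !(mem_cat, inE) eqxx !orbT.
- move: bPQ; rewrite map_cons map_cat map_cons (collapse_x xy) (collapse_y xy).
  by rewrite !(inE, mem_cat); case: (b == _); case: (b \in _).
Qed.

(** * The recurrence rule in an abelian group *)

Section Brackets.
Variables (G : zmodType) (c0 : G -> G) (w : forall m, 'S_m -> G).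
Variables (n : nat) (s : 'S_n.+2) (r : 'I_n.+1).

Definition altsgn k (x : G) := if odd k then - x else x.

Definition gbracket cs := iter (count (@nilp _) cs) c0 (w (subst_perm s r cs)).

(* c0 stands for the multiplication by C_0; the rule is needed for operators,
   vectors and functions as well as for scalars. *)
Definition additive_rule : Prop :=
  [/\ forall P Q : seq 'I_n.+2,
        letr r \notin porbit s (letr1 r) ->
        ufcycle s (letr r :: P) -> ufcycle s (letr1 r :: Q) ->
        let P' := map (collapse r) P in let Q' := map (collapse r) Q in
        w s = w (conj_adj s r)
              + gbracket [:: letV r :: Q' ++ P'] - gbracket [:: letV r :: P' ++ Q']
              + altsgn (size Q) (gbracket [:: letV r :: P' ++ rev Q']
                                  - gbracket [:: letV r :: rev Q' ++ P']),
      forall P Q : seq 'I_n.+2,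
        Q != [::] ->
        ufcycle s (letr r :: P ++ letr1 r :: Q) ->
        let P' := map (collapse r) P in let Q' := map (collapse r) Q in
        w s = w (conj_adj s r)
              + gbracket [:: P'; letV r :: Q'] - gbracket [:: letV r :: P'; Q']
              + altsgn (size Q) (gbracket [:: letV r :: P' ++ rev Q']
                                  + gbracket [:: letV r :: rev Q' ++ P'])
    & forall P : seq 'I_n.+2,
        ufcycle s (letr r :: P ++ [:: letr1 r]) ->
        let b := gbracket [:: letV r :: map (collapse r) P] in
        w s = w (conj_adj s r) + (b *+ 2 - c0 b)].

(** Apart from [w s] and [w (conj_adj s r)] the rule contains only values at n+1 letters, so their
    difference stays in every subgroup stable under [c0] that contains these: the last hypothesis of
    [reduction]. *)
Lemma additive_rule_step (B : G -> Prop) :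
  (forall x y, B x -> B y -> B (x - y)) -> (forall x, B x -> B (c0 x)) ->
  additive_rule -> (forall t : 'S_n.+1, B (w t)) -> B (w s - w (conj_adj s r)).
Proof.
move=> BB Bc [ra rb rc] Bw.
have B0 : B 0 by rewrite -(subrr (w (1%g : 'S_n.+1))); apply: BB.
have BN x : B x -> B (- x) by rewrite -[- x]sub0r; apply: BB.
have BD x y : B x -> B y -> B (x + y).
  by move=> Bx /BN By; rewrite -[y]opprK; apply: BB.
have Bg cs : B (gbracket cs) by rewrite /gbracket; elim: count => //= k; apply: Bc.
have Ba k x : B x -> B (altsgn k x) by rewrite /altsgn; case: ifP => // _; apply: BN.
have add4 (x y z t : G) : x + y - z + t - x = y - z + t.
  by rewrite -!addrA [x + _]addrC -!addrA addNr addr0.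
case: (adj_words s r) => [[P [Q [rQ cP cQ]]]|[P [Q [Q0 cPQ]]]|[P cP]].
- rewrite (ra P Q) //= add4; apply/BD; first exact/BB/Bg/Bg.
  exact/Ba/BB/Bg/Bg.
- rewrite (rb P Q) //= add4; apply/BD; first exact/BB/Bg/Bg.
  exact/Ba/BD/Bg/Bg.
- by rewrite (rc P) //= addrAC subrr add0r mulr2n; apply/BB/Bc/Bg/BD; apply: Bg.
Qed.

End Brackets.

Lemma prodr_sign_if (A : pzRingType) (J : Type) (l : seq J) (p : pred J)
    (f : J -> A) :
  \prod_(a <- l) (if p a then - f a else f a)
  = (-1) ^+ count p l * \prod_(a <- l) f a.
Proof.
elim: l => [|a l IHl]; first by rewrite !big_nil mulr1.
rewrite !big_cons IHl /= addnC exprD mulrA commr_sign -!mulrA; congr (_ * _).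
by case: (p a); rewrite ?mul1r // expr1 mulN1r mulNr.
Qed.

Section EnumSplit.
Variables (n : nat) (r : 'I_n.+1).
(** The product over all letters is noncommutative, so the two neighbouring factors have to be
    exposed in place, between those of smaller and those of larger letters. *)
Definition before_r := take r (enum 'I_n.+2).
Definition after_r := drop r.+2 (enum 'I_n.+2).

Lemma enum_split : enum 'I_n.+2 = before_r ++ [:: letr r, letr1 r & after_r].
Proof.
rewrite -{1}(cat_take_drop r (enum 'I_n.+2)) /before_r; congr (_ ++ _).
have rn := ltn_ord r.
rewrite (drop_nth ord0) ?size_enum_ord ?ltnS; last by lia.
rewrite (drop_nth ord0) ?size_enum_ord ?ltnS; last by lia.
congr [:: _, _ & _].
  by rewrite -[r : nat in LHS]/(nat_of_ord (letr r)) nth_ord_enum.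
by rewrite -[r.+1]/(nat_of_ord (letr1 r)) nth_ord_enum.
Qed.

Lemma mem_before_after a :
  (a \in before_r ++ after_r) = (a != letr r) && (a != letr1 r).
Proof.
have := mem_enum 'I_n.+2 a; have := enum_uniq 'I_n.+2; rewrite !enum_split.
rewrite cat_uniq /= !mem_cat !inE => /and4P[_ /norP[rb /norP[r1b _]] ra /andP[r1a _]].
move: ra; rewrite negb_or => /andP[rr1 ra].
case: eqP => [->|_] /=; first by rewrite (negPf rb) (negPf ra).
by case: eqP => [->|_] //=; rewrite (negPf r1b) (negPf r1a).
Qed.

Lemma map_lift_enum x y : adjacent_pair r x y ->
  map (lift x) (enum 'I_n.+1) = before_r ++ y :: after_r.
Proof.
move=> xy; have -> : before_r ++ y :: after_r = [seq a <- enum 'I_n.+2 | a != x].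
  have : all (predC1 x) (before_r ++ after_r).
    apply/allP => a; rewrite mem_before_after /= => /andP[].
    by case: xy => -[-> _].
  rewrite all_cat enum_split filter_cat /= => /andP[/all_filterP -> /all_filterP ->].
  by case: xy => -[-> ->]; rewrite eqxx ?letr_neq // eq_sym letr_neq.
apply: (inj_map val_inj); apply: (@irr_sorted_eq _ ltn ltn_trans ltnn).
- rewrite -map_comp (map_comp (bump x) val) val_enum_ord sorted_map.
  apply: sub_sorted (iota_ltn_sorted _ _) => i j /=.
  by rewrite !ltnNge leq_bump2.
- apply: (subseq_sorted ltn_trans (map_subseq val (filter_subseq _ _))).
  by rewrite val_enum_ord iota_ltn_sorted.
- apply: eq_mem_map => a; rewrite mem_filter mem_enum andbT.
  apply/mapP/idP => [[b _ ->]|]; first by rewrite eq_sym neq_lift.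
  by rewrite eq_sym => /unlift_some[b -> _]; exists b; rewrite ?mem_enum.
Qed.
End EnumSplit.

Lemma count_enum (T : finType) (p : {pred T}) : count (mem p) (enum T) = #|p|.
Proof.
rewrite -size_filter cardE; apply/perm_size/uniq_perm => [||a].
- by rewrite filter_uniq ?enum_uniq.
- exact: enum_uniq.
- by rewrite mem_filter !mem_enum andbT.
Qed.

Lemma index_enumE (T : finType) : index_enum T = enum T.
Proof. by rewrite enumT [index_enum T]unlock. Qed.

(** * The invariant of an orthogonal Lie algebra *)

Section Model.
Variables (A : pzRingType) (I : finType) (bar : I -> I) (F : I -> I -> A).
Hypothesis barK : involutive bar.
Hypothesis F_bar : forall i j, F (bar j) (bar i) = - F i j.

Definition op m (s : 'S_m) : A :=
  \sum_(g : {ffun 'I_m -> I}) \prod_(a < m) F (g a) (g (s a)).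

Section Flip.
Variables (m : nat) (s : 'S_m) (x : 'I_m).
Local Notation s' := (invert_cycle s x).

(* Reindexing a cycle this way turns the factor F (g a) (g (s a)) into minus the
   factor of the inverted cycle. *)
Definition flip_ffun (g : {ffun 'I_m -> I}) : {ffun 'I_m -> I} :=
  [ffun a => if a \in porbit s x then bar (g (s' a)) else g a].

Lemma porbit_stable a : (s a \in porbit s x) = (a \in porbit s x).
Proof. by rewrite -!eq_porbit_mem -[in RHS](porbit_perm s 1 a) expg1. Qed.

Lemma flip_ffun_inj : injective flip_ffun.
Proof.
move=> g g' e; apply/ffunP => a.
have [ax|ax] := boolP (a \in porbit s x).
  have := congr1 (fun h : {ffun _} => h (s a)) e.
  rewrite !ffunE porbit_stable ax permE porbit_stable ax permK.
  exact: (can_inj barK).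
by have := congr1 (fun h : {ffun _} => h a) e; rewrite !ffunE (negPf ax).
Qed.

Lemma F_flip g a : F (flip_ffun g a) (flip_ffun g (s a)) =
  if a \in porbit s x then - F (g a) (g (s' a)) else F (g a) (g (s' a)).
Proof.
rewrite !ffunE porbit_stable; case: ifP => ax.
  by rewrite [s' (s a)]permE porbit_stable ax permK F_bar.
by rewrite permE ax.
Qed.

End Flip.

(** The reindexing keeps every factor at its position, so noncommutativity does no harm, and each
    letter of the cycle contributes one sign. *)
Lemma op_invert m (s : 'S_m) x : op (invert_cycle s x) = altsgn #|porbit s x| (op s).
Proof.
rewrite [in RHS]/op (reindex_inj (@flip_ffun_inj m s x)) /=.
under eq_bigr => g _ do under eq_bigr => a _ do rewrite F_flip.
under eq_bigr => g _ do rewrite prodr_sign_if.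
rewrite -big_distrr /= -[X in altsgn _ (_ * X)]/(op (invert_cycle s x)).
have -> : count (mem (porbit s x)) (index_enum 'I_m) = #|porbit s x|.
  by rewrite -sum1_count sum1_card.
rewrite /altsgn -signr_odd; case: odd; rewrite ?mul1r //.
by rewrite expr1 mulN1r opprK.
Qed.

(** A fixed point is a cycle of odd length equal to its own inverse, whence [op s = - op s]. *)
Lemma op_fixed m (s : 'S_m) x : (forall a : A, a + a = 0 -> a = 0) -> s x = x ->
  op s = 0.
Proof.
move=> A2 sx; apply: A2.
have ox y : (y \in porbit s x) = (y == x).
  apply/porbitP/eqP => [[k ->]|->]; last by exists 0%N; rewrite perm1.
  elim: k => [|k IHk]; first by rewrite perm1.
  by rewrite expgSr permM IHk.
have := op_invert s x; rewrite (eq_card ox) card1 /altsgn /=.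
rewrite (_ : invert_cycle s x = s) => [e|]; first by rewrite {1}e addNr.
apply/permP => y; rewrite permE ox; case: eqP => [->|//].
by rewrite -{1}sx permK sx.
Qed.

Lemma op_empty : op (1%g : 'S_0) = 1.
Proof.
rewrite /op (eq_bigr (fun=> 1)) => [|g _]; last by rewrite big_ord0.
by rewrite sumr_const card_ffun card_ord expn0.
Qed.

Lemma op_concat m n (s : 'S_m) (t : 'S_n) : op (concat_perm s t) = op s * op t.
Proof.
pose h (p : {ffun 'I_m -> I} * {ffun 'I_n -> I}) : {ffun 'I_(m + n) -> I} :=
  [ffun i => match split i with inl j => p.1 j | inr j => p.2 j end].
have hl p i : h p (lshift n i) = p.1 i.
  by rewrite ffunE (unsplitK (inl i)).
have hr p i : h p (rshift m i) = p.2 i.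
  by rewrite ffunE (unsplitK (inr i)).
have hbij : bijective h.
  exists (fun g : {ffun 'I_(m + n) -> I} =>
    ([ffun i => g (lshift n i)], [ffun i => g (rshift m i)])).
    by case=> g1 g2; congr (_, _); apply/ffunP => i; rewrite ffunE (hl, hr).
  move=> g; apply/ffunP => i; rewrite ffunE.
  by rewrite -[in RHS](splitK i); case: split => j; rewrite ffunE.
rewrite /op (reindex h) /=; last exact: onW_bij.
rewrite [RHS]big_distrlr /= pair_big; apply: eq_bigr => p _.
rewrite big_split_ord /=; congr (_ * _); apply: eq_bigr => i _; rewrite !permE.
  by rewrite (unsplitK (inl i)) !hl.
by rewrite (unsplitK (inr i)) !hr.
Qed.

Section Adjacent.
Variables (n : nat) (r : 'I_n.+1).
Local Notation lr := (letr r).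
Local Notation lr1 := (letr1 r).

(** Summing out the index at [x], which the delta equates with the one at [u x], joins the arrows
    into and out of [x]; this is the first return map. If [u] fixes [x], the index is free and gives
    the factor [#|I|], the value of C_0. *)
Lemma sum_skip x y (s : 'S_n.+2) : adjacent_pair r x y ->
  let u := (tperm x y * s)%g in
  \sum_(g : {ffun 'I_n.+2 -> I}) (g x == g (u x))%:R *
     \prod_(b < n.+1) F (g (lift x b)) (g (u (lift x b)))
  = (if u x == x then #|I|%:R else 1) * op (insub_perm (skip r x y s)).
Proof.
move=> xy u.
pose h (p : I * {ffun 'I_n.+1 -> I}) : {ffun 'I_n.+2 -> I} :=
  [ffun a => if unlift x a is Some b then p.2 b else p.1].
have hx p : h p x = p.1 by rewrite ffunE unlift_none.
have hl p b : h p (lift x b) = p.2 b by rewrite ffunE liftK.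
have hbij : bijective h.
  exists (fun g : {ffun 'I_n.+2 -> I} => (g x, [ffun b => g (lift x b)])).
    by case=> i g; rewrite hx; congr (_, _); apply/ffunP => b; rewrite ffunE hl.
  move=> g; apply/ffunP => a; rewrite ffunE.
  by case: unliftP => [b ->|->] //=; rewrite ffunE.
rewrite (reindex h) /=; last exact: onW_bij.
pose Y (g : {ffun 'I_n.+1 -> I}) :=
  \prod_b F (g b) (g (insub_perm (skip r x y s) b)).
have skipE b : lift x (insub_perm (skip r x y s) b) =
    if u (lift x b) == x then u x else u (lift x b).
  by rewrite insub_permE ?lift_skip //; apply: skip_inj.
rewrite (eq_bigr (fun p => (p.1 == h p (u x))%:R * Y p.2)) => [|p _]; last first.
  rewrite hx; have [e|_] := eqVneq p.1 (h p (u x)); last by rewrite !mul0r.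
  congr (_ * _); apply: eq_bigr => b _; rewrite hl; congr F.
  by rewrite -[in RHS]hl skipE; case: eqP => // ->; rewrite hx.
rewrite -(pair_big xpredT xpredT (fun i g => (i == h (i, g) (u x))%:R * Y g)) /=.
rewrite exchange_big /= big_distrr /=; apply: eq_bigr => g _.
rewrite -big_distrl /=; congr (_ * _); have [->|ux] := eqVneq (u x) x.
  by under eq_bigr => i _ do rewrite hx eqxx; rewrite sumr_const.
have [c ec] : exists c, u x = lift x c.
  by move: ux; rewrite eq_sym => /unlift_some[c -> _]; exists c.
under eq_bigr => i _ do rewrite ec hl /=.
by rewrite (bigD1 (g c)) //= eqxx big1 ?addr0 // => i /negPf ->.
Qed.

(** Opens [op s] at the two neighbouring factors: [H] receives their four indices, and the
    commutator will be substituted for it. *)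
Definition sum_adj (s : 'S_n.+2) (H : I -> I -> I -> I -> A) : A :=
  \sum_(g : {ffun 'I_n.+2 -> I})
    (\prod_(a <- before_r r) F (g a) (g (s a)))
    * H (g lr) (g (s lr)) (g lr1) (g (s lr1))
    * \prod_(a <- after_r r) F (g a) (g (s a)).

Lemma eq_sum_adj s H H' : (forall i j k l, H i j k l = H' i j k l) ->
  sum_adj s H = sum_adj s H'.
Proof. by move=> HH; apply: eq_bigr => g _; rewrite HH. Qed.

Lemma sum_adjD s H H' :
  sum_adj s (fun i j k l => H i j k l + H' i j k l) = sum_adj s H + sum_adj s H'.
Proof.
by rewrite -big_split; apply: eq_bigr => g _ /=; rewrite mulrDr mulrDl.
Qed.

Lemma sum_adjN s H :
  sum_adj s (fun i j k l => - H i j k l) = - sum_adj s H.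
Proof.
by rewrite -sumrN; apply: eq_bigr => g _ /=; rewrite mulrN mulNr.
Qed.

Lemma op_sum_adj s : op s = sum_adj s (fun i j k l => F i j * F k l).
Proof.
apply: eq_bigr => g _; rewrite index_enumE (enum_split r) big_cat !big_cons /=.
by rewrite !mulrA.
Qed.

Lemma eq_sides (f g : 'I_n.+2 -> A) X :
  (forall a, a != lr -> a != lr1 -> f a = g a) ->
  (\prod_(a <- before_r r) f a) * X * (\prod_(a <- after_r r) f a)
  = (\prod_(a <- before_r r) g a) * X * (\prod_(a <- after_r r) g a).
Proof.
move=> fg; have fg' a : a \in before_r r ++ after_r r -> f a = g a.
  by rewrite mem_before_after => /andP[]; apply: fg.
by congr (_ * _ * _); apply: eq_big_seq => a ab; apply: fg'; rewrite mem_cat ab ?orbT.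
Qed.

Definition swap_ffun (g : {ffun 'I_n.+2 -> I}) : {ffun 'I_n.+2 -> I} :=
  [ffun a => g (tperm lr lr1 a)].

Lemma swap_ffun_inj : injective swap_ffun.
Proof.
apply: (can_inj (g := swap_ffun)) => g; apply/ffunP => a.
by rewrite !ffunE tpermK.
Qed.

(** Exchanging the indices at the two neighbours undoes the conjugation, except that the two factors
    now stand in the opposite order. *)
Lemma op_conj_adj s : op (conj_adj s r) = sum_adj s (fun i j k l => F k l * F i j).
Proof.
rewrite op_sum_adj /sum_adj (reindex_inj swap_ffun_inj); apply: eq_bigr => g _.
have E a : swap_ffun g (conj_adj s r a) = g (s (tperm lr lr1 a)).
  by rewrite ffunE /conj_adj conjgE tpermV !permM tpermK.
rewrite !E !ffunE tpermL tpermR.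
by apply: eq_sides => a ar ar1; rewrite E ffunE tpermD // eq_sym.
Qed.

(** Multiplying by the transposition cuts a cycle through both neighbours into two, one of which can
    then be inverted by [sum_adj_flip]. *)
Lemma sum_adj_tperm s H : sum_adj s H =
  sum_adj (s * tperm lr lr1)%g (fun i j k l => H k j i l).
Proof.
rewrite /sum_adj (reindex_inj swap_ffun_inj); apply: eq_bigr => g _.
have E a : swap_ffun g (s a) = g ((s * tperm lr lr1)%g a).
  by rewrite ffunE permM.
rewrite !E [swap_ffun g lr]ffunE [swap_ffun g lr1]ffunE tpermL tpermR.
by apply: eq_sides => a ar ar1; rewrite E ffunE tpermD // eq_sym.
Qed.

(** The cycle has k+1 letters, but the factor of r+1 is hidden in [H], so only k signs come out. *)
Lemma sum_adj_flip s H k : lr \notin porbit s lr1 -> #|porbit s lr1| = k.+1 ->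
  sum_adj s H = altsgn k (sum_adj (invert_cycle s lr1)
    (fun i j k l => H i j (bar l) (bar k))).
Proof.
move=> rC cC; rewrite /sum_adj (reindex_inj (@flip_ffun_inj _ s lr1)) /=.
set s' := invert_cycle s lr1.
have E (g : {ffun 'I_n.+2 -> I}) (l : seq 'I_n.+2) :
    \prod_(a <- l) F (flip_ffun s lr1 g a) (flip_ffun s lr1 g (s a))
    = (-1) ^+ count (mem (porbit s lr1)) l * \prod_(a <- l) F (g a) (g (s' a)).
  by under eq_bigr => a _ do rewrite F_flip; rewrite prodr_sign_if.
under eq_bigr => g _ do rewrite !E.
have -> : altsgn k = ( *%R ((-1) ^+ k) : A -> A).
  apply/funext => z; rewrite /altsgn -signr_odd; case: odd; rewrite ?mul1r //.
  by rewrite expr1 mulN1r.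
have {1}-> : k = (count (mem (porbit s lr1)) (before_r r) + count (mem (porbit s lr1)) (after_r r))%N.
  apply: succn_inj; rewrite -cC -count_enum (enum_split r).
  rewrite count_cat /=. rewrite (negPf rC) porbit_id /= addnS.
  by [].
rewrite big_distrr; apply: eq_bigr => g _ /=; rewrite exprD.
have -> : flip_ffun s lr1 g lr = g lr by rewrite ffunE (negPf rC).
have -> : flip_ffun s lr1 g (s lr) = g (s' lr).
  by rewrite ffunE porbit_stable (negPf rC) permE (negPf rC).
have -> : flip_ffun s lr1 g lr1 = bar (g (s' lr1)) by rewrite ffunE porbit_id.
have -> : flip_ffun s lr1 g (s lr1) = bar (g lr1).
  by rewrite ffunE porbit_stable porbit_id permE porbit_stable porbit_id permK.
move: (H _ _ _ _) (\prod_(a <- before_r r) _) (\prod_(a <- after_r r) _) => Y X Z.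
rewrite -!mulrA; congr (_ * _).
by rewrite [Y * _]mulrA commr_sign -mulrA mulrA commr_sign -mulrA.
Qed.
End Adjacent.
End Model.

Section ModelRule.
Variables (A : pzRingType) (I : finType) (bar : I -> I) (F : I -> I -> A).
Hypothesis barK : involutive bar.
Hypothesis F_bar : forall i j, F (bar j) (bar i) = - F i j.

(** The pattern of the commutator of two matrix units of gl. In [F_comm] the second copy comes from
    the mirror summand of [F k l]. *)
Definition contraction i j k l : A :=
  (k == j)%:R * F i l - (i == l)%:R * F k j.

Hypothesis F_comm : forall i j k l, F i j * F k l - F k l * F i j =
  contraction i j k l - contraction i j (bar l) (bar k).
Hypothesis A2 : forall a : A, a + a = 0 -> a = 0.

Local Notation op := (op F).
Local Notation c0 := ( *%R #|I|%:R).

Section Rule.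
Variables (n : nat) (r : 'I_n.+1) (s : 'S_n.+2).
Local Notation lr := (letr r).
Local Notation lr1 := (letr1 r).
Local Notation sum_adj := (sum_adj F r).

Lemma prod_lift x y (f : 'I_n.+2 -> A) : adjacent_pair r x y ->
  \prod_(b < n.+1) f (lift x b)
  = \prod_(a <- before_r r) f a * f y * \prod_(a <- after_r r) f a.
Proof.
move=> xy; rewrite index_enumE -(big_map (lift x) xpredT f) (map_lift_enum xy).
by rewrite big_cat big_cons /= mulrA.
Qed.

Lemma sum_contraction x y (t : 'S_n.+2) (H : I -> I -> I -> I -> A) : adjacent_pair r x y ->
  (forall g : {ffun 'I_n.+2 -> I}, H (g lr) (g (t lr)) (g lr1) (g (t lr1))
     = (g x == g (t y))%:R * F (g y) (g (t x))) ->
  sum_adj t H = (if t y == x then #|I|%:R else 1) * op (insub_perm (skip r x y t)).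
Proof.
move=> xy HE; have := sum_skip F t xy; rewrite /= permM tpermL => <-.
apply: eq_bigr => g _; rewrite HE.
rewrite [\prod_(b < n.+1) _](prod_lift (fun a => F (g a) (g ((tperm x y * t)%g a))) xy).
rewrite permM tpermR; set X := F (g y) _.
rewrite (eq_sides (g := fun a => F (g a) (g ((tperm x y * t)%g a)))); last first.
  move=> a ar ar1; rewrite permM tpermD //; by case: xy => -[ex ey]; rewrite eq_sym ?ex ?ey.
by rewrite -!mulrA mulrA commr_nat -!mulrA.
Qed.

Lemma sum_contraction1 (t : 'S_n.+2) : sum_adj t (fun i j k l => (k == j)%:R * F i l) =
  (if t lr == lr1 then #|I|%:R else 1) * op (insub_perm (skip r lr1 lr t)).
Proof. by apply: sum_contraction => //; right. Qed.

Lemma sum_contraction2 (t : 'S_n.+2) : sum_adj t (fun i j k l => (i == l)%:R * F k j) =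
  (if t lr1 == lr then #|I|%:R else 1) * op (insub_perm (skip r lr lr1 t)).
Proof. by apply: sum_contraction => //; left. Qed.

Lemma op_step : op s = op (conj_adj s r) + (sum_adj s contraction
  - sum_adj s (fun i j k l => contraction i j (bar l) (bar k))).
Proof.
apply/eqP; rewrite addrC -subr_eq; apply/eqP.
rewrite (op_sum_adj F r) op_conj_adj -!sum_adjN -!sum_adjD.
exact: eq_sum_adj.
Qed.

Lemma sum_adj_contraction (t : 'S_n.+2) : sum_adj t contraction =
  sum_adj t (fun i j k l => (k == j)%:R * F i l)
  - sum_adj t (fun i j k l => (i == l)%:R * F k j).
Proof. by rewrite -sum_adjN -sum_adjD. Qed.

Lemma join_contractions (t : 'S_n.+2) P Q :
  fcycle t (lr :: P) -> fcycle t (lr1 :: Q) -> uniq ((lr :: P) ++ lr1 :: Q) ->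
  (forall a, a \notin (lr :: P) ++ lr1 :: Q -> s a = t a) ->
  let P' := map (collapse r) P in let Q' := map (collapse r) Q in
  sum_adj t (fun i j k l => (k == j)%:R * F i l)
    = op (subst_perm s r [:: letV r :: Q' ++ P']) /\
  sum_adj t (fun i j k l => (i == l)%:R * F k j)
    = op (subst_perm s r [:: letV r :: P' ++ Q']).
Proof.
move=> cP cQ uPQ st P' Q'.
have PQ a : a \in lr :: P -> a \notin lr1 :: Q.
  move: uPQ; rewrite cat_uniq => /and3P[_ /hasPn PQ _].
  by apply: contraL => /PQ.
have uQP : uniq ((lr1 :: Q) ++ lr :: P) by rewrite uniq_catC.
rewrite sum_contraction1 sum_contraction2; split.
  rewrite ifN; last first.
    apply: contraTneq (mem_head lr1 Q) => e; rewrite -{1}e; apply: PQ.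
    by rewrite fcycle_mem // mem_head.
  rewrite mul1r (subst_perm_join _ cQ cP) //; first by right.
  by move=> a; rewrite mem_cat orbC -mem_cat; apply: st.
rewrite ifN; last first.
  apply: contraTneq (mem_head lr P) => e; apply: contraTN isT => /PQ.
  by rewrite -e fcycle_mem // mem_head.
by rewrite mul1r (subst_perm_join _ cP cQ) //; left.
Qed.

Section FlippedWords.
Variables (t : 'S_n.+2) (P Q : seq 'I_n.+2).
Hypotheses (cP : fcycle t (lr :: P)) (cQ : fcycle t (lr1 :: Q)).
Hypothesis uPQ : uniq ((lr :: P) ++ lr1 :: Q).
Local Notation t' := (invert_cycle t lr1).

Lemma flipped_notin a : a \in lr :: P -> a \notin porbit t lr1.
Proof.
rewrite -(fcycle_porbit cQ); move: uPQ; rewrite cat_uniq => /and3P[_ /hasPn PQ _].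
by apply: contraL => /PQ.
Qed.

Lemma flipped_P : fcycle t' (lr :: P).
Proof.
apply: (sub_in_cycle (P := mem (lr :: P))) cP; last by apply/allP.
by move=> a b aP bP; rewrite /= permE (negPf (flipped_notin aP)).
Qed.

Lemma flipped_Q : fcycle t' (lr1 :: rev Q).
Proof.
rewrite -rotr1_rcons -rev_cons rotr_cycle rev_cycle.
apply: (sub_in_cycle (P := mem (lr1 :: Q))) cQ; last by apply/allP.
move=> a b; rewrite !inE -!in_cons => aQ bQ /= /eqP tab.
by rewrite permE -(fcycle_porbit cQ) bQ -tab permK.
Qed.

Lemma flipped_uniq : uniq ((lr :: P) ++ lr1 :: rev Q).
Proof.
rewrite (perm_uniq (s2 := (lr :: P) ++ lr1 :: Q)) //.
by rewrite perm_cat2l perm_cons perm_rev.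
Qed.

End FlippedWords.

(** The plain contraction joins the two cycles in the two possible ways. For the mirror contraction
    the cycle of r+1 is inverted first; this turns it into a plain contraction for the permutation
    with Q reversed, with the sign of the |Q| remaining factors. *)
Lemma rule_diff P Q : lr \notin porbit s lr1 ->
  ufcycle s (lr :: P) -> ufcycle s (lr1 :: Q) ->
  let P' := map (collapse r) P in let Q' := map (collapse r) Q in
  op s = op (conj_adj s r) + op (subst_perm s r [:: letV r :: Q' ++ P'])
    - op (subst_perm s r [:: letV r :: P' ++ Q'])
    + altsgn (size Q) (op (subst_perm s r [:: letV r :: P' ++ rev Q'])
       - op (subst_perm s r [:: letV r :: rev Q' ++ P'])).
Proof.
move=> rC /andP[cP uP] /andP[cQ uQ] P' Q'.
have uPQ : uniq ((lr :: P) ++ lr1 :: Q).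
  rewrite cat_uniq uP uQ andbT; apply/hasPn => a; rewrite (fcycle_porbit cQ) => ar1.
  apply: contra rC; rewrite /= (fcycle_porbit cP) -!eq_porbit_mem in ar1 *.
  by move=> /eqP <-.
have cQs : #|porbit s lr1| = (size Q).+1.
  by rewrite -(eq_card (fcycle_porbit cQ)) (card_uniqP uQ).
rewrite op_step (sum_adj_flip barK F_bar
  (fun i j k l => contraction i j (bar l) (bar k)) rC cQs).
have [//|T1 T2] := join_contractions cP cQ uPQ.
have cP_ := flipped_P cP cQ uPQ; have cQ_ := flipped_Q cQ.
have [|T3 T4] := join_contractions cP_ cQ_ (flipped_uniq uPQ).
  move=> a aPQ; rewrite permE ifN // -(fcycle_porbit cQ); apply: contra aPQ.
  by rewrite mem_cat !inE mem_rev => ->; rewrite orbT.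
rewrite map_rev in T3 T4.
rewrite (@eq_sum_adj _ _ _ _ _ (invert_cycle s lr1) _ contraction) ; last first.
  by move=> i j k l; rewrite !barK.
have altN (x y : A) : - altsgn (size Q) (x - y) = altsgn (size Q) (y - x).
  by rewrite /altsgn; case: odd; rewrite !opprB.
by rewrite !sum_adj_contraction T1 T2 T3 T4 altN !addrA.
Qed.

(** The plain contraction splits the cycle; an empty part means that the contracted index is free,
    whence the factors [#|I|]. The mirror contraction joins P with the reversed Q. *)
Lemma rule_same P Q : ufcycle s (lr :: P ++ lr1 :: Q) ->
  let P' := map (collapse r) P in let Q' := map (collapse r) Q in
  op s = op (conj_adj s r)
    + ((if P == [::] then #|I|%:R else 1) * op (subst_perm s r [:: P'; letV r :: Q'])
    - (if Q == [::] then #|I|%:R else 1) * op (subst_perm s r [:: letV r :: P'; Q']))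
    + altsgn (size Q) (op (subst_perm s r [:: letV r :: P' ++ rev Q'])
       + op (subst_perm s r [:: letV r :: rev Q' ++ P'])).
Proof.
move=> cPQ P' Q'; have [cPQ1 uPQ1] := andP cPQ.
have cQP : ufcycle s (lr1 :: Q ++ lr :: P).
  by rewrite -cat_cons -rot_size_cat rot_ucycle.
have uPQ : uniq ((lr :: P) ++ lr1 :: Q) by [].
(* Cuts the common cycle into (r P) and (r+1 Q), so that the second can be inverted as in case
   (a). *)
pose t := (s * tperm lr lr1)%g.
have lrr1 := letr_neq r.
have := uPQ; rewrite cat_uniq /= => /and3P[/andP[rP uP] /norP[r1P PQ] /andP[r1Q uQ]].
have rQ : lr \notin Q by apply: contra PQ => rQ; apply/hasP; exists lr; rewrite ?mem_head.
have r1P' : lr1 \notin P by move: r1P; rewrite inE => /norP[].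
have [pP sP pQ sQ] : [/\ fpath s lr P, s (last lr P) = lr1, fpath s lr1 Q & s (last lr1 Q) = lr].
  move: cPQ1; rewrite fcycle_rcons cat_path last_cat /=.
  by move=> /andP[/and3P[-> /eqP-> ->] /eqP->].
have tP : fcycle t (lr :: P).
  rewrite fcycle_rcons permM sP tpermR eqxx andbT.
  apply: path_sub_in pP => a b _ bP /= /eqP sab; rewrite permM sab tpermD //.
    by apply: contraNneq rP => ->.
  by apply: contraNneq r1P' => ->.
have tQ : fcycle t (lr1 :: Q).
  rewrite fcycle_rcons permM sQ tpermL eqxx andbT.
  apply: path_sub_in pQ => a b _ bQ /= /eqP sab; rewrite permM sab tpermD //.
    by apply: contraNneq rQ => ->.
  by apply: contraNneq r1Q => ->.
have st a : a \notin (lr :: P) ++ lr1 :: Q -> s a = t a.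
  move=> aPQ; rewrite permM tpermD //; apply: contra aPQ => /eqP e.
    by rewrite -(fcycle_mem a cPQ1) -e !(mem_cat, inE) eqxx.
  by rewrite -(fcycle_mem a cPQ1) -e !(mem_cat, inE) eqxx !orbT.
have cQs : #|porbit t lr1| = (size Q).+1.
  by rewrite -(eq_card (fcycle_porbit tQ)) (card_uniqP _) //= r1Q.
have rC := flipped_notin tQ uPQ (mem_head lr P).
have cP_ := flipped_P tP tQ uPQ; have cQ_ := flipped_Q tQ.
have [|T3 T4] := join_contractions cP_ cQ_ (flipped_uniq uPQ).
  move=> a aPQ; rewrite st ?permE ?ifN // -?(fcycle_porbit tQ); last first.
    by apply: contra aPQ; rewrite !(mem_cat, inE) mem_rev.
  apply: contra aPQ; rewrite !(mem_cat, inE) mem_rev.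
  by move=> ->; rewrite orbT.
rewrite map_rev in T3 T4.
rewrite op_step -addrA; congr (_ + (_ + _)).
  rewrite sum_adj_contraction sum_contraction1 sum_contraction2.
  have -> : (s lr == lr1) = (P == [::]).
    case: (P) pP sP r1P' => [|p P0] /=; first by move=> _ ->; rewrite !eqxx.
    move=> /andP[/eqP -> _] _; rewrite inE => /norP[/negPf + _].
    by rewrite eq_sym.
  have -> : (s lr1 == lr) = (Q == [::]).
    case: (Q) pQ sQ rQ => [|q Q0] /=; first by move=> _ ->; rewrite !eqxx.
    move=> /andP[/eqP -> _] _; rewrite inE => /norP[/negPf + _].
    by rewrite eq_sym.
  rewrite (subst_perm_split (or_introl erefl) cPQ (or_introl (fun=> erefl))).
  rewrite (subst_perm_split (or_intror erefl) cQP) //; left=> p.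
  by rewrite !inE orbC.
(* Here [F_bar] changes the sign of just one of the two terms of the contraction, so that they add
   up: the plus sign in (b). *)
rewrite sum_adj_tperm (sum_adj_flip barK F_bar _ rC cQs).
rewrite (@eq_sum_adj _ _ _ _ _ _ _
  (fun i j k l => - ((k == j)%:R * F i l + (i == l)%:R * F k j))).
  rewrite sum_adjN sum_adjD T3 T4 /altsgn.
  by case: odd; rewrite ?opprK addrC.
move=> i j k l; rewrite /contraction !barK F_bar (can_eq barK) mulrN opprD.
by rewrite [l == i]eq_sym.
Qed.

Lemma op_rule : additive_rule c0 (fun m => @op m) s r.
Proof.
split=> [P Q rC cP cQ P' Q'|P Q Q0 cPQ P' Q'|P cP b].
- exact: rule_diff.
- have Q'0 : nilp Q' = false by rewrite /nilp size_map; case: (Q) Q0.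
  have P'0 : nilp P' = (P == [::]) by rewrite /nilp size_map size_eq0.
  rewrite (rule_same cPQ) /gbracket /= -/P' -/Q' Q'0 P'0 (negPf Q0) !mul1r.
  by case: eqP => _; rewrite /= ?mul1r !addrA.
- rewrite (rule_same cP) /= cats0 /altsgn /=.
  have cs2 : subst_perm s r [:: letV r :: map (collapse r) P; [::]]
      = subst_perm s r [:: letV r :: map (collapse r) P] by [].
  (* This permutation fixes V, so its value vanishes. With Q empty the two reversed brackets
     coincide, and 2 b - C_0 b remains, as in (c). *)
  have -> : op (subst_perm s r [:: map (collapse r) P; [:: letV r]]) = 0.
    apply: (op_fixed barK F_bar A2 (x := letV r)).
    have cQP : ufcycle s (lr1 :: [::] ++ lr :: P).
      by rewrite -cat_cons -rot_size_cat rot_ucycle.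
    have xy : adjacent_pair r lr1 lr by right.
    rewrite (subst_perm_split xy cQP); last by left=> p; rewrite !inE orbC.
    rewrite insub_permE; last exact: skip_inj.
    have [] := skip_split xy (andP cQP).1 (andP cQP).2.
    by rewrite /= andbT => /eqP.
  by rewrite mulr0 sub0r cs2 -/b addrAC -addrA; congr (_ + _).
Qed.

End Rule.
End ModelRule.

(** * Fermionic highest weight vectors *)

Section MonomialMatrix.
Variables (K : comNzRingType) (T : finType).

(** Fermionic operators have at most one nonzero entry in each row. Such matrices multiply by
    composing the maps [phi], which reduces the anticommutation relations to identities of scalar
    functions. *)
Definition monomial_mx (g : T -> K) (phi : T -> T) : 'M[K]_#|T| :=
  \matrix_(p, q) (g (enum_val p) *+ (enum_val q == phi (enum_val p))).

Lemma monomial_mxM g phi h psi : monomial_mx g phi *m monomial_mx h psi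
  = monomial_mx (fun t => g t * h (phi t)) (psi \o phi).
Proof.
apply/matrixP => p q; rewrite !mxE (bigD1 (enum_rank (phi (enum_val p)))) //=.
rewrite !mxE enum_rankK eqxx mulr1n big1 ?addr0 ?mulrnAr // => u /negPf up.
by rewrite mxE -(inj_eq enum_rank_inj) enum_valK up mulr0n mul0r.
Qed.

Lemma monomial_mxD g h phi : monomial_mx g phi + monomial_mx h phi
  = monomial_mx (fun t => g t + h t) phi.
Proof. by apply/matrixP => p q; rewrite !mxE mulrnDl. Qed.

Lemma eq_monomial_mx g h phi psi : g =1 h -> phi =1 psi ->
  monomial_mx g phi = monomial_mx h psi.
Proof. by move=> gh pp; apply/matrixP => p q; rewrite !mxE gh pp. Qed.

Lemma monomial_mx1 : monomial_mx (fun=> 1) id = 1%:M.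
Proof.
apply/matrixP => p q; rewrite !mxE eq_sym (inj_eq enum_val_inj) //.
Qed.

Lemma monomial_mx0 phi : monomial_mx (fun=> 0) phi = 0.
Proof. by apply/matrixP => p q; rewrite !mxE mul0rn. Qed.

Definition basis_col (t : T) : 'cV[K]_#|T| := \col_p (enum_val p == t)%:R.

Lemma monomial_mx_col g phi t : monomial_mx g phi *m basis_col t
  = \col_p (g (enum_val p) * (phi (enum_val p) == t)%:R).
Proof.
apply/colP => p; rewrite !mxE (bigD1 (enum_rank (phi (enum_val p)))) //=.
rewrite !mxE enum_rankK eqxx mulr1n big1 ?addr0 // => u /negPf up.
by rewrite mxE -(inj_eq enum_rank_inj) enum_valK up mulr0n mul0r.
Qed.

End MonomialMatrix.

Section Fock.
Variables (K : comNzRingType) (X : finType).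
Local Notation T := {ffun X -> bool}.
Implicit Types (x y : X) (f : T) (e : bool).

Definition toggle x f : T := [ffun y => f y (+) (y == x)].

Lemma toggleC x y f : toggle x (toggle y f) = toggle y (toggle x f).
Proof. by apply/ffunP => z; rewrite !ffunE addbAC. Qed.

Lemma toggleK x f : toggle x (toggle x f) = f.
Proof. by apply/ffunP => z; rewrite !ffunE -addbA addbb addbF. Qed.

Definition jw_sign x f : K :=
  \prod_(y | (enum_rank y < enum_rank x)%N) (-1) ^+ f y.

Lemma jw_sign_toggle x y f : jw_sign x (toggle y f)
  = (-1) ^+ (enum_rank y < enum_rank x)%N * jw_sign x f.
Proof.
rewrite /jw_sign; case: ltnP => yx.
  rewrite (bigD1 y) // [in RHS](bigD1 y) //= ffunE eqxx.
  rewrite (eq_bigr (fun z => (-1) ^+ f z)) => [|z /andP[_ /negPf zy]].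
    by rewrite addbT; case: (f y); rewrite /= ?expr0 ?expr1 ?mul1r ?mulN1r ?opprK.
  by rewrite ffunE zy addbF.
rewrite mul1r; apply: eq_bigr => z zx; rewrite ffunE.
by case: eqP zx => [->|_]; rewrite ?addbF // ltnNge yx.
Qed.

Lemma jw_sign_sqr x f : jw_sign x f * jw_sign x f = 1.
Proof.
rewrite -big_split big1 //= => y _.
by rewrite -signr_addb addbb.
Qed.

(* For e = true (resp. false) this is the creation (resp. annihilation)
   operator of the mode x, with the Jordan-Wigner sign. *)
Definition fermion e x : 'M[K]_#|{: T}| :=
  monomial_mx (fun f => if f x == e then jw_sign x f else 0) (toggle x).

(** For distinct modes exactly one of the two signs sees the other mode, so the two orders cancel.
    For equal modes, equal operators square to zero, and of two opposite ones exactly one order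
    survives, with squared sign 1. *)
Lemma fermion_anticomm e x e' y :
  fermion e x *m fermion e' y + fermion e' y *m fermion e x
  = ((x == y) && (e != e'))%:R%:M.
Proof.
rewrite !monomial_mxM [X in _ + X](@eq_monomial_mx _ _ _ _ _ (toggle y \o toggle x) (frefl _)) => [|f]; last exact: toggleC.
rewrite monomial_mxD; have [xy|xy] := eqVneq x y; last first.
  rewrite raddf0 -(monomial_mx0 _ (toggle y \o toggle x)).
  apply: eq_monomial_mx => // f.
  rewrite !jw_sign_toggle ![toggle _ _ _]ffunE [y == x]eq_sym (negPf xy) !addbF.
  case: eqP => _; case: eqP => _; rewrite ?mul0r ?mulr0 ?addr0 //.
  rewrite mulrCA [X in _ + X]mulrCA [jw_sign y f * _]mulrC -mulrDl.
  have : enum_rank x != enum_rank y by rewrite (inj_eq enum_rank_inj).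
  rewrite -val_eqE /=; case: ltngtP => //= _ _; rewrite expr0 expr1.
    by rewrite addNr mul0r.
  by rewrite subrr mul0r.
rewrite xy /=.
rewrite (@eq_monomial_mx _ _ _ (fun=> (e != e')%:R) _ id).
- case: (e != e'); last by rewrite monomial_mx0 raddf0.
  by rewrite monomial_mx1.
- move=> f; rewrite !jw_sign_toggle ltnn mul1r ![toggle _ _ _]ffunE eqxx addbT.
  by case: (f y); case: e; case: e'; rewrite /= ?mul0r ?mulr0 ?addr0 ?add0r ?jw_sign_sqr.
- by move=> f; rewrite /= toggleK.
Qed.
End Fock.

Section Bilinears.
Variables (A : pzRingType) (I J : finType) (c d : I * J -> A).
Hypothesis cc : forall x y, c x * c y + c y * c x = 0.
Hypothesis dd : forall x y, d x * d y + d y * d x = 0.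
Hypothesis cd : forall x y, c x * d y + d y * c x = (x == y)%:R.

(** Moving the inner [c] past [d] leaves the deltas; the quartic remainders of the two products
    agree, as the pair of [d] and the pair of [c] each change sign. *)
Lemma bilinear_comm x y z t : d x * c y * (d z * c t) - d z * c t * (d x * c y)
  = (y == z)%:R * (d x * c t) - (x == t)%:R * (d z * c y).
Proof.
have cdE u v : c u * d v = (u == v)%:R - d v * c u by rewrite -cd addrK.
have ccE : c t * c y = - (c y * c t) by apply/eqP; rewrite -addr_eq0 cc.
have ddE : d z * d x = - (d x * d z) by apply/eqP; rewrite -addr_eq0 dd.
have E u v p q : d u * c v * (d p * c q)
    = (v == p)%:R * (d u * c q) - d u * d p * (c v * c q).
  rewrite mulrA -[d u * c v * d p]mulrA cdE mulrBr mulrBl commr_nat.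
  by rewrite -!mulrA.
rewrite !E ccE ddE mulrNN [t == x]eq_sym opprB addrA subrK //.
Qed.

(** The sum over copies [a] lets a weight grow up to the number of copies, where a single fermion
    would only give 0 and 1. *)
Definition gl_elt i j : A := \sum_a d (i, a) * c (j, a).

Lemma gl_comm i j k l : gl_elt i j * gl_elt k l - gl_elt k l * gl_elt i j
  = (j == k)%:R * gl_elt i l - (i == l)%:R * gl_elt k j.
Proof.
rewrite /gl_elt !big_distrlr /= [X in _ - X]exchange_big /= -sumrB.
transitivity (\sum_a (\sum_b ((j, a) == (k, b))%:R * (d (i, a) * c (l, b))
    - \sum_b ((i, a) == (l, b))%:R * (d (k, b) * c (j, a)))).
  by apply: eq_bigr => a _; rewrite -!sumrB; apply: eq_bigr => b _; apply: bilinear_comm.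
rewrite sumrB [X in _ - X]exchange_big /= !big_distrr /=.
congr (_ - _); apply: eq_bigr => a _; rewrite (bigD1 a) //= big1 ?addr0 => [|b /negPf ba].
- by rewrite xpair_eqE eqxx andbT.
- by rewrite xpair_eqE [a == b]eq_sym ba andbF mul0r.
- by rewrite xpair_eqE eqxx andbT.
- by rewrite xpair_eqE ba andbF mul0r.
Qed.

Variable bar : I -> I.
Hypothesis barK : involutive bar.

Definition so_elt i j : A := gl_elt i j - gl_elt (bar j) (bar i).

Lemma so_elt_bar i j : so_elt (bar j) (bar i) = - so_elt i j.
Proof. by rewrite /so_elt !barK opprB. Qed.

Lemma so_comm i j k l : so_elt i j * so_elt k l - so_elt k l * so_elt i j =
  contraction so_elt i j k l - contraction so_elt i j (bar l) (bar k).
Proof.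
have bE u v : (bar u == v) = (u == bar v) by rewrite -(can_eq barK) barK.
have commBl (a a' b : A) :
    (a - a') * b - b * (a - a') = (a * b - b * a) - (a' * b - b * a').
  rewrite mulrBl mulrBr !opprB [X in _ + X]addrC addrACA; congr (_ + _).
  by rewrite addrC.
have commBr (a b b' : A) :
    a * (b - b') - (b - b') * a = (a * b - b * a) - (a * b' - b' * a).
  rewrite mulrBl mulrBr !opprB [X in _ + X]addrC addrACA; congr (_ + _).
  by rewrite addrC.
rewrite /contraction {1 2 3 4}/so_elt commBr !commBl !gl_comm /so_elt !barK.
rewrite !bE !barK [l == bar j]eq_sym bE ![k == j]eq_sym !mulrBr.
rewrite !opprB !addrA; by rewrite [LHS](ACl (1*6*5*2*7*4*3*8)).
Qed.
End Bilinears.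

Section GlHighestWeight.
Variables (K : comNzRingType) (N L : nat) (lam : 'I_N -> nat).
Hypothesis lam_le : forall i, (lam i <= L)%N.
Hypothesis lam_mono : forall i j : 'I_N, (i <= j)%N -> (lam j <= lam i)%N.

Local Notation X := ('I_N * 'I_L)%type.
Local Notation c := (@fermion K X false).
Local Notation d := (@fermion K X true).
Local Notation E := (gl_elt c d).

(** The occupied modes form the Young diagram of [lam]. *)
Definition hw_state : {ffun X -> bool} := [ffun x : X => (x.2 < lam x.1)%N].
Definition hw_vector := basis_col K hw_state.

Lemma hw_vector_neq0 : hw_vector != 0.
Proof.
apply/eqP => /colP /(_ (enum_rank hw_state)) /eqP.
by rewrite !mxE enum_rankK eqxx oner_eq0.
Qed.

Lemma bilinear_hw x y : (d x *m c y) *m hw_vector =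
  \col_p let f : {ffun X -> bool} := enum_val p in
    (if f x == true then jw_sign K x f else 0)
    * (if toggle x f y == false then jw_sign K y (toggle x f) else 0)
    * (toggle y (toggle x f) == hw_state)%:R.
Proof. by rewrite monomial_mxM monomial_mx_col. Qed.

(** A particle moved from row j up to row i within its column finds its place occupied, since the
    rows of the diagram weakly decrease. *)
Lemma gl_elt_raise (i j : 'I_N) : (i < j)%N -> E i j *m hw_vector = 0.
Proof.
move=> ij; rewrite mulmx_suml big1 // => a _; rewrite bilinear_hw.
have xy : ((i, a) == (j, a)) = false by rewrite xpair_eqE -val_eqE ltn_eqF.
apply/colP => p; rewrite !mxE /= eqb_id eqbF_neg; move: (enum_val p) => f.
rewrite /= [toggle _ f _]ffunE [(j, a) == _]eq_sym xy addbF.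
case fi: (f (i, a)); last by rewrite !mul0r.
case fj: (f (j, a)); first by rewrite mulr0 mul0r.
case: eqP => [e|_]; last by rewrite mulr0.
have := congr1 (fun h : {ffun _} => h (i, a)) e.
have := congr1 (fun h : {ffun _} => h (j, a)) e.
rewrite !ffunE /= !eqxx xy [(j, a) == _]eq_sym xy fi fj /=.
move=> /esym aj; move: (leq_trans aj (lam_mono (ltnW ij))) => ->.
by [].
Qed.

Lemma gl_elt_diag i : E i i *m hw_vector = (lam i)%:R *: hw_vector.
Proof.
rewrite mulmx_suml (eq_bigr (fun a : 'I_L => (a < lam i)%N%:R *: hw_vector)) => [|a _]; last first.
  rewrite bilinear_hw; apply/colP => p; rewrite !mxE; move: (enum_val p) => f.
  rewrite /= toggleK [toggle _ f _]ffunE eqxx addbT jw_sign_toggle ltnn mul1r.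
  have [->|_] := eqVneq f hw_state; last by rewrite !mulr0.
  by rewrite ffunE /=; case: ltnP => _ /=; rewrite ?mul0r // jw_sign_sqr.
rewrite -scaler_suml -natr_sum; congr (_%:R *: _).
have sumE m k : (\sum_(a < m) (a < k)%N = minn m k)%N.
  elim: m => [|m IHm]; first by rewrite big_ord0 min0n.
  by rewrite big_ord_recr /= IHm; case: (ltnP m k) => /= mk; lia.
by rewrite sumE; apply/minn_idPr.
Qed.
End GlHighestWeight.

Section SoHighestWeight.
Variables (K : comNzRingType) (N : nat) (lam : 'I_N -> nat).
Hypothesis lam_mono : forall i j : 'I_N, (i <= j)%N -> (lam j <= lam i)%N.

(** The involution is taken to be [rev_ord] because it reverses the order: for i < j both summands
    of [F i j] are then raising, so one vector serves as highest weight vector of gl and of so. *)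
Lemma so_highest_weight :
  exists d (F : 'I_N -> 'I_N -> 'M[K]_d) (v : 'cV[K]_d),
  [/\ v != 0, forall i j, F (rev_ord j) (rev_ord i) = - F i j,
     forall i j k l, F i j * F k l - F k l * F i j =
       contraction F i j k l - contraction F i j (rev_ord l) (rev_ord k),
     forall i j : 'I_N, (i < j)%N -> F i j *m v = 0
   & forall i, F i i *m v = ((lam i)%:R - (lam (rev_ord i))%:R) *: v].
Proof.
pose L := \max_i lam i.
have lam_le i : (lam i <= L)%N by apply: leq_bigmax.
exists _, (so_elt (@fermion K ('I_N * 'I_L)%type false)
  (@fermion K ('I_N * 'I_L)%type true) (@rev_ord N)), (hw_vector K L lam); split.
- exact: hw_vector_neq0.
- exact/so_elt_bar/rev_ordK.
- apply: so_comm; last exact: rev_ordK.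
  + by move=> x y; rewrite [LHS]fermion_anticomm andbF raddf0.
  + by move=> x y; rewrite [LHS]fermion_anticomm andbF raddf0.
  + by move=> x y; rewrite [LHS]fermion_anticomm andbT; case: (x == y); rewrite ?raddf0.
- move=> i j ij; apply: etrans (mulmxBl _ _ _) _.
  have E1 := gl_elt_raise K L lam_mono ij.
  have ji : (rev_ord j < rev_ord i)%N by case: (i) (j) ij => i' iN [j' jN] /=; lia.
  have E2 := gl_elt_raise K L lam_mono ji.
  set x := (X in X - _ = _); set y := (X in _ - X = _).
  have -> : x = 0 by exact: E1.
  have -> : y = 0 by exact: E2.
  exact: subrr.
- move=> i; apply: etrans (mulmxBl _ _ _) _.
  have E1 := gl_elt_diag K lam_le i; have E2 := gl_elt_diag K lam_le (rev_ord i).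
  set x := (X in X - _ = _); set y := (X in _ - X = _).
  rewrite (E1 : x = _) (E2 : y = _); exact/esym/scalerBl.
Qed.

End SoHighestWeight.

Lemma sum_ffun_lift (A : nmodType) (I : finType) n (x : 'I_n.+1)
    (H : {ffun 'I_n.+1 -> I} -> A) :
  \sum_g H g = \sum_i \sum_(g : {ffun 'I_n -> I})
    H [ffun a => if unlift x a is Some b then g b else i].
Proof.
pose h (p : I * {ffun 'I_n -> I}) : {ffun 'I_n.+1 -> I} :=
  [ffun a => if unlift x a is Some b then p.2 b else p.1].
have hbij : bijective h.
  exists (fun g : {ffun 'I_n.+1 -> I} => (g x, [ffun b => g (lift x b)])).
    case=> i g; rewrite ffunE unlift_none; congr (_, _); apply/ffunP => b.
    by rewrite !ffunE liftK.
  move=> g; apply/ffunP => a; rewrite ffunE.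
  by case: unliftP => [b ->|->] //=; rewrite ffunE.
by rewrite (reindex h) /= ?pair_big //; apply: onW_bij.
Qed.

(** * Eigenvalues of Casimir elements *)

Section MatrixPowers.
Variables (A : pzRingType) (I : finType) (F : I -> I -> A).

Fixpoint power_entry k i j : A :=
  if k is k'.+1 then \sum_l power_entry k' i l * F l j else (i == j)%:R.

(** The sum runs over paths of m edges starting at [i]. Weighting the end point by an arbitrary [f]
    lets the induction absorb the last edge into [f]. *)
Lemma path_sum m i (f : I -> A) :
  \sum_(g : {ffun 'I_m.+1 -> I}) (g ord0 == i)%:R
     * (\prod_(0 <= a < m) F (g (inord a)) (g (inord a.+1))) * f (g (inord m))
  = \sum_j power_entry m i j * f j.
Proof.
elim: m f => [|m IHm] f.
  rewrite (bigD1 [ffun=> i]) //= [X in _ + X]big1 ?addr0 => [|g gi].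
    rewrite big_geq // !ffunE eqxx !mul1r (bigD1 i) //= eqxx mul1r.
    by rewrite big1 ?addr0 // => j /negPf; rewrite eq_sym => ->; rewrite mul0r.
  rewrite (_ : _ == i = false) ?mul0r //; apply: contraNF gi => /eqP <-.
  by apply/eqP/ffunP => a; rewrite ffunE [a]ord1.
have liftE a : (a <= m)%N -> inord a = lift ord_max (inord a : 'I_m.+1) :> 'I_m.+2.
  move=> am; apply: val_inj; rewrite /= /bump !inordK ?ltnS ?(leqW am) //.
  by rewrite leqNgt ltnS am.
rewrite (sum_ffun_lift ord_max) exchange_big /=.
pose f' j := \sum_k F j k * f k.
have -> : \sum_j power_entry m.+1 i j * f j = \sum_j power_entry m i j * f' j.
  under eq_bigr => j _ do rewrite big_distrl /=.
  rewrite exchange_big /=; apply: eq_bigr => j _; rewrite big_distrr /=.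
  by apply: eq_bigr => k _; rewrite mulrA.
rewrite -(IHm f'); apply: eq_bigr => g _.
rewrite big_distrr /=; apply: eq_bigr => k _.
rewrite big_nat_recr //= !mulrA.
have -> : inord m.+1 = ord_max :> 'I_m.+2 by apply: val_inj; rewrite /= inordK.
have gE a : (a <= m)%N ->
    [ffun b => if unlift ord_max b is Some c then g c else k] (inord a : 'I_m.+2)
    = g (inord a).
  by move=> am; rewrite ffunE liftE // liftK.
have -> : ord0 = inord 0 :> 'I_m.+2 by apply: val_inj; rewrite /= inordK.
have -> : ord0 = inord 0 :> 'I_m.+1 by apply: val_inj; rewrite /= inordK.
rewrite !gE // [X in F _ X]ffunE unlift_none [X in f X]ffunE unlift_none.
congr (_ * _ * _ * _); apply: eq_big_nat => a /= am.
by rewrite !gE // ltnW.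
Qed.

(** In a standard cycle the order of the factors follows the cycle, so the sum over closed paths is
    the trace of a power of the matrix of generators. *)
Lemma op_std_cycle m : (0 < m)%N -> op F (std_cycle m) = \sum_i power_entry m i i.
Proof.
case: m => // m _ /=.
under [RHS]eq_bigr => i _ do rewrite -(path_sum m i (fun j => F j i)).
rewrite [RHS]exchange_big /=; apply: eq_bigr => g _.
rewrite [RHS](bigD1 (g ord0)) //= eqxx mul1r [X in _ + X]big1 ?addr0 => [|i /negPf]; last first.
  by rewrite eq_sym => ->; rewrite !mul0r.
rewrite big_ord_recr /= big_mkord; congr (_ * F (g _) (g _)).
- apply: eq_bigr => a _; congr (F (g _) (g _)); apply: val_inj.
    by rewrite /= inordK // ltnS ltnW.
  by rewrite permE /= inordK ?ltnS // modn_small // ltnS.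
- by apply: val_inj; rewrite /= inordK.
- by apply: val_inj; rewrite permE /= modnn.
Qed.

End MatrixPowers.

Section Covariance.
Variables (A : pzRingType) (I : finType) (bar : I -> I) (F : I -> I -> A).
Hypothesis barK : involutive bar.
Hypothesis F_bar : forall i j, F (bar j) (bar i) = - F i j.
Hypothesis F_comm : forall i j k l, F i j * F k l - F k l * F i j =
  contraction F i j k l - contraction F i j (bar l) (bar k).

(** The action of the generator with indices p, q on a two-index tensor: one term for each index of
    M, and their mirror images. *)
Definition adjoint_action (M : I -> I -> A) p q a b : A :=
  (a == q)%:R * M p b - (p == b)%:R * M a q
  - (a == bar p)%:R * M (bar q) b + (bar q == b)%:R * M a (bar p).

Lemma F_adjoint p q a b : F p q * F a b - F a b * F p q = adjoint_action F p q a b.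
Proof.
rewrite F_comm /contraction /adjoint_action opprB -[RHS]addrA; congr (_ + _).
have bE u t : (bar u == t) = (u == bar t) by rewrite -(can_eq barK) barK.
have -> : F p (bar a) = - F a (bar p) by rewrite -F_bar barK.
have -> : F (bar b) q = - F (bar q) b by rewrite -F_bar barK.
by rewrite !mulrN opprK !bE [b == _]eq_sym bE [p == _]eq_sym bE.
Qed.

Local Notation pw := (power_entry F).

(** Covariance passes to matrix products: the terms acting on the summed index appear with opposite
    signs from the two factors and cancel. *)
Lemma power_entry_adjoint k p q a b :
  F p q * pw k a b - pw k a b * F p q = adjoint_action (pw k) p q a b.
Proof.
elim: k a b => [|k IHk] a b /=.
  have bE u t : (bar u == t) = (u == bar t) by rewrite -(can_eq barK) barK.
  rewrite commr_nat subrr /adjoint_action /=; apply/esym.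
  have -> : (a == q)%:R * (p == b)%:R = (p == b)%:R * (a == q)%:R :> A.
    by rewrite -!natrM mulnC.
  have -> : (a == bar p)%:R * (bar q == b)%:R = (bar q == b)%:R * (a == bar p)%:R :> A.
    by rewrite -!natrM mulnC.
  by rewrite subrr sub0r addNr.
have -> : F p q * pw k.+1 a b - pw k.+1 a b * F p q
    = \sum_l (adjoint_action (pw k) p q a l * F l b + pw k a l * adjoint_action F p q l b).
  rewrite big_distrr big_distrl -sumrB; apply: eq_bigr => l _ /=.
  by rewrite -IHk -F_adjoint mulrBl mulrBr !mulrA subrKA.
have sel (X : I -> A) c : \sum_l (c == l)%:R * X l = X c.
  rewrite (bigD1 c) //= eqxx mul1r big1 ?addr0 // => l /negPf.
  by rewrite eq_sym => ->; rewrite mul0r.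
have selr (X : I -> A) Y c : \sum_l X l * ((l == c)%:R * Y) = X c * Y.
  rewrite (bigD1 c) //= eqxx mul1r big1 ?addr0 // => l /negPf.
  by move=> ->; rewrite mul0r mulr0.
have -> : \sum_l (adjoint_action (pw k) p q a l * F l b + pw k a l * adjoint_action F p q l b)
  = ((a == q)%:R * pw k.+1 p b - pw k a q * F p b
    - (a == bar p)%:R * pw k.+1 (bar q) b + pw k a (bar p) * F (bar q) b)
  + (pw k a q * F p b - (p == b)%:R * pw k.+1 a q
    - pw k a (bar p) * F (bar q) b + (bar q == b)%:R * pw k.+1 a (bar p)).
  rewrite big_split /=; congr (_ + _).
    rewrite -(sel (fun l => pw k a q * F l b) p).
    rewrite -(sel (fun l => pw k a (bar p) * F l b) (bar q)).
    rewrite !big_distrr /= -!sumrB -big_split /=; apply: eq_bigr => l _.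
    by rewrite /adjoint_action !(mulrDl, mulNr) !mulrA.
  rewrite -(selr (pw k a) (F p b)) -(selr (pw k a) (F (bar q) b)).
  rewrite !big_distrr /= -!sumrB -big_split /=; apply: eq_bigr => l _.
  rewrite /adjoint_action !(mulrDr, mulrN); congr (_ - _ - _ + _).
    by rewrite !mulrA commr_nat.
  by rewrite !mulrA commr_nat.
rewrite /adjoint_action /= !addrA.
rewrite [LHS](ACl (1*6*3*8*(2*5)*(4*7))) /= addNr addr0.
by rewrite subrr addr0.
Qed.

End Covariance.

(* The eigenvalue of the i-th diagonal entry of the k-th power of the matrix
   of generators on a highest weight vector of weight mu. *)
Fixpoint entry_eigenvalue (K : pzRingType) N (mu : 'I_N -> K) k (i : 'I_N) : K :=
  if k is k'.+1 then
    mu i * entry_eigenvalue mu k' i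
    + \sum_(l < N | (i < l)%N && (l != rev_ord i))
        (entry_eigenvalue mu k' i - entry_eigenvalue mu k' l)
  else 1.

Section HighestWeight.
Variables (K : comNzRingType) (N d : nat) (F : 'I_N -> 'I_N -> 'M[K]_d).
Variables (v : 'cV[K]_d) (mu : 'I_N -> K).
Local Notation bar := (@rev_ord N).
Hypothesis F_bar : forall i j, F (bar j) (bar i) = - F i j.
Hypothesis F_comm : forall i j k l, F i j * F k l - F k l * F i j =
  contraction F i j k l - contraction F i j (bar l) (bar k).
Hypothesis F_raise : forall i j : 'I_N, (i < j)%N -> F i j *m v = 0.
Hypothesis F_diag : forall i, F i i *m v = mu i *: v.
Local Notation pw := (power_entry F).

Lemma rev_ord_lt (i j : 'I_N) : (bar j < bar i)%N = (i < j)%N.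
Proof. by case: i j => i iN [j jN] /=; lia. Qed.

(** In the sum over the last factor [F l j], the terms l < j kill [v] and l = j gives [mu j]. For l
    > j the factor is commuted to the left: as [pw k i l] kills [v], only the commutator remains,
    known by covariance. *)
Lemma power_entry_hw k (i j : 'I_N) : (i <= j)%N ->
  pw k i j *m v = (if i == j then entry_eigenvalue mu k i else 0) *: v.
Proof.
elim: k i j => [|k IHk] i j ij.
  by rewrite /=; case: eqP => _; rewrite ?scale1r ?scale0r ?mul1mx ?mul0mx.
rewrite /= mulmx_suml (bigID (fun l : 'I_N => (l < j)%N)) /= big1 ?add0r => [|l lj].
  rewrite (bigD1 j) ?ltnn //=.
  rewrite -mulmxA F_diag -scalemxAr IHk //.
  have step (l : 'I_N) : (j < l)%N -> pw k i l * F l j *m v =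
     (if (i == j) && (l != bar j) then entry_eigenvalue mu k i - entry_eigenvalue mu k l else 0) *: v.
    move=> jl; have il : (i < l)%N by apply: leq_ltn_trans jl.
    have := power_entry_adjoint (@rev_ordK N) F_bar F_comm k l j i l.
    move/(canRL (subKr _)) => ->; rewrite mulmxBl -[F l j * _ *m v]mulmxA IHk ?(ltnW il) //.
    rewrite -val_eqE (ltn_eqF il) scale0r mulmx0 sub0r /adjoint_action.
    have natM (b : bool) (M : 'M[K]_d) : b%:R * M *m v = if b then M *m v else 0.
      by case: b; rewrite ?mul1r ?mul0r ?mul0mx.
    rewrite mulmxDl !mulmxBl !natM eqxx.
    have lb : (bar j == l) = (l == bar j) by rewrite eq_sym.
    have [eij|nij] := eqVneq i j.
      rewrite -eij in jl lb *; have -> : (i == bar l) = (l == bar i).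
        by rewrite -(inj_eq rev_ord_inj) rev_ordK eq_sym.
      (* For l = bar i the mirror terms cancel the plain ones; this is why [entry_eigenvalue] omits
         that index. *)
      rewrite lb; have [->|_] /= := eqVneq l (bar i).
        by rewrite rev_ordK !IHk // !eqxx [X in - (X + _)]addrAC subrr add0r addNr oppr0 scale0r.
      by rewrite !IHk // !eqxx subr0 addr0 opprB scalerBl.
    have lij : (i < j)%N by rewrite ltn_neqAle nij.
    rewrite IHk // (negPf nij) scale0r subrr /=; apply/eqP; rewrite oppr_eq0; apply/eqP.
    have -> : (if i == bar l then pw k (bar j) l *m v else 0) = 0.
      case: eqP => // il'; have bjl : (bar j < l)%N by rewrite -[l]rev_ordK -il' rev_ord_lt.
      by rewrite IHk ?(ltnW bjl) // -val_eqE (ltn_eqF bjl) scale0r.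
    have -> : (if bar j == l then pw k i (bar l) *m v else 0) = 0.
      by case: eqP => // <-; rewrite rev_ordK IHk // (negPf nij) scale0r.
    by rewrite subrr addr0.
  rewrite (eq_bigr (fun l : 'I_N => (if (i == j) && (l != bar j) then
      entry_eigenvalue mu k i - entry_eigenvalue mu k l else 0) *: v)) => [|l /andP[lj nlj]].
    rewrite -scaler_suml scalerA -scalerDl; congr (_ *: v).
    have [<-|_] := eqVneq i j; last by rewrite mulr0 add0r big1.
    congr (_ + _); rewrite -big_mkcondr /=; apply: eq_bigl => l.
    by rewrite -leqNgt /=; congr (_ && _); rewrite ltn_neqAle andbC eq_sym.
  by apply: step; rewrite ltn_neqAle leqNgt lj eq_sym val_eqE nlj.
by rewrite -mulmxA F_raise // mulmx0.
Qed.

Lemma op_std_cycle_hw m : (0 < m)%N ->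
  op F (std_cycle m) *m v = (\sum_i entry_eigenvalue mu m i) *: v.
Proof.
move=> m0; rewrite op_std_cycle // mulmx_suml scaler_suml; apply: eq_bigr => i _.
by rewrite power_entry_hw // eqxx.
Qed.

End HighestWeight.

(** * Transport of the recurrence rule along additive maps *)

Section RuleMorphism.
Variables (G H : zmodType) (c0 : G -> G) (c1 : H -> H) (f : G -> H).
Hypotheses (fB : {morph f : x y / x - y}) (fc : forall x, f (c0 x) = c1 (f x)).
Variables (w : forall m, 'S_m -> G) (n : nat) (s : 'S_n.+2) (r : 'I_n.+1).
Local Notation fw := (fun m (t : 'S_m) => f (w t)).

Let fN : {morph f : x / - x}.
Proof. by move=> x; rewrite -sub0r fB -(subrr 0) fB subrr sub0r. Qed.

Let fD : {morph f : x y / x + y}.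
Proof. by move=> x y; rewrite -[y in LHS]opprK fB fN opprK. Qed.

Let fb cs : f (gbracket c0 w s r cs) = gbracket c1 fw s r cs.
Proof. by rewrite /gbracket; elim: count => //= k <-. Qed.

Let fa k x : f (altsgn k x) = altsgn k (f x).
Proof. by rewrite /altsgn; case: odd; rewrite ?fN. Qed.

Lemma additive_rule_morph : additive_rule c0 w s r -> additive_rule c1 fw s r.
Proof.
move=> [ra rb rc]; split=> [P Q rP cP cQ P' Q'|P Q Q0 cPQ P' Q'|P cP b].
- by rewrite -!fb -fD -!fB -fa -!fD -ra.
- by rewrite -!fb -!fD -!fB -fa -!fD -rb.
- by rewrite /b -!fb -fc mulr2n -fD -fB -fD -mulr2n -rc.
Qed.

(** Serves to bring the rule back from multiples of the highest weight vector to scalars, and from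
    functions of the weight to polynomials. *)
Lemma additive_rule_inj :
  injective f -> additive_rule c1 fw s r -> additive_rule c0 w s r.
Proof.
move=> fI [ra rb rc].
split=> [P Q rP cP cQ P' Q'|P Q Q0 cPQ P' Q'|P cP b]; apply: fI.
- by rewrite !(fD, fN) fa !(fD, fN) !fb; apply: ra.
- by rewrite !(fD, fN) fa !(fD, fN) !fb; apply: rb.
- by rewrite fD fB mulr2n fD -mulr2n fc !fb; apply: rc.
Qed.

End RuleMorphism.

Lemma altsgnE (A : pzRingType) k (x : A) : altsgn k x = (-1) ^+ k * x.
Proof. by rewrite /altsgn -signr_odd; case: odd; rewrite ?mul1r // expr1 mulN1r. Qed.

Lemma recurrence_ruleP (A : comNzRingType) c (w : forall m, 'S_m -> A) n
    (s : 'S_n.+2) r :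
  recurrence_rule c w s r <-> additive_rule ( *%R (c 0%N)) w s r.
Proof.
have bE cs : bracket c w s r cs = gbracket ( *%R (c 0%N)) w s r cs.
  by rewrite /bracket /gbracket; elim: count => [|k /= <-]; rewrite ?mul1r // exprS mulrA.
split=> -[ra rb rc].
  split=> [P Q rP cP cQ P' Q'|P Q Q0 cPQ P' Q'|P cP b].
  - by rewrite altsgnE -!bE; apply: ra.
  - by rewrite altsgnE -!bE; apply: rb.
  - by rewrite /b -!bE -mulr_natl -mulrBl; apply: rc.
split=> [P Q rP cP cQ P' Q'|P Q Q0 cPQ P' Q'|P cP].
- by rewrite !bE -altsgnE; apply: ra.
- by rewrite !bE -altsgnE; apply: rb.
- by rewrite !bE mulrBl mulr_natl; apply: rc.
Qed.

Section HighestWeightModel.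
Variables (K : numFieldType) (N : nat) (lam : 'I_N -> nat).
Hypothesis lam_mono : forall i j : 'I_N, (i <= j)%N -> (lam j <= lam i)%N.

Definition hw_weight i : K := (lam i)%:R - (lam (rev_ord i))%:R.

(** The multiples of [v] are stable under everything the reduction uses, so each [op F s] acts on
    [v] by a scalar because the even standard cycles do. The relations of the operators then descend
    to these scalars, as [v] is nonzero. *)
Lemma hw_model : exists chi : forall m, 'S_m -> K,
  so_relations (fun k => \sum_i entry_eigenvalue hw_weight k.*2 i) chi.
Proof.
have [d [F [v [v0 F_bar F_comm F_raise F_diag]]]] := so_highest_weight K lam_mono.
have bK := @rev_ordK N.
have A2 (a : 'M[K]_d) : a + a = 0 -> a = 0.
  move=> /matrixP aa; apply/matrixP => p q; have /eqP := aa p q.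
  by rewrite !mxE -mulr2n mulrn_eq0 /= => /eqP.
have w_rule n (s : 'S_n.+2) r :
    additive_rule (fun u => N%:R *: u) (fun m t => op F t *m v) s r.
  have := op_rule bK F_bar F_comm A2 r s.
  apply: (additive_rule_morph (f := fun a => a *m v)) => [x y|x] /=.
    exact: mulmxBl.
  rewrite card_ord mulr_natl scaler_nat; exact: (raddfMn (mulmxr v)).
have w_scalar m (s : 'S_m) : exists x, op F s *m v = x *: v.
  apply: (reduction (w := fun m t => op F t *m v) (B := fun u => exists x, u = x *: v)) => {m s}.
  - by move=> _ _ [x ->] [y ->]; exists (x - y); rewrite scalerBl.
  - move=> u [x ux]; exists (x / 2); rewrite mulrC -scalerA -ux -mulr2n -scaler_nat.
    by rewrite scalerA mulVf ?scale1r // pnatr_eq0.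
  - by exists 1; rewrite op_empty mul1mx scale1r.
  - move=> m n s t [x sx] [y ty]; exists (y * x).
    by rewrite op_concat -mulmxA ty -scalemxAr sx scalerA.
  - move=> m m2 em; exists (\sum_i entry_eigenvalue hw_weight m i).
    by apply: op_std_cycle_hw => //; apply: leq_trans m2.
  - move=> m s x; rewrite (op_invert bK F_bar) // /altsgn; case: odd => //.
    by rewrite mulNmx.
  - move=> n s r; apply: (additive_rule_step (c0 := fun u => N%:R *: u) (w := fun m t => op F t *m v)
      (B := fun u => exists x, u = x *: v)) => //.
    + by move=> _ _ [x ->] [y ->]; exists (x - y); rewrite scalerBl.
    + by move=> _ [x ->]; exists (N%:R * x); rewrite scalerA.
have [p vp] : exists p, v p 0 != 0.
  apply/existsP; apply: contraNT v0; rewrite negb_exists => /forallP v0.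
  by apply/eqP/colP => p; rewrite mxE; apply/eqP; rewrite -[_ == _]negbK; apply: v0.
(* The scalar is read off at a coordinate [p] where [v] does not vanish. *)
pose chi m (s : 'S_m) := (op F s *m v) p 0 / v p 0.
have chiE m (s : 'S_m) : op F s *m v = chi m s *: v.
  by have [x sx] := w_scalar m s; rewrite /chi sx mxE mulfK.
have scI : injective (fun x : K => x *: v).
  by move=> x y /eqP; rewrite -subr_eq0 -scalerBl scaler_eq0 (negPf v0) orbF subr_eq0 => /eqP.
exists chi; split.
- by apply: scI; rewrite -chiE op_empty mul1mx scale1r.
- move=> m n s t; apply: scI; rewrite -chiE op_concat -mulmxA !chiE -scalemxAr chiE.
  by rewrite scalerA mulrC.
- move=> m s x; apply: scI; rewrite -chiE (op_invert bK F_bar) -altsgnE /altsgn.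
  by case: odd; rewrite ?mulNmx ?scaleNr chiE.
- move=> m m2 em; apply: scI; rewrite -chiE.
  rewrite (op_std_cycle_hw F_bar F_comm F_raise F_diag); last exact: leq_trans m2.
  by rewrite -{1}[m]odd_double_half (negPf em).
- move=> n s r; apply/recurrence_ruleP.
  have -> : \sum_i entry_eigenvalue hw_weight 0.*2 i = N%:R by rewrite sumr_const card_ord.
  apply: (additive_rule_inj (c1 := fun u => N%:R *: u) (f := ( *:%R^~ v : K -> _))).
  + by move=> x y /=; rewrite scalerBl.
  + by move=> x /=; rewrite scalerA.
  + exact: scI.
  + have := w_rule n s r; congr (additive_rule _ _ s r).
    by apply: boolp.functional_extensionality_dep => k; apply/funext => t; rewrite chiE.
Qed.

End HighestWeightModel.

(** * Separation of polynomials by highest weights *)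

Section Evaluation.
Variables (S : comNzRingType) (u : nat -> S).

Definition monomial_value (m : {cmonom nat}) : S :=
  \prod_(k <- finsupp m) u k ^+ m k.

Lemma monomial_valueEw (E : {fset nat}) (m : {cmonom nat}) :
  (finsupp m `<=` E)%fset -> monomial_value m = \prod_(k <- E) u k ^+ m k.
Proof.
move=> mE; rewrite /monomial_value; apply: big_fset_incl => // k _.
by move=> /fsfun_dflt ->; rewrite expr0.
Qed.

Lemma monomial_value_is_mult : mmorphism monomial_value.
Proof.
split=> [m1 m2|]; last by rewrite /monomial_value mdom1 big_seq_fset0.
pose E := (finsupp m1 `|` finsupp m2)%fset.
have m12E : (finsupp (mmul m1 m2) `<=` E)%fset by rewrite mdomD.
rewrite (monomial_valueEw m12E) (@monomial_valueEw E m1) ?fsubsetUl //.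
rewrite (@monomial_valueEw E m2) ?fsubsetUr // -big_split /=.
by apply: eq_bigr => k _; rewrite cmM exprD.
Qed.

HB.instance Definition _ :=
  isMultiplicative.Build {cmonom nat} S monomial_value monomial_value_is_mult.

Lemma monomial_value_var k : monomial_value (ucm k) = u k.
Proof.
rewrite /monomial_value mdomU big_seq_fset1 cmU eqxx expr1 //.
Qed.
End Evaluation.

Lemma rmorph_monomial_value (S S' : comNzRingType) (f : {rmorphism S -> S'}) u m :
  f (monomial_value u m) = monomial_value (fun k => f (u k)) m.
Proof. by rewrite rmorph_prod; apply: eq_bigr => k _; rewrite rmorphXn. Qed.

(** A formal leading coefficient: [a] only bounds the degree and [c] may vanish, so the relation is
    compatible with sums as well as products. *)
Definition top_coef (S : nzRingType) (p : {poly S}) a c :=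
  (size p <= a.+1)%N /\ p`_a = c.

Section TopCoef.
Variable S : comNzRingType.
Implicit Types (p q : {poly S}).

Lemma top_coefM p q a b x y : top_coef p a x -> top_coef q b y ->
  top_coef (p * q) (a + b) (x * y).
Proof.
move=> [sp px] [sq qy]; split.
  apply: leq_trans (size_polyMleq _ _) _; lia.
rewrite coefM (bigD1 (Ordinal (leq_addr b a : (a < (a + b).+1)%N))) //= addKn px qy.
rewrite big1 ?addr0 // => i; rewrite -val_eqE /= neq_ltn => /orP[ia|ia].
  by rewrite [q`_ _]nth_default ?mulr0 //; apply: leq_trans sq _; lia.
by rewrite [p`_ _]nth_default ?mul0r // (leq_trans sp).
Qed.

Lemma top_coef1 : top_coef (1 : {poly S}) 0 1.
Proof. by split; rewrite ?size_poly1 // coef1. Qed.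

Lemma top_coefX p a x k : top_coef p a x -> top_coef (p ^+ k) (a * k) (x ^+ k).
Proof.
move=> px; elim: k => [|k IHk]; first by rewrite muln0 !expr0; apply: top_coef1.
by rewrite mulnS !exprS; apply: top_coefM.
Qed.

Lemma top_coef_sum (J : Type) (r : seq J) (P : pred J) (f : J -> {poly S}) a x :
  (forall i, P i -> top_coef (f i) a (x i)) ->
  top_coef (\sum_(i <- r | P i) f i) a (\sum_(i <- r | P i) x i).
Proof.
move=> fx; split; last by rewrite coef_sum; apply: eq_bigr => i /fx [].
apply: (big_ind (fun p : {poly S} => (size p <= a.+1)%N)) => [|p q sp sq|i /fx[]//].
  by rewrite size_poly0.
by apply: leq_trans (size_polyD _ _) _; rewrite geq_max sp.
Qed.

Lemma top_coef_prod (J : Type) (r : seq J) (f : J -> {poly S}) (a : J -> nat) x :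
  (forall i, top_coef (f i) (a i) (x i)) ->
  top_coef (\prod_(i <- r) f i) (\sum_(i <- r) a i) (\prod_(i <- r) x i).
Proof.
move=> fx; elim: r => [|i r IHr]; first by rewrite !big_nil; apply: top_coef1.
by rewrite !big_cons; apply: top_coefM.
Qed.
End TopCoef.

Lemma rmorph_entry_eigenvalue (S S' : pzRingType) (f : {rmorphism S -> S'}) N
    (mu : 'I_N -> S) k i :
  f (entry_eigenvalue mu k i) = entry_eigenvalue (fun i => f (mu i)) k i.
Proof.
elim: k i => [|k IHk] i /=; first by rewrite rmorph1.
rewrite rmorphD rmorphM rmorph_sum IHk; congr (_ + _); apply: eq_bigr => l _.
by rewrite rmorphB !IHk.
Qed.

(** With weights proportional to the indeterminate, only the product with [mu i] raises the degree;
    the differences stay one degree lower. *)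
Lemma top_coef_entry_eigenvalue (S : comNzRingType) N (tau : 'I_N -> S) k i :
  top_coef (entry_eigenvalue (fun i => tau i *: 'X) k i) k (tau i ^+ k).
Proof.
elim: k i => [|k IHk] i /=; first by rewrite expr0; apply: top_coef1.
have sumP : (size (\sum_(l < N | (i < l)%N && (l != rev_ord i))
    (entry_eigenvalue (fun i => tau i *: 'X) k i -
     entry_eigenvalue (fun i => tau i *: 'X) k l) : {poly S})%R <= k.+1)%N.
  apply: (big_ind (fun p : {poly S} => (size p <= k.+1)%N)) => [|p q sp sq|l _].
  - by rewrite size_poly0.
  - by apply: leq_trans (size_polyD _ _) _; rewrite geq_max sp.
  - apply: leq_trans (size_polyD _ _) _; rewrite geq_max size_polyN.
    by have [-> _] := IHk i; have [-> _] := IHk l.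
have XP : top_coef (tau i *: 'X * entry_eigenvalue (fun i => tau i *: 'X) k i)
    k.+1 (tau i ^+ k.+1).
  rewrite exprS -add1n; apply: top_coefM => //; split.
    by apply: leq_trans (size_scale_leq _ _) _; rewrite size_polyX.
  by rewrite coefZ coefX mulr1.
case: XP => sX cX; split.
  by apply: leq_trans (size_polyD _ _) _; rewrite geq_max sX ltnW.
by rewrite coefD cX nth_default ?addr0.
Qed.

Lemma poly_nat_eq0 (K : numFieldType) (p : {poly K}) :
  (forall n : nat, p.[n%:R] = 0) -> p = 0.
Proof.
move=> p0; apply: (@roots_geq_poly_eq0 _ p [seq n%:R | n <- iota 0 (size p)]).
- by apply/allP => x /mapP[n _ ->]; rewrite /root p0.
- by rewrite map_inj_uniq ?iota_uniq // => a b /eqP; rewrite eqr_nat => /eqP.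
- by rewrite size_map size_iota.
Qed.

Lemma digits_inj B J (f g : nat -> nat) :
  (forall k, f k < B)%N -> (forall k, g k < B)%N ->
  (\sum_(k < J) f k * B ^ k = \sum_(k < J) g k * B ^ k)%N ->
  forall k, (k < J)%N -> f k = g k.
Proof.
elim: J f g => // J IHJ f g fB gB; have B0 : (0 < B)%N by apply: leq_ltn_trans (fB 0%N).
have shift (h : nat -> nat) : (\sum_(k < J.+1) h k * B ^ k
    = h 0%N + (\sum_(k < J) h k.+1 * B ^ k) * B)%N.
  rewrite big_ord_recl muln1; congr (_ + _)%N; rewrite big_distrl /=.
  by apply: eq_bigr => k _; rewrite /bump add1n expnSr mulnA.
rewrite !shift => e.
have f0 : f 0%N = g 0%N.
  have := congr1 (modn^~ B) e; rewrite /= ![(_ 0%N + _)%N]addnC !modnMDl.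
  by rewrite !modn_small.
case=> [|k] kJ; first exact: f0.
apply: (IHJ (fun k => f k.+1) (fun k => g k.+1)) => //.
by move/eqP: e; rewrite f0 eqn_add2l eqn_pmul2r // => /eqP.
Qed.

Lemma monomial_value_ord (S : comNzRingType) (u : nat -> S) J (m : {cmonom nat}) :
  (forall k, (J <= k)%N -> m k = 0%N) ->
  monomial_value u m = \prod_(k < J) u k ^+ m k.
Proof.
move=> mJ; rewrite -(big_mkord xpredT (fun k => u k ^+ m k)).
rewrite (bigID (fun k => k \in finsupp m)) /= [X in _ * X]big1 ?mulr1 => [|k]; last first.
  by rewrite -cmE_eq0 => /eqP ->; rewrite expr0.
rewrite /monomial_value -[RHS]big_filter; apply: perm_big; apply: uniq_perm => [||k].
- exact: fset_uniq.
- by rewrite filter_uniq // iota_uniq.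
- rewrite mem_filter mem_index_iota /= andb_idr // -cmE_neq0.
  by apply: contraR; rewrite -leqNgt => /mJ ->.
Qed.

(** * Polynomials vanishing on power sums *)

Section PolynomialFunctions.
Variables (K : numFieldType) (E : {fset {cmonom nat}}) (a : {cmonom nat} -> K).

Definition poly_fun (S : comNzRingType) (f : K -> S) (u : nat -> S) : S :=
  \sum_(m <- E) f (a m) * monomial_value u m.

Lemma rmorph_poly_fun (S S' : comNzRingType) (f : K -> S) (g : {rmorphism S -> S'}) u :
  g (poly_fun f u) = poly_fun (g \o f) (fun k => g (u k)).
Proof.
rewrite rmorph_sum; apply: eq_bigr => m _.
by rewrite rmorphM rmorph_monomial_value.
Qed.

Variable J : nat.
Hypothesis EJ : forall m k, m \in E -> (J <= k)%N -> m k = 0%N.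

Lemma eq_poly_fun u u' : (forall k, (k < J)%N -> u k = u' k) ->
  poly_fun id u = poly_fun id u'.
Proof.
move=> uu'; rewrite /poly_fun big_seq [RHS]big_seq; apply: eq_bigr => m mE.
congr (_ * _); have mJ k := EJ (k := k) mE.
by rewrite !(monomial_value_ord _ mJ); apply: eq_bigr => k _; rewrite uu'.
Qed.

Lemma poly_fun_eq0 : (forall u, poly_fun id u = 0) -> forall m, m \in E -> a m = 0.
Proof.
move=> u0.
(* Kronecker substitution: [B] exceeds all exponents, so setting the k-th variable to n^(B^k) sends
   distinct monomials to distinct powers of n. *)
pose B := (\max_(m <- E) \max_(k < J) m k).+1.
have mB (m : {cmonom nat}) k : m \in E -> (m k < B)%N.
  move=> mE; rewrite ltnS; case: (ltnP k J) => kJ; last by rewrite (EJ mE kJ).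
  apply: leq_trans (leq_bigmax_seq _ mE isT).
  exact: (leq_bigmax (F := fun k : 'I_J => m k) (Ordinal kJ)).
pose e (m : {cmonom nat}) := (\sum_(k < J) m k * B ^ k)%N.
have e_inj m m' : m \in E -> m' \in E -> e m = e m' -> m = m'.
  move=> mE m'E emm'; apply/eqP/cmP => k; case: (ltnP k J) => kJ.
    by apply: (digits_inj _ _ emm') => // l; apply: mB.
  by rewrite !(EJ _ kJ).
pose p := \sum_(m <- E) a m *: 'X^(e m) : {poly K}.
have p0 : p = 0.
  apply: poly_nat_eq0 => n; rewrite /p horner_sum -[RHS](u0 (fun k => n%:R ^+ (B ^ k))).
  rewrite /poly_fun big_seq [RHS]big_seq; apply: eq_bigr => m mE.
  rewrite hornerZ hornerXn; congr (_ * _); have mJ k := EJ (k := k) mE.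
  rewrite (monomial_value_ord _ mJ) expr_sum; apply: eq_bigr => k _.
  by rewrite mulnC exprM.
move=> m mE; have := congr1 (fun q : {poly K} => q`_(e m)) p0.
rewrite coef0 coef_sum (big_rem m) //= coefZ coefXn eqxx mulr1 big_seq big1 ?addr0 //.
move=> m'; rewrite mem_rem_uniq ?fset_uniq // inE => /andP[m'm m'E].
rewrite coefZ coefXn; case: eqP => [e'|_]; last by rewrite mulr0.
by rewrite (e_inj _ _ mE m'E e') eqxx in m'm.
Qed.

(** For natural [z] this is the leading term of C_2k for the partition with [z j] parts equal to j.
    Arbitrary multiplicities are allowed so that the values fill the whole space. The part 0 counts
    only for k = 0, that is, in N. *)
Definition power_sum n (z : nat -> K) k : K :=
  2 * \sum_(j < n) z j * j%:R ^+ k.*2.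

(** The first J power sums are linear in the multiplicities, with a Vandermonde matrix at the
    distinct nodes j^2. *)
Lemma power_sum_onto (y : nat -> K) : exists z, forall k, (k < J)%N ->
  power_sum J z k = y k.
Proof.
pose r : 'rV[K]_J := \row_j (j%:R ^+ 2).
have Vu : Vandermonde J r \in unitmx.
  rewrite unitmxE unitfE det_Vandermonde; apply/prodf_neq0 => i _.
  apply/prodf_neq0 => j ij; rewrite !mxE subr_eq0 -!natrX eqr_nat eqn_sqr.
  by rewrite gtn_eqF.
pose z := invmx (Vandermonde J r) *m \col_k (y k / 2).
exists (fun j => if insub j is Some j' then z j' 0 else 0) => k kJ.
have := congr1 (fun c : 'cV_J => c (Ordinal kJ) 0) (mulKVmx Vu (\col_k (y k / 2))).
rewrite !mxE -/z => e; rewrite /power_sum -[RHS](divfK (x := 2)) ?pnatr_eq0 //= -e mulrC.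
congr (_ * 2); apply: eq_bigr => j _; rewrite valK !mxE mulrC; congr (_ * _).
by rewrite -exprM mul2n.
Qed.

(** The natural multiplicities are replaced by arbitrary scalars one at a time: in each single
    multiplicity the value is a polynomial that vanishes at all naturals, hence everywhere. *)
Lemma poly_fun_power_sum :
  (forall n : nat -> nat, poly_fun id (power_sum J (fun j => (n j)%:R)) = 0) ->
  forall u, poly_fun id u = 0.
Proof.
move=> n0 u; have [z zu] := power_sum_onto u; rewrite -(eq_poly_fun zu).
have ext r (n : nat -> nat) : poly_fun id (power_sum J
    (fun j => if (j < r)%N then z j else (n j)%:R)) = 0.
  elim: r n => [|r IHr] n; first exact: n0.
  pose zX j : {poly K} := if j == r then 'X else (if (j < r)%N then z j else (n j)%:R)%:P.
  pose p := poly_fun polyC (fun k => 2 * \sum_(j < J) zX j * j%:R ^+ k.*2).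
  have pE x : p.[x] = poly_fun id (power_sum J
      (fun j => if j == r then x else if (j < r)%N then z j else (n j)%:R)).
    rewrite -/(horner_eval x p) rmorph_poly_fun /poly_fun; apply: eq_bigr => m _.
    congr (_ * _); first by rewrite /= /horner_eval hornerC.
    apply: eq_bigr => k _; congr (_ ^+ _); rewrite rmorphM rmorph_nat rmorph_sum.
    congr (_ * _); apply: eq_bigr => j _; rewrite rmorphM rmorphXn rmorph_nat.
    by congr (_ * _); rewrite /zX /= /horner_eval; case: eqP => _; rewrite ?hornerX ?hornerC. 
  have p0 : p = 0.
    apply: poly_nat_eq0 => t; rewrite pE.
    rewrite -[RHS](IHr (fun j => if j == r then t else n j)); congr poly_fun.
    apply/funext => k; congr (_ * _); apply: eq_bigr => j _; congr (_ * _).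
    by have [->|_] := eqVneq (j : nat) r; rewrite ?ltnn.
  have := pE (z r); rewrite p0 horner0 => e; rewrite [RHS]e; congr poly_fun.
  apply/funext => k; congr (_ * _); apply: eq_bigr => j _; congr (_ * _).
  by rewrite ltnS leq_eqVlt; case: eqP => //= ->.
rewrite -[RHS](ext J (fun=> 0%N)); congr poly_fun; apply/funext => k.
by congr (_ * _); apply: eq_bigr => j _; rewrite ltn_ord.
Qed.

End PolynomialFunctions.

Definition hw_casimir (K : numFieldType) N (lam : 'I_N -> nat) k : K :=
  \sum_i entry_eigenvalue (hw_weight K lam) k.*2 i.

Section ScaledWeights.
Variables (K : numFieldType) (rs : seq nat).
Local Notation M := (size rs).

(** The parts occupy the first half of an even number of rows and the default 0 of [nth] the second,
    so each weight of so is plus or minus a part. The scale L serves as the variable in which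
    leading terms are taken. *)
Definition scaled_weight L (i : 'I_(M + M)) : nat := (L * nth 0%N rs i)%N.

Definition skew_weight (i : 'I_(M + M)) : K :=
  (nth 0%N rs i)%:R - (nth 0%N rs (rev_ord i))%:R.

Definition casimir_poly k : {poly K} :=
  \sum_i entry_eigenvalue (fun i => skew_weight i *: 'X) k.*2 i.

Lemma horner_casimir_poly L k :
  (casimir_poly k).[L%:R] = hw_casimir K (scaled_weight L) k.
Proof.
rewrite -/(horner_eval _ _) rmorph_sum; apply: eq_bigr => i _.
rewrite rmorph_entry_eigenvalue; congr entry_eigenvalue; apply/funext => j.
rewrite /= /horner_eval hornerZ hornerX /skew_weight /hw_weight /scaled_weight.
by rewrite !natrM -mulrBr mulrC.
Qed.

(** The two halves carry opposite weights, which the even exponent identifies. *)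
Lemma skew_weight_sum k : \sum_i skew_weight i ^+ k.*2
  = 2 * \sum_(x <- rs) x%:R ^+ k.*2.
Proof.
have rsE : \sum_(x <- rs) x%:R ^+ k.*2 = \sum_(i < M) (nth 0%N rs i)%:R ^+ k.*2 :> K.
  by rewrite (big_nth 0%N) big_mkord.
rewrite big_split_ord mulr_natl mulr2n rsE /=; congr (_ + _).
  apply: eq_bigr => i _; rewrite /skew_weight /= [X in _ - X%:R]nth_default ?subr0 //.
  by have := ltn_ord i; lia.
rewrite [RHS](reindex_inj rev_ord_inj); apply: eq_bigr => i _.
rewrite /skew_weight /= nth_default ?leq_addr // sub0r -mul2n exprM sqrrN -exprM.
by congr ((nth _ _ _)%:R ^+ _); have := ltn_ord i; lia.
Qed.

Lemma top_coef_casimir_poly k :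
  top_coef (casimir_poly k) k.*2 (2 * \sum_(x <- rs) x%:R ^+ k.*2).
Proof.
rewrite -skew_weight_sum; apply: top_coef_sum => i _.
exact: top_coef_entry_eigenvalue.
Qed.

End ScaledWeights.

Lemma power_sum_seq (K : numFieldType) J (n : nat -> nat) : exists rs,
  sorted geq rs /\
  forall k, 2 * \sum_(x <- rs) x%:R ^+ k.*2 = power_sum J (fun j => (n j)%:R) k :> K.
Proof.
pose s := flatten [seq nseq (n j) j | j <- iota 0 J].
exists (sort geq s); split; first by apply: sort_sorted => x y; apply: leq_total.
move=> k; congr (_ * _); rewrite (perm_big s) /=; last by rewrite perm_sort.
rewrite /s; have -> : iota 0 J = index_iota 0 J by rewrite /index_iota subn0.
rewrite big_flatten big_map big_mkord.
by apply: eq_bigr => j _; rewrite big_nseq iter_addr_0 mulr_natl.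
Qed.

Lemma sorted_geq_nth rs i j : sorted geq rs -> (i <= j)%N ->
  (nth 0%N rs j <= nth 0%N rs i)%N.
Proof.
move=> srs ij; case: (ltnP j (size rs)) => jrs; last by rewrite nth_default.
apply: (sorted_leq_nth _ _ 0%N srs) => //.
- by move=> x y z /= xy yz; apply: leq_trans xy.
- by move=> x /=.
- by rewrite inE (leq_ltn_trans ij).
Qed.

Section Separation.
Variables (K : numFieldType) (P : {malg K[{cmonom nat}]}).

(** The degree in the scale L, each C_2k counting 2k; C_0 has weight 0. *)
Definition cmonom_weight (m : {cmonom nat}) :=
  (\sum_(k <- finsupp m) k.*2 * m k)%N.

Hypothesis P_vanishes : forall N (lam : 'I_N -> nat),
  (forall i j : 'I_N, (i <= j)%N -> (lam j <= lam i)%N) ->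
  mmap idfun (monomial_value (hw_casimir K lam)) P = 0.

(** On scaled weights the value of P is a polynomial in L vanishing at all naturals. Its coefficient
    of L^D only sees the monomials of maximal weight D, each through its leading term. *)
Lemma top_weight_vanishes D (E : {fset {cmonom nat}}) rs :
  (forall m, m \in msupp P -> (cmonom_weight m <= D)%N) ->
  E =i [pred m in msupp P | cmonom_weight m == D] -> sorted geq rs ->
  poly_fun E (fun m => P@_m) id (fun k => 2 * \sum_(x <- rs) x%:R ^+ k.*2) = 0.
Proof.
move=> PD ED srs.
pose q := \sum_(m <- msupp P) (P@_m)%:P * monomial_value (casimir_poly K rs) m.
have q0 : q = 0.
  apply: poly_nat_eq0 => L; rewrite -/(horner_eval _ _) rmorph_sum.
  rewrite -[RHS](P_vanishes (lam := @scaled_weight rs L)) => [|i j ij]; last first.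
    by rewrite leq_mul2l sorted_geq_nth ?orbT.
  rewrite mmapE; apply: eq_bigr => m _; rewrite rmorphM rmorph_monomial_value.
  rewrite /= /horner_eval hornerC; congr (_ * monomial_value _ _).
  by apply/funext => k; rewrite horner_casimir_poly.
have top m : top_coef (monomial_value (casimir_poly K rs) m) (cmonom_weight m)
    (monomial_value (fun k => 2 * \sum_(x <- rs) x%:R ^+ k.*2) m).
  by apply: top_coef_prod => k; apply/top_coefX/top_coef_casimir_poly.
have qD : q`_D = 0 by rewrite q0 coef0.
rewrite -[RHS]qD coef_sum.
rewrite [RHS](bigID (fun m => cmonom_weight m == D)) /=.
rewrite [X in _ = _ + X]big1_seq ?addr0 => [|m /andP[mD mP]]; last first.
  rewrite coefCM nth_default ?mulr0 //; case: (top m) => [sm _].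
  by apply: leq_trans sm _; rewrite ltn_neqAle mD PD.
rewrite -[RHS]big_filter /poly_fun (perm_big [seq m <- msupp P | cmonom_weight m == D]).
  rewrite !big_filter; apply: eq_bigr => m /eqP mD; rewrite coefCM -mD.
  by case: (top m) => _ ->.
apply: uniq_perm => [||m]; first exact: fset_uniq.
  by rewrite filter_uniq ?fset_uniq.
by rewrite ED mem_filter inE andbC.
Qed.

(** Otherwise the part of P of maximal weight vanishes on the power sums of all partitions, hence on
    all values of its variables, and its coefficients are zero. *)
Lemma model_separates : P = 0.
Proof.
apply/eqP; rewrite -msupp_eq0; apply: contraT => /fset0Pn[m0 m0P].
have [[m mP] _ /= maxm] :=
  @arg_maxnP _ [` m0P]%fset xpredT (fun m : msupp P => cmonom_weight (val m)) isT.
pose D := cmonom_weight m.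
pose E := [fset m in msupp P | cmonom_weight m == D]%fset.
have PD m' : m' \in msupp P -> (cmonom_weight m' <= D)%N.
  by move=> m'P; have := maxm [` m'P]%fset isT.
have ED : E =i [pred m in msupp P | cmonom_weight m == D].
  by move=> m'; rewrite !inE.
pose J := (\max_(m <- E) \max_(k <- finsupp m) k).+1.
have EJ m' k : m' \in E -> (J <= k)%N -> m' k = 0%N.
  move=> m'E Jk; apply/eqP; rewrite cmE_eq0; apply: contraL Jk => km'.
  rewrite -ltnNge ltnS; apply: leq_trans (leq_bigmax_seq _ m'E isT).
  rewrite -[k in leqLHS]/((fun l : nat => l) k); apply: leq_bigmax_seq => //.
have mE : m \in E by rewrite ED inE mP eqxx.
have /eqP : P@_m = 0.
  apply: (poly_fun_eq0 EJ) mE; apply: (poly_fun_power_sum EJ) => n.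
  have [rs [srs rsE]] := power_sum_seq K J n.
  apply: etrans (top_weight_vanishes PD ED srs); congr poly_fun.
  by apply/funext => k; rewrite rsE.
by rewrite mcoeff_eq0 mP.
Qed.

End Separation.

(* Uniqueness and existence over the coefficient ring *)
From mathcomp Require Import functions.

(** Packs a family of solutions into a single function-valued one, to which [reduction] applies: two
    solutions indexed by [bool] for uniqueness, all highest weights at once for existence. *)
Lemma additive_rule_fun (T : Type) (H : zmodType) (c0 : T -> H -> H)
    (w : T -> forall m, 'S_m -> H) n (s : 'S_n.+2) r :
  (forall x, additive_rule (c0 x) (w x) s r) ->
  additive_rule (fun (g : T -> H) x => c0 x (g x)) (fun m t x => w x m t) s r.
Proof.
move=> rw.
have gE x cs : gbracket (fun (g : T -> H) x => c0 x (g x)) (fun m t x => w x m t) s r cs x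
    = gbracket (c0 x) (w x) s r cs.
  by rewrite /gbracket; elim: count => //= k ->.
have aE x k (g : T -> H) : altsgn k g x = altsgn k (g x).
  by rewrite /altsgn; case: odd.
split=> [P Q rP cP cQ P' Q'|P Q Q0 cPQ P' Q'|P cP b]; apply/funext => x; have [ra rb rc] := rw x.
- have /= := ra P Q rP cP cQ; rewrite -!gE => ->.
  by rewrite [RHS]/(_ + _ - _ + altsgn _ _ x) aE.
- have /= := rb P Q Q0 cPQ; rewrite -!gE => ->.
  by rewrite [RHS]/(_ + _ - _ + altsgn _ _ x) aE.
- have /= := rc P cP; rewrite -!gE => ->; rewrite !mulr2n //.
Qed.

Section CoefRing.
Variable R : realType.
Local Notation A := (coef_ring R).
Local Notation K := (R[i]).

Lemma coef_ring_half (x : A) : x + x = 0 -> x = 0.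
Proof.
move=> xx; have : (2 : K)^-1 *: (x + x) = 0 by rewrite xx scaler0.
rewrite -mulr2n -[x *+ 2]scaler_nat scalerA mulVf ?scale1r ?pnatr_eq0 //.
Qed.

Lemma so_relations_uniq (w1 w2 : forall m, 'S_m -> A) :
  so_relations (@Cvar R) w1 -> so_relations (@Cvar R) w2 ->
  forall m (s : 'S_m), w1 m s = w2 m s.
Proof.
move=> h1 h2 m s; pose ww (b : bool) := if b then w1 else w2.
have hw b : so_relations (@Cvar R) (ww b) by case: b.
have wrule n (t : 'S_n.+2) r := additive_rule_fun (fun b =>
  iffLR (recurrence_ruleP _ _ _ _) (so_recurrence (hw b) t r)).
pose B (g : bool -> A) := g true = g false.
have BB (x y : bool -> A) : B x -> B y -> B (x - y).
  by rewrite /B => bx bY; rewrite -[LHS]/(x true - y true) bx bY.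
apply: (reduction (w := fun m s b => ww b m s) (B := B)) => {m s} //.
- move=> x bx; apply/eqP; rewrite -subr_eq0; apply/eqP/coef_ring_half.
  by rewrite -mulr2n mulrnBl !mulr2n; apply/eqP; rewrite subr_eq0; apply/eqP.
- by rewrite /B /= (so_empty h1) (so_empty h2).
- by move=> m n s t; rewrite /B /= !(so_concat h1) !(so_concat h2) => -> ->.
- by move=> m m2 em; rewrite /B /= (so_std h1) // (so_std h2).
- move=> m s x; apply/funext => b; rewrite (so_invert (hw b)) -altsgnE /altsgn.
  by case: odd.
- move=> n s r lower.
  have Bc x : B x -> B (fun b => Cvar R 0 * x b) by rewrite /B => ->.
  exact: (additive_rule_step BB Bc (wrule n s r) lower).
Qed.

Record weight_param := WeightParam {
  wp_size : nat;
  wp_fun : 'I_wp_size -> nat;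
  wp_mono : forall i j : 'I_wp_size, (i <= j)%N -> (wp_fun j <= wp_fun i)%N
}.

Definition coef_eval (P : A) (t : weight_param) : K :=
  mmap idfun (monomial_value (hw_casimir K (@wp_fun t))) P.

Lemma coef_evalB P Q : coef_eval (P - Q) = coef_eval P - coef_eval Q.
Proof. by apply/funext => t; rewrite /coef_eval raddfB. Qed.

Lemma coef_evalM P Q t : coef_eval (P * Q) t = coef_eval P t * coef_eval Q t.
Proof. by rewrite /coef_eval rmorphM. Qed.

Lemma coef_eval_var k t : coef_eval (Cvar R k) t = hw_casimir K (@wp_fun t) k.
Proof. by rewrite /coef_eval /Cvar mmapU monomial_value_var mul1r. Qed.

Lemma coef_eval_inj : injective coef_eval.
Proof.
move=> P Q PQ; apply/eqP; rewrite -subr_eq0; apply/eqP.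
apply: model_separates => N lam lam_mono.
have := congr1 (fun f => f (WeightParam lam_mono)) (coef_evalB P Q).
by rewrite PQ subrr.
Qed.

(** By [reduction] the family of scalars [chi t] always lies in the image of [coef_eval]. Its
    preimage is unique, and injectivity pulls the relations back. *)
Lemma so_relations_ex : exists w : forall m, 'S_m -> A, so_relations (@Cvar R) w.
Proof.
pose chi (t : weight_param) := sval (cid (hw_model K (@wp_mono t))).
have chiP t : so_relations (hw_casimir K (@wp_fun t)) (chi t).
  exact: svalP (cid (hw_model K (@wp_mono t))).
have chi_rule n (s : 'S_n.+2) r := additive_rule_fun (fun t =>
  iffLR (recurrence_ruleP _ _ _ _) (so_recurrence (chiP t) s r)).
pose B (g : weight_param -> K) := exists P, coef_eval P = g.
have BB x y : B x -> B y -> B (x - y).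
  by move=> [P <-] [Q <-]; exists (P - Q); rewrite coef_evalB.
have chiB m (s : 'S_m) : B (fun t => chi t m s).
  apply: (reduction (w := fun m s t => chi t m s) (B := B)) => {m s} //.
  - move=> x [P Px]; exists ((2 : K)^-1 *: P); apply/funext => t.
    rewrite /coef_eval mmapZ /= -/(coef_eval P t) Px -[X in _ * X]/(x t + x t).
    by rewrite -[x t + _]mulr2n -[x t *+ 2]mulr_natl mulKf // pnatr_eq0.
  - exists 1; apply/funext => t; rewrite (so_empty (chiP t)) /coef_eval.
    exact: rmorph1.
  - move=> m n s t [P Ps] [Q Qt]; exists (P * Q); apply/funext => x.
    by rewrite coef_evalM Ps Qt (so_concat (chiP x)).
  - move=> m m2 em; exists (Cvar R m./2); apply/funext => t.
    by rewrite coef_eval_var (so_std (chiP t)).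
  - move=> m s x; apply/funext => t; rewrite (so_invert (chiP t)) -altsgnE /altsgn.
    by case: odd.
  - move=> n s r lower.
    have Bc x : B x -> B (fun t => hw_casimir K (@wp_fun t) 0 * x t).
      move=> [P <-]; exists (Cvar R 0 * P); apply/funext => t.
      by rewrite coef_evalM coef_eval_var.
    exact: (additive_rule_step BB Bc (chi_rule n s r) lower).
pose w m (s : 'S_m) : A := sval (cid (chiB m s)).
have wE m (s : 'S_m) : coef_eval (w m s) = fun t => chi t m s := svalP (cid (chiB m s)).
exists w; split.
- apply: coef_eval_inj; rewrite wE; apply/funext => t.
  by rewrite (so_empty (chiP t)) /coef_eval rmorph1.
- move=> m n s t; apply: coef_eval_inj; rewrite wE; apply/funext => x.
  by rewrite coef_evalM !wE (so_concat (chiP x)).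
- move=> m s x; apply: coef_eval_inj; rewrite wE; apply/funext => t.
  rewrite (so_invert (chiP t)) coef_evalM wE; congr (_ * _).
  by rewrite /coef_eval rmorphXn rmorphN1.
- move=> m m2 em; apply: coef_eval_inj; rewrite wE; apply/funext => t.
  by rewrite coef_eval_var (so_std (chiP t)).
- move=> n s r; apply/recurrence_ruleP.
  apply: (additive_rule_inj (f := coef_eval)
    (c1 := fun (g : weight_param -> K) t => hw_casimir K (@wp_fun t) 0 * g t)).
  + exact: coef_evalB.
  + by move=> P; apply/funext => t; rewrite coef_evalM coef_eval_var.
  + exact: coef_eval_inj.
  + have := chi_rule n s r; congr (additive_rule _ _ s r).
    by apply: boolp.functional_extensionality_dep => k; apply/funext => t; rewrite wE.
Qed.

End CoefRing.

(** * Moving a letter of a word *)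

Section WordValue.
Variables (T : eqType) (x0 : T) (A : comNzRingType) (c : nat -> A).
Variable w : forall m, 'S_m -> A.
Hypothesis w_so : so_relations c w.
Implicit Types (e : seq T) (f : T -> T).
Local Notation rep := (rep x0).

Definition word_perm e f : 'S_(size e) :=
  insub_perm (fun i : 'I_(size e) => insubd i (index (f (nth x0 e i)) e)).

Definition word_value e f := w (word_perm e f).

Definition permutes f e :=
  [/\ uniq e, {in e, forall x, f x \in e} & {in e &, injective f}].

Lemma rep_word_perm e f : permutes f e -> rep (word_perm e f) e f.
Proof.
case=> ue fe finj; split=> // i.
have lti (j : 'I_(size e)) : (index (f (nth x0 e j)) e < size e)%N.
  by rewrite index_mem fe // mem_nth.
rewrite /word_perm insub_permE => [|j k /(congr1 (fun i : 'I_(size e) => nth x0 e i))].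
  by rewrite val_insubd lti nth_index // fe // mem_nth.
rewrite !val_insubd !lti !nth_index ?fe ?mem_nth // => /finj.
rewrite !mem_nth // => /(_ isT isT) /eqP; rewrite nth_uniq // => /eqP.
exact: val_inj.
Qed.

Lemma rep_value e f m (s : 'S_m) : permutes f e -> rep s e f -> w s = word_value e f.
Proof.
move=> pf se; have [ue _ _] := pf.
exact: (rep_eq w ue (fun _ _ => erefl) se (rep_word_perm pf)).
Qed.

Lemma eq_word_value e f g : permutes f e -> {in e, f =1 g} ->
  word_value e f = word_value e g.
Proof.
move=> pf fg; have [ue fe finj] := pf.
have pg : permutes g e.
  split=> // [x xe|x y xe ye]; first by rewrite -fg ?fe.
  by rewrite -!fg //; apply: finj.
exact: (rep_eq w ue fg (rep_word_perm pf) (rep_word_perm pg)).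
Qed.

Lemma map_word_value e f g h : permutes f e -> {in e &, injective h} ->
  {in e, forall x, g (h x) = h (f x)} -> word_value (map h e) g = word_value e f.
Proof.
move=> pf hinj gh; have [ue fe finj] := pf.
have pg : permutes g (map h e).
  split; first by rewrite map_inj_in_uniq.
    by move=> _ /mapP[x xe ->]; rewrite gh // map_f // fe.
  move=> _ _ /mapP[x xe ->] /mapP[y ye ->]; rewrite !gh // => /hinj.
  by rewrite !fe // => /(_ isT isT) /finj -> //.
apply/esym/rep_value => //; have [_ sP] := rep_word_perm pf.
split=> [|i]; first by rewrite size_map.
by rewrite !(nth_map x0) // sP gh // mem_nth.
Qed.

(** [skip] on labelled letters, with [y] in the role of V. For chords {x, x'} and {y, y'} it yields
    the 3-cycle y, x', y'. *)
Definition detach x y f z :=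
  let u := if z == y then f x else f z in if u == x then f y else u.

Lemma nth_detached e1 x y e2 n (r : 'I_n.+1) (i : 'I_n.+1) : r = size e1 :> nat ->
  nth x0 (e1 ++ y :: e2) i = nth x0 (e1 ++ x :: y :: e2) (lift (letr r) i).
Proof.
move=> re1; rewrite !nth_cat /= /bump -re1; case: (leqP r i) => ri.
  by rewrite add1n ltnNge (leqW ri) /= subSn.
by rewrite add0n ri.
Qed.

Lemma invert_3cycle m (t t' : 'S_m) u v z : uniq [:: u; v; z] ->
  fcycle t [:: u; v; z] -> fcycle t' [:: u; z; v] ->
  (forall a, a \notin [:: u; v; z] -> t' a = t a) -> w t' = - w t.
Proof.
move=> uuvz ct ct' tt'; have pt := fcycle_porbit ct.
have -> : t' = invert_cycle t u.
  apply/permP => a; rewrite permE -pt; case: ifPn => [|/tt' //].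
  move: ct ct'; rewrite /= !andbT => /and3P[/eqP tu /eqP tv /eqP tz].
  move=> /and3P[/eqP t'u /eqP t'z /eqP t'v].
  rewrite !inE => /or3P[] /eqP ->; apply: (@perm_inj _ t); rewrite permKV.
  - by rewrite t'u tz.
  - by rewrite t'v tu.
  - by rewrite t'z tv.
rewrite (so_invert w_so) -(eq_card pt) (card_uniqP uuvz) /=.
by rewrite -signr_odd /= expr1 mulN1r.
Qed.

Section Swap.
Variables (e1 e2 : seq T) (x y : T) (f : T -> T) (n : nat) (s : 'S_n.+2) (r : 'I_n.+1).
Hypotheses (re1 : r = size e1 :> nat) (ue : uniq (e1 ++ x :: y :: e2)).
Hypothesis se : rep s (e1 ++ x :: y :: e2) f.
Local Notation lr := (letr r).
Local Notation lr1 := (letr1 r).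

Lemma nth_lr : nth x0 (e1 ++ x :: y :: e2) lr = x.
Proof. by rewrite /= re1 nth_cat ltnn subnn. Qed.

Lemma nth_lr1 : nth x0 (e1 ++ x :: y :: e2) lr1 = y.
Proof. by rewrite /= /bump add1n re1 nth_cat ltnNge leqnSn subSnn. Qed.

Lemma rep_skip : rep (insub_perm (skip r lr lr1 s)) (e1 ++ y :: e2) (detach x y f).
Proof.
have [es sP] := se; have xy : adjacent_pair r lr lr1 by left.
split=> [|i]; first by move: es; rewrite !size_cat /= !addnS => -[->].
rewrite !(nth_detached x y e2 _ re1).
rewrite insub_permE ?lift_skip //; last exact: skip_inj.
have E (a b : 'I_n.+2) : (a == b) = (nth x0 (e1 ++ x :: y :: e2) (nat_of_ord a)
    == nth x0 (e1 ++ x :: y :: e2) (nat_of_ord b)) :> bool.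
  by rewrite nth_uniq ?es.
rewrite /= !permM tpermL /detach.
have tE : s (tperm lr lr1 (lift lr i)) = if lift lr i == lr1 then s lr else s (lift lr i).
  case: tpermP => [/esym/eqP|->|_ /eqP/negPf ->] //; last by rewrite eqxx.
  by rewrite (negPf (neq_lift _ _)).
rewrite tE.
have -> : (lift lr i == lr1) = (nth x0 (e1 ++ x :: y :: e2) (lift lr i) == y).
  by rewrite E nth_lr1.
set u := if _ then s lr else _.
have uE : nth x0 (e1 ++ x :: y :: e2) u =
   if nth x0 (e1 ++ x :: y :: e2) (lift lr i) == y then f x
   else f (nth x0 (e1 ++ x :: y :: e2) (lift lr i)).
  by rewrite /u; case: ifP; rewrite sP ?nth_lr.
rewrite -uE E nth_lr; case: ifP => // _.
by rewrite sP nth_lr1.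
Qed.

(** For one-letter words reversal does nothing and the sign is -1, so (a) gives 2 (w[V Q P] -
    w[V P Q]). These 3-cycles are inverse to each other, hence have opposite values: in total -4
    w[V P Q]. *)
Lemma chord_swap b q : uniq [:: lr; b; lr1; q] -> s lr = b -> s b = lr ->
  s lr1 = q -> s q = lr1 ->
  w s = w (conj_adj s r) - w (insub_perm (skip r lr lr1 s)) *+ 4.
Proof.
move=> u4 slr sb slr1 sq.
have cP : fcycle s (lr :: [:: b]) by rewrite /= slr sb !eqxx.
have cQ : fcycle s (lr1 :: [:: q]) by rewrite /= slr1 sq !eqxx.
have u4' : uniq ((lr1 :: [:: q]) ++ lr :: [:: b]).
  by rewrite (perm_uniq (s2 := [:: lr; b; lr1; q])) // (perm_catC [:: lr1; q]).
have rC : lr \notin porbit s lr1.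
  rewrite -(fcycle_porbit cQ); move: u4; rewrite /= !inE => /and4P[].
  by rewrite !negb_or => /and3P[_ -> ->].
have [cD cD'] := (skip_join (or_introl erefl : adjacent_pair r lr lr1) cP cQ u4,
  skip_join (or_intror erefl : adjacent_pair r lr1 lr) cQ cP u4').
have uP : uniq (lr :: [:: b]) by move: u4; rewrite /= !inE negb_or => /and3P[/andP[->]].
have uQ : uniq (lr1 :: [:: q]) by move: u4 => /= /and4P[_ _ ->].
have [/(_ [:: b] [:: q] rC) + _ _] := so_recurrence w_so s r.
rewrite /ucycle cP uP cQ uQ => /(_ isT isT) /=.
rewrite /bracket /= !mul1r expr1 mulN1r => ->.
rewrite -[[:: letV r; collapse r b; collapse r q]]/(letV r :: [:: collapse r b] ++ [:: collapse r q]).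
rewrite -[[:: letV r; collapse r q; collapse r b]]/(letV r :: [:: collapse r q] ++ [:: collapse r b]).
rewrite (subst_perm_join (or_introl erefl : adjacent_pair r lr lr1) cP cQ u4) //.
rewrite (subst_perm_join (or_intror erefl : adjacent_pair r lr1 lr) cQ cP u4') //.
set t := insub_perm (skip r lr lr1 s); set t' := insub_perm _.
have tE : t =1 skip r lr lr1 s by apply/insub_permE/skip_inj; left.
have t'E : t' =1 skip r lr1 lr s by apply/insub_permE/skip_inj; right.
have -> : w t' = - w t.
  apply: (@invert_3cycle _ t t' (letV r) (collapse r b) (collapse r q)).
  - have [b1 q1] : b != lr1 /\ q != lr1.
      move: u4; rewrite /= !inE !negb_or => /and4P[_ /andP[-> _] + _].
      by rewrite eq_sym.
    rewrite -(collapse_letr r) -[_ :: _]/(map (collapse r) [:: lr; b; q]).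
    rewrite map_inj_in_uniq; first by move: u4; rewrite /= !inE !negb_or => /and4P[/and3P[-> _ ->] /andP[_ ->]].
    have ne1 a : a \in [:: lr; b; q] -> a != lr1.
      by rewrite !inE => /or3P[]/eqP -> //; apply: letr_neq.
    move=> a a' /ne1 a1 /ne1 a'1 /(congr1 (lift lr1)).
    by rewrite !collapseK.
  - by rewrite (eq_fcycle tE).
  - by rewrite (eq_fcycle t'E).
  - move=> a aV; rewrite tE t'E.
    have off : a \notin map (collapse r) ([:: lr; b] ++ [:: lr1; q]).
      by move: aV; rewrite /= collapse_letr collapse_letr1 !inE; case: (a == letV r); case: (a == collapse r b).
    have lin : lr \in [:: lr; b] ++ [:: lr1; q] by rewrite !inE eqxx.
    have lin1 : lr1 \in [:: lr; b] ++ [:: lr1; q] by rewrite !inE eqxx !orbT.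
    rewrite (skip_off (or_introl erefl : adjacent_pair r lr lr1) cP cQ lin lin1 off).
    by rewrite (skip_off (or_intror erefl : adjacent_pair r lr1 lr) cP cQ lin1 lin off).
ring.
Qed.

End Swap.
End WordValue.

(** * Words of chord ends: rotation and sliding *)

Section ChordWords.
Variables (T : eqType) (x0 : T) (A : comNzRingType) (c : nat -> A).
Variable w : forall m, 'S_m -> A.
Hypothesis w_so : so_relations c w.
Hypothesis A2 : forall x : A, x + x = 0 -> x = 0.
Implicit Types (e : seq T) (f : T -> T).
Local Notation rep := (rep x0).
Local Notation W := (word_value x0 w).

Lemma rep_permutes e f m (s : 'S_m) : uniq e -> rep s e f -> permutes f e.
Proof.
move=> ue [em sP]; subst m; split=> // [x|x y] /(nthP x0)[i ie <-].
  by rewrite -(sP (Ordinal ie)) mem_nth.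
move=> /(nthP x0)[j je <-]; rewrite -(sP (Ordinal ie)) -(sP (Ordinal je)).
by move/eqP; rewrite nth_uniq // => /eqP /val_inj /perm_inj [->].
Qed.

Lemma permutes_perm e e' f : perm_eq e e' -> permutes f e -> permutes f e'.
Proof.
move=> ee' [ue fe finj]; split; first by rewrite -(perm_uniq ee').
  by move=> x; rewrite -!(perm_mem ee'); apply: fe.
by move=> x y; rewrite -!(perm_mem ee'); apply: finj.
Qed.

Lemma rep_exists e f m : size e = m -> permutes f e -> exists s : 'S_m, rep s e f.
Proof. by move=> <- pf; exists (word_perm x0 e f); apply: rep_word_perm. Qed.

Lemma word_3cycle e f g u v z : permutes f e -> permutes g e ->
  uniq [:: u; v; z] -> {subset [:: u; v; z] <= e} ->
  f u = v -> f v = z -> f z = u -> g u = z -> g z = v -> g v = u ->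
  (forall a, a \in e -> a \notin [:: u; v; z] -> g a = f a) -> W e g = - W e f.
Proof.
move=> pf pg uuvz sub fu fv fz gu gz gv fg; have [ue _ _] := pf.
have lti a : a \in [:: u; v; z] -> (index a e < size e)%N by rewrite index_mem; apply: sub.
have uin : u \in [:: u; v; z] by rewrite !inE eqxx.
have vin : v \in [:: u; v; z] by rewrite !inE eqxx orbT.
have zin : z \in [:: u; v; z] by rewrite !inE eqxx !orbT.
have [_ tP] := rep_word_perm x0 pf; have [_ t'P] := rep_word_perm x0 pg.
pose iu := Ordinal (lti u uin); pose iv := Ordinal (lti v vin); pose iz := Ordinal (lti z zin).
have nI (i j : 'I_(size e)) : nth x0 e i = nth x0 e j -> i = j.
  by move/eqP; rewrite nth_uniq // => /eqP /val_inj.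
have [nu nv nz] : [/\ nth x0 e iu = u, nth x0 e iv = v & nth x0 e iz = z].
  by rewrite /= !nth_index ?sub.
have u3 : uniq [:: iu; iv; iz].
  move: uuvz; rewrite -{1}nu -{1}nv -{1}nz -[[:: nth _ _ _; _; _]]/(map (nth x0 e \o val) [:: iu; iv; iz]).
  exact: map_uniq.
apply: (invert_3cycle w_so (u := iu) (v := iv) (z := iz)) => //.
- by rewrite /= andbT; apply/and3P; split; apply/eqP/nI; rewrite tP ?nu ?nv ?nz.
- by rewrite /= andbT; apply/and3P; split; apply/eqP/nI; rewrite t'P ?nu ?nv ?nz.
- move=> a ai; apply: nI; rewrite tP t'P fg ?mem_nth //; apply: contra ai.
  by rewrite -{1}nu -{1}nv -{1}nz !inE !nth_uniq.
Qed.

Definition involutes f e := uniq e /\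
  {in e, forall x, [/\ f x \in e, f (f x) = x & f x != x]}.

Lemma involutes_permutes f e : involutes f e -> permutes f e.
Proof.
move=> [ue fe]; split=> // [x /fe[]//|x y xe ye fxy].
by have [_ <- _] := fe x xe; rewrite fxy; have [] := fe y ye.
Qed.

Lemma involutes_perm f e e' : perm_eq e e' -> involutes f e -> involutes f e'.
Proof.
move=> ee' [ue fe]; split; first by rewrite -(perm_uniq ee').
by move=> x; rewrite -!(perm_mem ee'); apply: fe.
Qed.

Lemma perm_swap e1 e2 (x y : T) : perm_eq (e1 ++ x :: y :: e2) (e1 ++ y :: x :: e2).
Proof. by rewrite perm_cat2l; apply/permPl/(perm_catCA [:: x] [:: y] e2). Qed.

Lemma word_swap e1 e2 x y f : involutes f (e1 ++ x :: y :: e2) -> f x != y ->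
  permutes (detach x y f) (e1 ++ y :: e2) /\
  W (e1 ++ x :: y :: e2) f = W (e1 ++ y :: x :: e2) f
    - W (e1 ++ y :: e2) (detach x y f) *+ 4.
Proof.
move=> inv fxy; have [ue fe] := inv; have pf := involutes_permutes inv.
have [|s se] := @rep_exists _ f (size e1 + size e2).+2 _ pf.
  by rewrite size_cat /= !addnS.
have re1 : (size e1 < (size e1 + size e2).+1)%N by rewrite ltnS leq_addr.
pose r := Ordinal re1; have re1' : r = size e1 :> nat by [].
have [es sP] := se.
have ue' : uniq (e1 ++ y :: e2).
  by move: ue; rewrite !cat_uniq /= => /and3P[-> /norP[_ ->] /andP[_ ->]].
have skipE := rep_skip re1' ue se.
have pd := rep_permutes ue' skipE; split=> //.
rewrite -(rep_value w pf se) -(rep_value w pd skipE).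
rewrite -(rep_value w _ (rep_swap re1' se)); last exact: permutes_perm (perm_swap _ _ _ _) pf.
have nI (i j : 'I_(size e1 + size e2).+2) : nth x0 (e1 ++ x :: y :: e2) i
    = nth x0 (e1 ++ x :: y :: e2) j -> i = j.
  by move/eqP; rewrite nth_uniq ?es // => /eqP /val_inj.
have ss i : s (s i) = i.
  by apply: nI; rewrite !sP; have [|_ -> _] // := fe (nth x0 (e1 ++ x :: y :: e2) i); rewrite mem_nth ?es.
have si i : s i != i.
  apply/eqP => /(congr1 (fun i : 'I__ => nth x0 (e1 ++ x :: y :: e2) i)); rewrite sP.
  by have [|_ _ /eqP] // := fe (nth x0 (e1 ++ x :: y :: e2) i); rewrite mem_nth ?es.
have slr : s (letr r) != letr1 r.
  apply: contra fxy => /eqP e; have := sP (letr r).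
  by rewrite e (nth_lr1 x0 e2 x y re1') (nth_lr x0 e2 x y re1') => <-.
apply: (@chord_swap _ _ _ w_so _ s r (s (letr r)) (s (letr1 r))) => //.
have lrr1 := letr_neq r.
rewrite /= !inE !negb_or lrr1 [letr r == _]eq_sym si /= andbT.
rewrite slr [letr1 r == _]eq_sym si andbT (inj_eq perm_inj) lrr1 !andbT.
by rewrite eq_sym -(inj_eq (@perm_inj _ s)) ss eq_sym.
Qed.

(** The involution commutes with the transposition of its own chord, so the conjugation changes
    nothing. *)
Lemma word_swap_partner e1 e2 x y f : involutes f (e1 ++ x :: y :: e2) -> f x = y ->
  W (e1 ++ x :: y :: e2) f = W (e1 ++ y :: x :: e2) f.
Proof.
move=> inv fxy; have [ue fe] := inv; have pf := involutes_permutes inv.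
have [|s se] := @rep_exists _ f (size e1 + size e2).+2 _ pf.
  by rewrite size_cat /= !addnS.
have re1 : (size e1 < (size e1 + size e2).+1)%N by rewrite ltnS leq_addr.
pose r := Ordinal re1; have re1' : r = size e1 :> nat by [].
have [es sP] := se.
rewrite -(rep_value w pf se).
rewrite -(rep_value w _ (rep_swap re1' se)); last exact: permutes_perm (perm_swap _ _ _ _) pf.
have nI (i j : 'I_(size e1 + size e2).+2) : nth x0 (e1 ++ x :: y :: e2) i
    = nth x0 (e1 ++ x :: y :: e2) j -> i = j.
  by move/eqP; rewrite nth_uniq ?es // => /eqP /val_inj.
have slr : s (letr r) = letr1 r.
  by apply: nI; rewrite sP (nth_lr1 x0 e2 x y re1') (nth_lr x0 e2 x y re1').
have slr1 : s (letr1 r) = letr r.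
  apply: nI; rewrite sP (nth_lr1 x0 e2 x y re1') (nth_lr x0 e2 x y re1') -fxy.
  by have [|] := fe x; rewrite // mem_cat !inE eqxx orbT.
have sC : (s * tperm (letr r) (letr1 r) = tperm (letr r) (letr1 r) * s)%g.
  by rewrite [RHS]conjgC tpermJ slr slr1 tpermC.
by congr w; rewrite /conj_adj conjgE sC mulKg.
Qed.

Lemma detach_permutes x y f e : involutes f (x :: e) -> y \in e -> f x != y ->
  permutes (detach x y f) e.
Proof.
move=> inv ye fxy; have ee' := perm_to_rem ye.
have inv' : involutes f ([::] ++ x :: y :: rem y e).
  by apply: involutes_perm inv; rewrite /= perm_cons.
have [+ _] := word_swap inv' fxy; apply: permutes_perm.
by rewrite perm_sym.
Qed.

(** At the two ends of one chord the 3-cycle is run through in opposite directions. *)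
Lemma detach_partner x y f e : involutes f (x :: e) -> y \in e -> f x != y ->
  W e (detach x (f y) f) = - W e (detach x y f).
Proof.
move=> inv ye fxy; have [/= /andP[xe ue] fe] := inv.
have nxy : x != y by apply: contraNneq xe => ->.
have [fx_in ffx fxx] := fe x (mem_head _ _).
have yin : y \in x :: e by rewrite inE ye orbT.
have [fy_in ffy fyy] := fe y yin.
have fyx : f y != x by apply: contra fxy => /eqP <-; rewrite ffy.
have fxfy : f x != f y by apply: contra nxy => /eqP e1; rewrite -ffx e1 ffy.
have fye : f y \in e by move: fy_in; rewrite inE (negPf fyx).
have fxe : f x \in e by move: fx_in; rewrite inE (negPf fxx).
apply: (@word_3cycle _ _ _ y (f x) (f y)).
- exact: detach_permutes.
- by apply: detach_permutes.
- by rewrite /= !inE !negb_or (eq_sym y) fxy (eq_sym y) fyy fxfy.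
- by move=> z; rewrite !inE => /or3P[]/eqP ->.
- by rewrite /detach eqxx (negPf fxx).
- by rewrite /detach (negPf fxy) ffx eqxx.
- by rewrite /detach (negPf fyy) ffy eq_sym (negPf nxy).
- by rewrite /detach (eq_sym y) (negPf fyy) (negPf fyx).
- by rewrite /detach eqxx (negPf fxx).
- by rewrite /detach (negPf fxfy) ffx eqxx ffy.
- move=> z ze; rewrite !inE !negb_or => /and3P[zy zfx zfy].
  rewrite /detach (negPf zy) (negPf zfy); case: ifP => // /eqP fzx.
  have [|_ ffz _] := fe z; first by rewrite inE ze orbT.
  by rewrite -fzx ffz eqxx in zfx.
Qed.

Lemma detach_sum x f e : involutes f (x :: e) ->
  \sum_(y <- e | y != f x) W e (detach x y f) = 0.
Proof.
move=> inv; have [/= /andP[xe ue] fe] := inv.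
(* The sum is added to its reindexing by [f], so that each end meets its partner without choosing
   one end of every chord. *)
apply: A2; rewrite -big_filter; set l := [seq y <- e | y != f x].
have fl y : y \in l -> (f y \in l) /\ f (f y) = y.
  rewrite !mem_filter => /andP[yfx ye].
  have yin : y \in x :: e by rewrite inE ye orbT.
  have [fy_in ffy fyy] := fe y yin; have [_ ffx _] := fe x (mem_head _ _).
  split=> //; apply/andP; split.
    apply: contraNneq xe => fyfx; rewrite -ffx -fyfx ffy //.
  by move: fy_in; rewrite inE => /predU1P[fyx|//]; rewrite -fyx ffy eqxx in yfx.
have fll : perm_eq (map f l) l.
  have finj : {in l &, injective f}.
    by move=> y z /fl[_ {2}<-] /fl[_ {2}<-] ->.
  have ul : uniq l by rewrite filter_uniq.
  apply: uniq_perm => // [|y]; first by rewrite map_inj_in_uniq.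
  apply/mapP/idP => [[z /fl[zl _] ->//]|yl].
  by have [fyl ffy] := fl y yl; exists (f y).
rewrite -{1}(perm_big _ fll) /= big_map -big_split big_seq big1 //= => y.
rewrite mem_filter => /andP[yfx ye].
by rewrite detach_partner // ?addNr // eq_sym.
Qed.

Lemma word_move x f e1 e2 : involutes f (x :: e1 ++ e2) ->
  W (x :: e1 ++ e2) f = W (e1 ++ x :: e2) f
    - (\sum_(y <- e1 | y != f x) W (e1 ++ e2) (detach x y f)) *+ 4.
Proof.
elim/last_ind: e1 e2 => [|e1 y IHe] e2 inv; first by rewrite big_nil mul0rn subr0.
rewrite !cat_rcons in inv *; rewrite (IHe (y :: e2)) // big_rcons /=.
have inv' : involutes f (e1 ++ x :: y :: e2).
  apply: involutes_perm inv; rewrite perm_sym.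
  exact/permPl/(perm_catCA e1 [:: x] (y :: e2)).
have [yfx|yfx] := eqVneq y (f x).
  by rewrite (word_swap_partner inv') //= addr0.
have fxy : f x != y by rewrite eq_sym.
by have [_ ->] := word_swap inv' fxy; rewrite /= mulrnDl [in RHS]opprD [RHS]addrA [RHS]addrAC.
Qed.

(** Moving the cut past one end carries this letter across all the others; the contributions sum up
    to zero by [detach_sum]. *)
Lemma word_rot1 x f e : involutes f (x :: e) -> W (x :: e) f = W (rcons e x) f.
Proof.
move=> inv; have := @word_move x f e [::]; rewrite !cats0 => -> //.
by rewrite detach_sum // mul0rn subr0 cats1.
Qed.

Lemma word_rot f e1 e2 : involutes f (e1 ++ e2) -> W (e1 ++ e2) f = W (e2 ++ e1) f.
Proof.
elim: e1 e2 => [|x e1 IHe] e2 inv; first by rewrite cats0.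
rewrite [LHS]word_rot1 // -[x :: e1]/([:: x] ++ e1) catA cats1 -IHe.
  by rewrite rcons_cat.
by apply: involutes_perm inv; rewrite -rcons_cat perm_sym perm_rcons.
Qed.

Definition cycle3 a b d f (t : T) :=
  if t == a then b else if t == b then d else if t == d then a else f t.

Definition join_chord z p f (t : T) :=
  if t == z then p else if t == p then z else f t.

Lemma cycle3_permutes y z f e : involutes f e -> y \in e -> z \notin e ->
  permutes (cycle3 y (f y) z f) (z :: e).
Proof.
move=> [ue fe] ye ze; have [fye ffy fyy] := fe y ye.
have zy : z != y by apply: contraNneq ze => ->.
have zfy : z != f y by apply: contraNneq ze => ->.
split; first by rewrite /= ze.
  move=> t; rewrite inE /cycle3 => /predU1P[->|te].
    by rewrite (negPf zy) (negPf zfy) eqxx inE ye orbT.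
  case: eqP => _; first by rewrite inE fye orbT.
  case: eqP => _; first by rewrite mem_head.
  by case: eqP => _; rewrite inE ?ye ?orbT //; have [-> _ _] := fe t te; rewrite orbT.
have cE t : t \in z :: e -> t != y -> t != f y -> t != z ->
   [/\ cycle3 y (f y) z f t = f t, f t \in e, f t != y & f t != f y].
  rewrite inE => /predU1P[->|te ty tfy tz]; first by rewrite eqxx.
  have [fte fft ftt] := fe t te.
  rewrite /cycle3 (negPf ty) (negPf tfy) (negPf tz); split=> //.
    by apply: contra tfy => /eqP <-; rewrite fft.
  by apply: contra ty => /eqP e1; rewrite -fft e1 ffy.
have cy : cycle3 y (f y) z f y = f y by rewrite /cycle3 eqxx.
have cfy : cycle3 y (f y) z f (f y) = z by rewrite /cycle3 (negPf fyy) eqxx.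
have cz : cycle3 y (f y) z f z = y by rewrite /cycle3 (negPf zy) (negPf zfy) eqxx.
have spec t : t \in z :: e -> [\/ t = y, t = f y, t = z |
   [/\ cycle3 y (f y) z f t = f t, f t \in e, f t != y & f t != f y] /\ t \in e].
  move=> te; have [->|ty] := eqVneq t y; first by constructor 1.
  have [->|tfy] := eqVneq t (f y); first by constructor 2.
  have [->|tz] := eqVneq t z; first by constructor 3.
  constructor 4; split; first exact: cE.
  by move: te; rewrite inE (negPf tz).
have fz t : f t \in e -> f t != z by apply: contraTneq => ->.
move=> t u /spec[->|->|->|[[-> fte fty ftfy] te]] /spec[->|->|->|[[-> fue fuy fufy] ue']];
  rewrite ?cy ?cfy ?cz // => E1.
- by rewrite E1 eqxx in zfy.
- by rewrite E1 eqxx in fyy.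
- by rewrite E1 eqxx in fufy.
- by rewrite E1 eqxx in zfy.
- by rewrite E1 eqxx in zy.
- by rewrite E1 fue in ze.
- by rewrite -E1 eqxx in fyy.
- by rewrite E1 eqxx in zy.
- by rewrite -E1 eqxx in fuy.
- by rewrite E1 eqxx in ftfy.
- by rewrite -E1 fte in ze.
- by rewrite E1 eqxx in fty.
- by have [_ <- _] := fe t te; have [_ <- _] := fe u ue'; rewrite E1.
Qed.

(* Both sides of the 4-term relation have this form, one for y and the other
   for f y. *)
Lemma word_slide e1 e2 y z p f e : involutes f e -> y \in e -> z \notin e -> p \notin e ->
  p != z -> perm_eq (e1 ++ y :: e2) (z :: e) ->
  W (e1 ++ y :: p :: e2) (join_chord z p f) = W (e1 ++ p :: y :: e2) (join_chord z p f)
    - W (e1 ++ y :: e2) (cycle3 y (f y) z f) *+ 4.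
Proof.
move=> inv ye ze pe pz ee; have [ue fe] := inv; have [fye ffy fyy] := fe y ye.
set g := join_chord z p f.
have zy : z != y by apply: contraNneq ze => ->.
have zfy : z != f y by apply: contraNneq ze => ->.
have py : p != y by apply: contraNneq pe => ->.
have pfy : p != f y by apply: contraNneq pe => ->.
have gE t : t \in e -> g t = f t.
  move=> te; rewrite /g /join_chord; case: eqP => [tz|_]; first by rewrite -tz te in ze.
  by case: eqP => // tp; rewrite -tp te in pe.
have gz : g z = p by rewrite /g /join_chord eqxx.
have gp : g p = z by rewrite /g /join_chord (negPf pz) eqxx.
have inv' : involutes g (p :: z :: e).
  split; first by rewrite /= inE negb_or pz pe ze.
  move=> t; rewrite !inE => /or3P[/eqP ->|/eqP ->|te].
  - by rewrite gp gz eqxx orbT (eq_sym z).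
  - by rewrite gz gp eqxx.
  - by have [fte fft ftt] := fe t te; rewrite !gE // fte !orbT.
have pee : perm_eq (p :: z :: e) (e1 ++ y :: p :: e2).
  rewrite perm_sym -[y :: p :: e2]cat1s catA -[p :: e2]cat1s perm_catCA /= -catA.
  by rewrite perm_cons.
have inv2 := involutes_perm pee inv'.
have gyp : g y != p by rewrite gE // eq_sym.
have [pd ->] := word_swap inv2 gyp; congr (_ - _ *+ 4).
have pc := cycle3_permutes inv ye ze.
have pc' := permutes_perm (etrans (perm_sym _ _) ee : perm_eq (z :: e) (e1 ++ y :: e2)) pc.
(* [word_swap] removes [y] and keeps [p] in its place; renaming [y] to [p] identifies the result
   with the 3-cycle y, f y, z. *)
pose h t := if t == y then p else t.
have hE : map h (e1 ++ y :: e2) = e1 ++ p :: e2.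
  have [uy _ _] := pc'; move: uy; rewrite cat_uniq /= => /and3P[_ /norP[ye1 _] /andP[ye2 _]].
  have hid l : y \notin l -> map h l = l.
    move=> yl; rewrite -[RHS]map_id; apply/eq_in_map => t tl.
    by rewrite /h; case: eqP => // ty; rewrite -ty tl in yl.
  by rewrite map_cat /= !hid // /h eqxx.
rewrite -hE; apply: map_word_value => //.
  move=> t u; rewrite !(perm_mem ee) /h => tze uze.
  have pze : p \notin z :: e by rewrite inE negb_or pz.
  case: eqP => [->|_]; case: eqP => [->|_] // E1.
    by rewrite E1 uze in pze.
  by rewrite -E1 tze in pze.
move=> t; rewrite (perm_mem ee) inE => /predU1P[->|te].
  rewrite /h (negPf zy) /cycle3 (negPf zy) (negPf zfy) eqxx eqxx /detach (eq_sym z) (negPf pz).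
  by rewrite gz (negPf py) .
have tz : t != z by apply: contraNneq ze => <-.
rewrite /h /cycle3 (negPf tz).
have [ty|ty] := eqVneq t y.
  by rewrite /= (negPf fyy) /detach eqxx gE // (negPf fyy).
have tp : t != p by apply: contraNneq pe => <-.
have [tfy|tfy] := eqVneq t (f y).
  by rewrite /= tfy (negPf zy) /detach (eq_sym _ p) (negPf pfy) gE // ffy eqxx gp.
have [fte fft ftt] := fe t te.
have fty : f t != y by apply: contra tfy => /eqP <-; rewrite fft.
by rewrite (negPf fty) /detach (negPf tp) gE // (negPf fty).
Qed.

Lemma cycle3_rev y z f e e' : involutes f e -> y \in e -> z \notin e ->
  perm_eq e' (z :: e) ->
  W e' (cycle3 (f y) y z f) = - W e' (cycle3 y (f y) z f).
Proof.
move=> inv ye ze ee'; have [ue fe] := inv; have [fye ffy fyy] := fe y ye.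
have zy : z != y by apply: contraNneq ze => ->.
have zfy : z != f y by apply: contraNneq ze => ->.
have ze' : perm_eq (z :: e) e' by rewrite perm_sym.
apply: (@word_3cycle _ _ _ y (f y) z).
- exact: permutes_perm ze' (cycle3_permutes inv ye ze).
- have := permutes_perm ze' (cycle3_permutes inv fye ze).
  by rewrite ffy.
- by rewrite /= !inE negb_or (eq_sym y) fyy (eq_sym y) zy (eq_sym (f y)) zfy.
- by move=> t; rewrite (perm_mem ee') !inE => /or3P[]/eqP ->; rewrite ?eqxx ?ye ?fye ?orbT.
- by rewrite /cycle3 eqxx.
- by rewrite /cycle3 (negPf fyy) eqxx.
- by rewrite /cycle3 (negPf zy) (negPf zfy) eqxx.
- by rewrite /cycle3 (eq_sym y) (negPf fyy) eqxx.
- by rewrite /cycle3 (negPf zfy) (negPf zy) eqxx.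
- by rewrite /cycle3 eqxx.
- move=> t _; rewrite !inE !negb_or /cycle3 => /and3P[/negPf -> /negPf -> /negPf ->] //.
Qed.

End ChordWords.

(** * Chord diagrams on the circle *)

Section Circle.
Variable R : realType.
Implicit Types (p q x y z : circle R) (D : chord_diagram R).

Lemma circle_bounds x : 0 <= val x < 1. Proof. by case: x. Qed.

Lemma arc_len_bounds p x : 0 <= arc_len p x < 1.
Proof.
have /andP[p0 p1] := circle_bounds p; have /andP[x0 x1] := circle_bounds x.
by rewrite /arc_len; case: (leP (val p) (val x)) => px; apply/andP; split; lra.
Qed.

Lemma arc_lenxx p : arc_len p p = 0.
Proof. by rewrite /arc_len lexx subrr. Qed.

Lemma arc_len_inj p : injective (arc_len p).
Proof.
move=> x y e; apply: val_inj; move: e.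
have /andP[p0 p1] := circle_bounds p; have /andP[x0 x1] := circle_bounds x.
have /andP[y0 y1] := circle_bounds y.
rewrite /arc_len; case: (leP (val p) (val x)) => px;
  case: (leP (val p) (val y)) => py e; lra.
Qed.

Lemma arc_len_change p q x : arc_len q x =
  if arc_len p q <= arc_len p x then arc_len p x - arc_len p q
  else arc_len p x - arc_len p q + 1.
Proof.
have /andP[p0 p1] := circle_bounds p; have /andP[x0 x1] := circle_bounds x.
have /andP[q0 q1] := circle_bounds q.
rewrite /arc_len; case: (leP (val p) (val x)) => px;
  case: (leP (val p) (val q)) => pq; case: (leP (val q) (val x)) => qx;
  case: ifP => [h|/negbT h]; rewrite -?ltNge in h; lra.
Qed.

Definition arc_le p : rel (circle R) := fun x y => arc_len p x <= arc_len p y.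

Lemma arc_le_trans p : transitive (arc_le p).
Proof. by move=> y x z; apply: le_trans. Qed.

Lemma arc_le_total p : total (arc_le p).
Proof. by move=> x y; apply: le_total. Qed.

Lemma arc_le_anti p : antisymmetric (arc_le p).
Proof. by move=> x y /le_anti/arc_len_inj. Qed.

Lemma sorted_arc_le p e : sorted (arc_le p) e = pairwise (arc_le p) e.
Proof. exact/sorted_pairwise/arc_le_trans. Qed.

Lemma ends_fromP D p e : perm_eq e (ends D) -> sorted (arc_le p) e ->
  e = ends_from D p.
Proof.
move=> eD se; apply: (sorted_eq (@arc_le_trans p) (@arc_le_anti p)) => //.
  exact: (sort_sorted (@arc_le_total p)).
by rewrite (perm_trans eD) // perm_sym perm_sort.
Qed.

Lemma perm_ends_from D p : perm_eq (ends_from D p) (ends D).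
Proof. by rewrite perm_sort. Qed.

Lemma sorted_ends_from D p : sorted (arc_le p) (ends_from D p).
Proof. exact: (sort_sorted (@arc_le_total p)). Qed.

Lemma mem_ends_from D p x : (x \in ends_from D p) = (x \in ends D).
Proof. exact: perm_mem (perm_ends_from D p) x. Qed.

(** The ends on the arc from p to q come first as seen from p and last as seen from q, with
    unchanged order inside each part. *)
Lemma ends_from_rot D p q : exists e1 e2,
  ends_from D p = e1 ++ e2 /\ ends_from D q = e2 ++ e1.
Proof.
pose a x := arc_len p x < arc_len p q.
pose e1 := filter a (ends_from D p); pose e2 := filter (predC a) (ends_from D p).
have pe : perm_eq (e1 ++ e2) (ends D).
  by rewrite (perm_trans _ (perm_ends_from D p)) // perm_filterC.
have sp := sorted_ends_from D p; rewrite sorted_arc_le in sp.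
have [se1 se2] : pairwise (arc_le p) e1 /\ pairwise (arc_le p) e2.
  by split; apply: subseq_pairwise sp; apply: filter_subseq.
have m1 x : x \in e1 -> arc_len p x < arc_len p q.
  by rewrite mem_filter => /andP[].
have m2 x : x \in e2 -> arc_len p q <= arc_len p x.
  by rewrite mem_filter => /andP[/=]; rewrite /a -leNgt.
exists e1, e2; split.
  apply/esym/ends_fromP => //; rewrite sorted_arc_le pairwise_cat se1 se2 !andbT.
  by apply/allrelP => x y /m1 xq /m2 qy; apply/ltW/(lt_le_trans xq).
apply/esym/ends_fromP; first by rewrite perm_catC.
rewrite sorted_arc_le pairwise_cat; apply/and3P; split.
- apply/allrelP => x y /m2 qx /m1 yq; rewrite /arc_le !(arc_len_change p q) qx.
  rewrite (lt_geF yq) /=; have /andP[_ ] := arc_len_bounds p x.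
  by have /andP[] := arc_len_bounds p y; lra.
- apply: (sub_in_pairwise (P := mem e2)) se2; last exact/allP.
  move=> x y /m2 qx /m2 qy; rewrite /arc_le !(arc_len_change p q) qx qy.
  lra.
- apply: (sub_in_pairwise (P := mem e1)) se1; last exact/allP.
  move=> x y /m1 qx /m1 qy; rewrite /arc_le !(arc_len_change p q).
  rewrite (lt_geF qx) (lt_geF qy) /=; lra.
Qed.

Lemma chord_card D a : a \in val D -> #|` a| = 2%N.
Proof.
move=> aD; have /andP[/forallP c2 _] := valP D.
exact/eqP/(c2 [` aD]%fset).
Qed.

Lemma chord_disjoint D a b x : a \in val D -> b \in val D -> x \in a -> x \in b -> a = b.
Proof.
move=> aD bD xa xb; have /andP[_ /forallP dis] := valP D.
have := forallP (dis [` aD]%fset) [` bD]%fset; apply: contraTeq => ab.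
rewrite negb_imply -val_eqE /= ab /=.
by apply/fset0Pn; exists x; rewrite inE xa.
Qed.

Lemma endsP D x : reflect (exists2 a, a \in val D & x \in a) (x \in ends D).
Proof.
rewrite /ends; apply: (iffP (bigfcupP _ _ _ _)) => [[a /andP[aD _] xa]|[a aD xa]]; first by exists a.
by exists a; rewrite ?aD.
Qed.

Definition partner D x : circle R :=
  if [pick y : ends D | [fset x; val y]%fset \in val D] is Some y then val y else x.

Lemma chord_ends D x y : [fset x; y]%fset \in val D -> x \in ends D /\ y \in ends D.
Proof.
by move=> xyD; split; apply/endsP; exists [fset x; y]%fset; rewrite ?fset21 ?fset22.
Qed.

Lemma chord_neq D x y : [fset x; y]%fset \in val D -> x != y.
Proof. by move=> /chord_card; rewrite cardfs2; case: (x == y). Qed.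

Lemma partner_chord D x y : [fset x; y]%fset \in val D -> partner D x = y.
Proof.
move=> xyD; have [_ yD] := chord_ends xyD; rewrite /partner.
case: pickP => [y' y'D|/(_ [` yD]%fset)]; last by rewrite xyD.
have := chord_disjoint xyD y'D (fset21 _ _) (fset21 _ _).
move=> /fsetP /(_ y); rewrite fset22 => /esym /fset2P[yx|<-//].
by have := chord_neq xyD; rewrite yx eqxx.
Qed.

Lemma chord_partner D x : x \in ends D -> [fset x; partner D x]%fset \in val D.
Proof.
move=> /endsP[a aD xa]; have /eqP := chord_card aD.
rewrite (cardfsD1 x) xa eqSS => /cardfs1P[y ay].
have axy : a = [fset x; y]%fset by rewrite -(fsetD1K xa) ay.
by rewrite axy in aD *; rewrite (partner_chord aD).
Qed.

Lemma partner_involutes D e : perm_eq e (ends D) -> involutes (partner D) e.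
Proof.
move=> eD; split=> [|x]; first by rewrite (perm_uniq eD) fset_uniq.
rewrite !(perm_mem eD) => /chord_partner xD; have [_ yD] := chord_ends xD.
split=> //; last by rewrite eq_sym (chord_neq xD).
by apply: partner_chord; rewrite fsetUC.
Qed.

Lemma card_bigfcup2 (s : seq {fset circle R}) : uniq s ->
  (forall a, a \in s -> #|` a| = 2%N) ->
  (forall a b x, a \in s -> b \in s -> x \in a -> x \in b -> a = b) ->
  #|` \bigcup_(a <- s) a|%fset = (size s).*2.
Proof.
elim: s => [|a s IHs] /=; first by rewrite big_nil cardfs0.
move=> /andP[as_ us] c2 dis; rewrite big_cons cardfsU.
rewrite IHs // => [|b bs|b d x bs ds]; last first.
- by apply: dis; rewrite inE ?bs ?ds orbT.
- by apply: c2; rewrite inE bs orbT.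
rewrite (c2 a) ?mem_head // doubleS (_ : _ `&` _ = fset0)%fset ?cardfs0 ?subn0 //.
apply/eqP; rewrite -[_ == _]negbK; apply/negP => /fset0Pn[x].
rewrite inE => /andP[xa /bigfcupP[b /andP[bs _] xb]].
have ab := dis a b x (mem_head _ _) _ xa xb.
by rewrite ab ?inE ?bs ?orbT in as_ *.
Qed.

Lemma card_ends D : #|` ends D| = (nchords D).*2.
Proof.
apply: card_bigfcup2; first exact: fset_uniq.
  by move=> a; apply: chord_card.
by move=> a b x; apply: chord_disjoint.
Qed.

End Circle.

Section ChordDiagrams.
Variable R : realType.
Implicit Types (p q x y z : circle R) (D : chord_diagram R).

Lemma rep_default (T : eqType) (x0 x1 : T) m (s : 'S_m) e f :
  rep x0 s e f -> rep x1 s e f.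
Proof.
move=> [em sP]; split=> // i.
by rewrite !(set_nth_default x0 x1) ?em.
Qed.

Lemma rep_cut_perm D p : rep p (cut_perm D p) (ends_from D p) (partner D).
Proof.
have se : size (ends_from D p) = (nchords D).*2.
  by rewrite size_sort -card_ends.
have ue : uniq (ends_from D p) by rewrite (perm_uniq (perm_ends_from D p)) fset_uniq.
split=> // i.
pose e (i : 'I_((nchords D).*2)) := nth p (ends_from D p) i.
pose g (i : 'I_((nchords D).*2)) := odflt i [pick j | [fset e i; e j]%fset \in val D].
have eD j : e j \in ends D by rewrite -(mem_ends_from D p) mem_nth ?se.
have eg j : e (g j) = partner D (e j).
  rewrite /g; case: pickP => [k kD|none] /=; first by rewrite (partner_chord kD).
  have pD := chord_partner (eD j); have [_ pjD] := chord_ends pD.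
  have lt : (index (partner D (e j)) (ends_from D p) < (nchords D).*2)%N.
    by rewrite -se index_mem mem_ends_from.
  have := none (Ordinal lt); rewrite /e /= nth_index ?mem_ends_from //.
  by rewrite -/(e j) pD.
have einj : injective e.
  by move=> j k /eqP; rewrite nth_uniq ?se // => /eqP /val_inj.
have ginj : injective g.
  move=> j k gjk; apply: einj.
  have [_ inv] := partner_involutes (perm_ends_from D p).
  have ein i' : e i' \in ends_from D p by rewrite mem_ends_from.
  have [_ <- _] := inv _ (ein j); have [_ <- _] := inv _ (ein k).
  by rewrite -!eg gjk.
by rewrite /cut_perm insub_permE // -/(e (g i)) eg.
Qed.

Section WeightSystem.
Variables (A : comNzRingType) (c : nat -> A) (w : forall m, 'S_m -> A).
Hypothesis w_so : so_relations c w.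
Hypothesis A2 : forall x : A, x + x = 0 -> x = 0.
Variable x0 : circle R.
Local Notation W := (word_value x0 w).

Lemma cut_perm_value D p : w (cut_perm D p) = W (ends_from D p) (partner D).
Proof.
apply: rep_value (rep_default _ (rep_cut_perm D p)).
exact/involutes_permutes/partner_involutes/perm_ends_from.
Qed.

Lemma word_value_cut D p q :
  W (ends_from D p) (partner D) = W (ends_from D q) (partner D).
Proof.
have [e1 [e2 [ep eq]]] := ends_from_rot D p q.
have := partner_involutes (perm_ends_from D p); rewrite ep eq.
exact: (word_rot x0 w_so A2).
Qed.

Section NewChord.
Variables (D : chord_diagram R) (x z : circle R).
Hypotheses (xD : x \in ends D) (zD : z \notin ends D).
Local Notation u := (arc_len z).

Lemma add_chord_word p D' e1 e2 : p \notin ends D -> p != z -> add_chord D z p D' ->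
  sorted (arc_le z) (e1 ++ e2) -> perm_eq (e1 ++ e2) (z :: p :: ends D) ->
  W (ends_from D' z) (partner D') = W (e1 ++ e2) (join_chord z p (partner D)).
Proof.
move=> pD pz D'E se pe.
have inD' a : (a \in val D') = (a == [fset z; p]%fset) || (a \in val D).
  by rewrite D'E !inE.
have eD' t : (t \in ends D') = [|| t == z, t == p | t \in ends D].
  apply/endsP/or3P => [[a]|].
    rewrite inD' => /predU1P[->|aD ta]; last by constructor 3; apply/endsP; exists a.
    by rewrite !inE => /orP[]; [constructor 1|constructor 2].
  case=> [/eqP ->|/eqP ->|/endsP[a aD ta]].
  - by exists [fset z; p]%fset; rewrite ?inD' ?eqxx // fset21.
  - by exists [fset z; p]%fset; rewrite ?inD' ?eqxx // fset22.
  - by exists a; rewrite ?inD' ?aD ?orbT.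
have ppe : perm_eq (e1 ++ e2) (ends D').
  apply: (perm_trans pe); apply: uniq_perm => [||t].
  - by rewrite /= inE negb_or eq_sym pz zD pD fset_uniq.
  - exact: fset_uniq.
  - by rewrite eD' !inE.
rewrite -(ends_fromP ppe se).
apply: eq_word_value.
  exact/involutes_permutes/partner_involutes.
move=> t; rewrite (perm_mem ppe) eD' /join_chord => /or3P[/eqP ->|/eqP ->|tD].
- by rewrite eqxx; apply: partner_chord; rewrite inD' eqxx.
- by rewrite (negPf pz) eqxx; apply: partner_chord; rewrite inD' fsetUC eqxx.
- rewrite ifN; last by apply: contraTneq tD => ->.
  rewrite ifN; last by apply: contraTneq tD => ->.
  by apply: partner_chord; rewrite inD' chord_partner ?orbT.
Qed.

Lemma arc_len_gt0 t : t != z -> 0 < u t.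
Proof.
move=> tz; have /andP[+ _] := arc_len_bounds z t; rewrite le_eqVlt => /predU1P[ut|//].
by rewrite -(arc_lenxx z) in ut; rewrite (arc_len_inj ut) eqxx in tz.
Qed.

(** Measured from the cut point z, the cyclic condition becomes a comparison of positions; z counts
    as a marked point, which keeps [p] from passing the cut. *)
Lemma just_after_pos p : just_after D z x p ->
  [/\ p \notin ends D, p != z, u x < u p
    & forall t, t \in ends D -> u x < u t -> u p < u t].
Proof.
case=> xp_gt0 after; have xz : x != z by apply: contraNneq zD => <-.
have px : p != x by apply: contraTneq xp_gt0 => ->; rewrite arc_lenxx ltxx.
have pz : p != z.
  apply/eqP => pz; have := after z; rewrite !inE eqxx eq_sym xz => /(_ isT isT).
  by rewrite pz ltxx.
have pD : p \notin ends D.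
  by apply/negP => pD; have := after p; rewrite !inE pD orbT px ltxx => /(_ isT isT).
have uz := arc_lenxx z; have ux := arc_len_gt0 xz.
have /andP[_ ux1] := arc_len_bounds z x; have /andP[up0 up1] := arc_len_bounds z p.
have xlt : u x < u p.
  have := after z; rewrite !inE eqxx eq_sym xz => /(_ isT isT).
  rewrite !(arc_len_change z x) uz [u x <= 0]leNgt ux /=.
  case: (leP (u x) (u p)) => [xp _|xp]; last by lra.
  by rewrite lt_neqAle xp andbT; apply: contra px => /eqP/arc_len_inj ->.
split=> // t tD xt; have tx : t != x by apply: contraTneq xt => ->; rewrite ltxx.
have := after t; rewrite !inE tD orbT tx => /(_ isT isT).
by rewrite !(arc_len_change z x) !ltW //; lra.
Qed.

Lemma just_before_pos p : just_before D z x p ->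
  [/\ p \notin ends D, p != z, u p < u x
    & forall t, t \in ends D -> u t < u x -> u t < u p].
Proof.
case=> px_gt0 before; have xz : x != z by apply: contraNneq zD => <-.
have px : p != x by apply: contraTneq px_gt0 => ->; rewrite arc_lenxx ltxx.
have pz : p != z.
  apply/eqP => pz; have := before z; rewrite !inE eqxx eq_sym xz => /(_ isT isT).
  by rewrite pz ltxx.
have pD : p \notin ends D.
  by apply/negP => pD; have := before p; rewrite !inE pD orbT px ltxx => /(_ isT isT).
have uz := arc_lenxx z; have ux := arc_len_gt0 xz.
have /andP[_ ux1] := arc_len_bounds z x; have /andP[up0 up1] := arc_len_bounds z p.
have xlt : u p < u x.
  have := before z; rewrite !inE eqxx eq_sym xz => /(_ isT isT).
  rewrite (arc_len_change z p x).
  case: (leP (u p) (u x)) => [pxl _|pxl]; last by lra.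
  by rewrite lt_neqAle pxl andbT; apply: contra px => /eqP/arc_len_inj ->.
split=> // t tD tx'; have tx : t != x by apply: contraTneq tx' => ->; rewrite ltxx.
have := before t; rewrite !inE tD orbT tx => /(_ isT isT).
by rewrite (arc_len_change z p x) (arc_len_change z t x) !ltW //; lra.
Qed.

End NewChord.
End WeightSystem.
End ChordDiagrams.

(** * The 4-term relations *)

Section FourTerm.
Variables (R : realType) (A : comNzRingType) (c : nat -> A) (w : forall m, 'S_m -> A).
Hypothesis w_so : so_relations c w.
Hypothesis A2 : forall x : A, x + x = 0 -> x = 0.
Variable x0 : circle R.
Local Notation W := (word_value x0 w).
Implicit Types (p q x y z : circle R) (D : chord_diagram R).

Lemma pairwise_insert (T : Type) (r : rel T) a (p : T) b :
  pairwise r (a ++ b) -> all (r^~ p) a -> all (r p) b -> pairwise r (a ++ p :: b).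
Proof.
rewrite !pairwise_cat /= => /and3P[rab ra rb] rap rpb.
by rewrite allrel_consr rap rab ra rpb rb.
Qed.

(** Only the place of the new end in the word matters, not the point of the circle; this makes the
    ends added after and before [x] comparable. *)
Lemma word_relabel e1 e2 z p p' f e : involutes f e -> z \notin e ->
  p \notin z :: e -> p' \notin z :: e -> perm_eq (e1 ++ e2) (z :: e) ->
  W (e1 ++ p' :: e2) (join_chord z p' f) = W (e1 ++ p :: e2) (join_chord z p f).
Proof.
move=> [ue fe] ze pe p'e ee.
have pz : p != z by apply: contraNneq pe => ->; rewrite mem_head.
have p'z : p' != z by apply: contraNneq p'e => ->; rewrite mem_head.
pose h t := if t == p then p' else t.
have hid l : p \notin l -> map h l = l.
  move=> pl; rewrite -[RHS]map_id; apply/eq_in_map => t tl.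
  by rewrite /h; case: eqP => // tp; rewrite -tp tl in pl.
have pe12 : p \notin e1 ++ e2 by rewrite (perm_mem ee).
have hE : map h (e1 ++ p :: e2) = e1 ++ p' :: e2.
  move: pe12; rewrite mem_cat negb_or => /andP[pe1 pe2].
  by rewrite map_cat /= !hid // /h eqxx.
have mE t : (t \in e1 ++ p :: e2) = (t == p) || (t \in z :: e).
  by rewrite -(perm_mem ee) !mem_cat inE; case: (t == p); rewrite ?orbT.
have joinE t : t \in e -> join_chord z p f t = f t /\ join_chord z p' f t = f t.
  move=> te; rewrite /join_chord.
  have /negPf -> : t != z by apply: contraNneq ze => <-.
  have /negPf -> : t != p by apply: contraNneq pe => <-; rewrite inE te orbT.
  by have /negPf -> : t != p' by apply: contraNneq p'e => <-; rewrite inE te orbT.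
have jp q : q != z -> join_chord z q f q = z.
  by move=> qz; rewrite /join_chord (negPf qz) eqxx.
have jz q : join_chord z q f z = q by rewrite /join_chord eqxx.
have inv : involutes (join_chord z p f) (e1 ++ p :: e2).
  split.
    rewrite -cat1s uniq_catCA /= pe12 (perm_uniq ee) /= ze ue //.
  move=> t; rewrite !mE inE => /or3P[/eqP ->|/eqP ->|te].
  - by rewrite jp // jz mem_head orbT (eq_sym z).
  - by rewrite jz jp // eqxx.
  - have [fte fft ftt] := fe t te; have [-> _] := joinE t te.
    by have [-> _] := joinE _ fte; rewrite inE fte !orbT.
rewrite -hE; apply: map_word_value.
- exact: involutes_permutes.
- move=> t u; rewrite !mE /h => tze uze.
  case: eqP tze => [->|_]; case: eqP uze => [->|_] //= uze tze E1.
    by rewrite E1 uze in p'e.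
  by rewrite -E1 tze in p'e.
- move=> t; rewrite mE inE /h => /or3P[/eqP ->|/eqP ->|te].
  + by rewrite eqxx !jp // eq_sym (negPf pz).
  + by rewrite eq_sym (negPf pz) !jz eqxx.
  + have [fte _ _] := fe t te; have [-> j'] := joinE t te.
    have /negPf -> : t != p by apply: contraNneq pe => <-; rewrite inE te orbT.
    by have /negPf -> : f t != p by apply: contraNneq pe => <-; rewrite inE fte orbT.
Qed.

Section Slide.
Variables (D : chord_diagram R) (x z xp xm : circle R) (Dp Dm : chord_diagram R).
Hypotheses (xD : x \in ends D) (zD : z \notin ends D).
Hypotheses (xpP : just_after D z x xp) (DpE : add_chord D z xp Dp).
Hypotheses (xmP : just_before D z x xm) (DmE : add_chord D z xm Dm).
Local Notation u := (arc_len z).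

(** Cut at z, both words start with z and differ, up to the name of the new end, by one swap of this
    end with [x]. *)
Lemma slide_difference :
  W (ends_from Dp z) (partner Dp) - W (ends_from Dm z) (partner Dm)
  = - (W (z :: ends_from D z) (cycle3 x (partner D x) z (partner D)) *+ 4).
Proof.
have pe := perm_ends_from D z; have se := sorted_ends_from D z.
have xe : x \in ends_from D z by rewrite mem_ends_from.
have inv := partner_involutes pe; have [ue _] := inv.
have zN : z \notin ends_from D z by rewrite mem_ends_from.
have [xpD xpz xxp xpt] := just_after_pos xD zD xpP.
have [xmD xmz xmx xmt] := just_before_pos xD zD xmP.
have [e1 [e2 eE]] : exists e1 e2, ends_from D z = e1 ++ x :: e2.
  by case/splitPr: xe => e1 e2; exists e1, e2.
have pw : pairwise (arc_le z) ((z :: e1) ++ x :: e2).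
  rewrite cat_cons -eE /= -sorted_arc_le se andbT; apply/allP => t _.
  by rewrite /arc_le arc_lenxx; have /andP[] := arc_len_bounds z t.
have [] : [/\ all (arc_le z ^~ x) (z :: e1) & all (arc_le z x) e2].
  move: pw; rewrite pairwise_cat allrel_consr => /and3P[/andP[-> _] _].
  by rewrite /= => /andP[].
move=> /allP lex /allP gex.
have ue' : uniq (e1 ++ x :: e2) by rewrite -eE.
have inD t : (t \in e1) || (t \in e2) -> t \in ends D /\ t != x.
  move=> te; split; first by rewrite -(mem_ends_from D z) eE mem_cat inE orbCA te orbT.
  apply: contraTneq te => ->; move: ue'; rewrite cat_uniq /=.
  by move=> /and3P[_ /norP[xe1 _] /andP[xe2 _]]; rewrite negb_or xe1.
have strict t s' : t != s' -> arc_le z t s' -> u t < u s'.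
  by move=> ts; rewrite /arc_le le_eqVlt => /predU1P[/arc_len_inj /eqP|//]; rewrite (negPf ts).
have wp : W (ends_from Dp z) (partner Dp)
    = W ((z :: e1) ++ x :: xp :: e2) (join_chord z xp (partner D)).
  rewrite -cat_rcons; apply: add_chord_word => //.
    rewrite sorted_arc_le; apply: pairwise_insert; first by rewrite cat_rcons.
      apply/allP => t; rewrite mem_rcons inE => /predU1P[->|/lex tx]; first exact: ltW.
      exact/ltW/(le_lt_trans tx).
    apply/allP => t te; have [|tD tx] := inD t; first by rewrite te orbT.
    by apply/ltW/xpt => //; apply: strict; rewrite 1?eq_sym // gex.
  rewrite cat_rcons cat_cons perm_cons -[x :: _]/([:: x] ++ xp :: e2) catA.
  rewrite -[xp :: e2]cat1s perm_catCA /= perm_cons -catA /= -eE.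
  exact: pe.
have wm : W (ends_from Dm z) (partner Dm)
    = W ((z :: e1) ++ xm :: x :: e2) (join_chord z xm (partner D)).
  apply: add_chord_word => //.
    rewrite sorted_arc_le; apply: pairwise_insert => //.
      apply/allP => t; rewrite inE => /predU1P[->|te].
        by rewrite /arc_le arc_lenxx; have /andP[] := arc_len_bounds z xm.
      have [|tD tx] := inD t; first by rewrite te.
      by apply/ltW/xmt => //; apply: strict => //; apply: lex; rewrite inE te orbT.
    apply/allP => t; rewrite inE => /predU1P[->|/gex tx]; first exact: ltW.
    exact/ltW/(lt_le_trans xmx).
  rewrite cat_cons perm_cons -[xm :: _]cat1s perm_catCA /= perm_cons -eE.
  exact: pe.
have zeE : perm_eq ((z :: e1) ++ x :: e2) (z :: ends_from D z) by rewrite eE.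
have xpN : xp \notin ends_from D z by rewrite mem_ends_from.
have xmN : xm \notin ends_from D z by rewrite mem_ends_from.
rewrite wp wm (word_slide x0 w_so inv xe zN xpN xpz zeE) (word_relabel inv zN _ _ zeE (p := xp) (p' := xm)).
- by rewrite addrAC subrr add0r cat_cons -eE.
- by rewrite inE negb_or xpz.
- by rewrite inE negb_or xmz.
Qed.

End Slide.

(** One base point serves as cut for all diagrams; where it is itself an end, it is listed first. *)
Definition diagram_value D := W (ends_from D x0) (partner D).

Lemma diagram_value_cut D p : diagram_value D = w (cut_perm D p).
Proof. by rewrite (cut_perm_value w x0) (word_value_cut w_so A2 x0 D p x0). Qed.

Lemma diagram_value_four_term : four_term diagram_value.
Proof.
move=> D x y z xyD zD xp xm yp ym Dxp Dxm Dyp Dym xpP DxpE xmP DxmE ypP DypE ymP DymE.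
have [xD yD] := chord_ends xyD; have yxD := xyD; rewrite fsetUC in yxD.
have py := partner_chord yxD; have px := partner_chord xyD.
have vE D' : diagram_value D' = W (ends_from D' z) (partner D').
  exact: (word_value_cut w_so A2 x0).
rewrite !vE (slide_difference yD zD ypP DypE ymP DymE).
rewrite -[RHS]opprB (slide_difference xD zD xpP DxpE xmP DxmE) opprK.
have inv := partner_involutes (perm_ends_from D z).
(* The two sides involve the 3-cycles through x, y, z in opposite directions. *)
have := cycle3_rev x0 w_so inv (_ : y \in _) (_ : z \notin _) (perm_refl _).
rewrite !mem_ends_from => /(_ yD zD); rewrite py px => ->.
by rewrite mulNrn.
Qed.

End FourTerm.

(** * Invariance under diffeomorphisms of the circle *)

Section Diffeomorphism.
Variables (R : realType) (h : circle R -> circle R).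
Hypothesis h_diffeo : circle_diffeo h.
Implicit Types (p q x y z : circle R) (D : chord_diagram R).

Lemma arc_len_uniq x y (k : int) (t : R) : 0 <= t < 1 ->
  t = val y - val x + k%:~R -> t = arc_len x y.
Proof.
move=> /andP[t0 t1] tE; have /andP[x1 x2] := circle_bounds x.
have /andP[y1 y2] := circle_bounds y.
have kgt : (-1)%:~R < k%:~R :> R by rewrite mulrN1z; lra.
have klt : k%:~R < 2%:~R :> R by lra.
rewrite ltr_int in kgt; rewrite ltr_int in klt.
have [k0|k1] : k = 0 \/ k = 1 by lia.
  by rewrite /arc_len; rewrite k0 mulr0z in tE; case: leP => xy; lra.
by rewrite /arc_len; rewrite k1 mulr1z in tE; case: leP => xy; lra.
Qed.

(** The arc is lifted to an interval of the line starting at [val p], possibly reaching beyond 1.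
    The increment of F on it lies in [0, 1) and agrees modulo 1 with the difference of the image
    points, so it is their arc length. *)
Lemma diffeo_lift : exists2 F : R -> R, {homo F : x y / x < y} &
  forall p x, arc_len (h p) (h x) = F (val p + arc_len p x) - F (val p).
Proof.
have [F [G [_ _ Fmono F1 Fh]]] := h_diffeo; exists F => // p x.
have [kp Fp] := Fh p; have [kx Fx] := Fh x.
have /andP[a0 a1] := arc_len_bounds p x.
have [k Fk] : exists k : int, F (val p + arc_len p x) = val (h x) + k%:~R.
  rewrite /arc_len; case: ifP => _; first by exists kx; rewrite addrC subrK.
  by exists (kx + 1); rewrite addrA [val p + _]addrC subrK F1 Fx rmorphD addrA.
apply/esym/(arc_len_uniq (k := k - kp)).
  have Flt : F (val p + arc_len p x) < F (val p) + 1 by rewrite -F1; apply: Fmono; lra.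
  have Fle : F (val p) <= F (val p + arc_len p x).
    by move: a0; rewrite le_eqVlt => /predU1P[<-|a0]; [rewrite addr0|apply/ltW/Fmono; lra].
  by apply/andP; split; lra.
by rewrite Fk Fp rmorphB /=; lra.
Qed.

Lemma diffeo_arc_le p x y : arc_le (h p) (h x) (h y) = arc_le p x y.
Proof.
have [F Fmono FE] := diffeo_lift; rewrite /arc_le !FE lerD2r.
have Fle : {mono F : a b / a <= b} := le_mono Fmono.
by rewrite Fle lerD2l.
Qed.

Lemma diffeo_inj : injective h.
Proof.
move=> x y hxy; apply: (@arc_le_anti _ x).
by rewrite -(diffeo_arc_le x x y) -(diffeo_arc_le x y x) hxy /arc_le lexx.
Qed.

Section Image.
Variables D D' : chord_diagram R.
Hypothesis D'E : val D' = [fset [fset h x | x in (a : {fset circle R})] | a in val D]%fset.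

Lemma image_chord x y : [fset x; y]%fset \in val D -> [fset h x; h y]%fset \in val D'.
Proof.
move=> xyD; rewrite D'E; apply/imfsetP; exists [fset x; y]%fset => //=.
apply/fsetP => t; apply/fset2P/imfsetP => [[->|->]|[u]].
- by exists x => //; rewrite fset21.
- by exists y => //; rewrite fset22.
- by move=> /= /fset2P[->|->] ->; [left|right].
Qed.

Lemma image_ends : ends D' = [fset h x | x in ends D]%fset.
Proof.
apply/fsetP => t; apply/endsP/imfsetP => [[a]|[x /= /endsP[a aD xa] ->]].
  rewrite D'E => /imfsetP[b /= bD ->] /imfsetP[x /= xb ->].
  by exists x => //; apply/endsP; exists b.
exists [fset h x | x in a]%fset; last by apply/imfsetP; exists x.
by rewrite D'E; apply/imfsetP; exists a.
Qed.

Lemma image_ends_from p : ends_from D' (h p) = map h (ends_from D p).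
Proof.
apply/esym/ends_fromP.
  apply: uniq_perm => [||t].
  - rewrite map_inj_uniq; last exact: diffeo_inj.
    by rewrite (perm_uniq (perm_ends_from D p)) fset_uniq.
  - exact: fset_uniq.
  - rewrite image_ends; apply/mapP/imfsetP => -[x xD ->]; exists x => //=.
      by rewrite -(mem_ends_from D p).
    by rewrite mem_ends_from.
rewrite sorted_map; apply: sub_sorted (sorted_ends_from D p) => x y /=.
by rewrite diffeo_arc_le.
Qed.

Lemma image_value (A : comNzRingType) c (w : forall m, 'S_m -> A) x0 :
  so_relations c w -> (forall x : A, x + x = 0 -> x = 0) ->
  diagram_value w x0 D = diagram_value w x0 D'.
Proof.
move=> w_so A2; rewrite /diagram_value (word_value_cut w_so A2 x0 D' x0 (h x0)).
rewrite image_ends_from; apply/esym/map_word_value.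
- exact/involutes_permutes/partner_involutes/perm_ends_from.
- by move=> x y _ _; apply: diffeo_inj.
- move=> x; rewrite mem_ends_from => /chord_partner/image_chord.
  exact: partner_chord.
Qed.

End Image.
End Diffeomorphism.

Theorem theorem2p3 (R : realType) :
  (exists! w : forall m : nat, 'S_m -> coef_ring R, so_relations (@Cvar R) w) /\
  (forall w : forall m : nat, 'S_m -> coef_ring R, so_relations (@Cvar R) w ->
     exists f : chord_diagram R -> coef_ring R,
       (forall (D : chord_diagram R) (p : circle R), p \notin ends D ->
          f D = w (nchords D).*2 (cut_perm D p)) /\
       weight_system f).
Proof.
have x0 : circle R by exists 0; rewrite lexx ltr01.
split.
  have [w w_so] := so_relations_ex R; exists w; split=> // w' w'_so.
  apply: boolp.functional_extensionality_dep => m; apply/funext => s.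
  exact: so_relations_uniq.
move=> w w_so; exists (diagram_value w x0); split=> [D p _|].
  exact: (diagram_value_cut w_so (@coef_ring_half R)).
split=> [D D' [h h_diffeo D'E]|].
  exact: (image_value h_diffeo D'E x0 w_so (@coef_ring_half R)).
exact: (diagram_value_four_term w_so (@coef_ring_half R)).
Qed.
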